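(* Let $\lambda>0$, $\ell>0$, let $\gamma\in A_\ell$ be a penalized pinned elastica and let $\tilde\gamma$ denote its arclength parametrization. (i) If $0<\lambda\ell^2<\hat\lambda$ and $\tilde\gamma=\gamma_{\rm larc}^{\lambda,\ell,1}$, then $\gamma$ is stable. (ii) If $0<\lambda\ell^2<\hat\lambda$ and $\tilde\gamma=\gamma_{\rm sarc}^{\lambda,\ell,1}$, then $\gamma$ is unstable. (iii) If $\lambda\ell^2=\hat\lambda$ and $\tilde\gamma=\gamma_{\rm sarc}^{\lambda,\ell,1}=\gamma_{\rm larc}^{\lambda,\ell,1}$, then $\gamma$ is unstable. (iv) If $\tilde\gamma=\gamma_{\rm loop}^{\lambda,\ell,1}$, then $\gamma$ is unstable.
   Context: Elliptic functions: for $q\in[0,1)$, $x\in\mathbb{R}$, $\mathrm{F}(x,q)=\int_0^x(1-q^2\sin^2\theta)^{-1/2}\,d\theta$, $\mathrm{E}(x,q)=\int_0^x(1-q^2\sin^2\theta)^{1/2}\,d\theta$, $\mathrm{K}(q)=\mathrm{F}(\pi/2,q)$, $\mathrm{E}(q)=\mathrm{E}(\pi/2,q)$; $\mathrm{am}(\cdot,q)$ is the inverse of $x\mapsto\mathrm{F}(x,q)$, $\mathrm{cn}(x,q)=\cos\mathrm{am}(x,q)$. The function $q\mapsto2\mathrm{E}(q)-\mathrm{K}(q)$ is strictly decreasing on $[0,1)$ with unique zero $q_*\in(0,1)$. On $[1/\sqrt2,1)$ let $f(q)=(4q^4-5q^2+1)\mathrm{K}(q)+(-8q^4+8q^2-1)\mathrm{E}(q)$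 and $g(q)=8(2\mathrm{E}(q)-\mathrm{K}(q))^2(2q^2-1)$. $f$ has a unique zero $\hat q\in[1/\sqrt2,1)$ (in $(1/\sqrt2,q_* )$); $\hat\lambda:=g(\hat q)\approx0.70107$. $g(1/\sqrt2)=0$, $g$ is strictly increasing on $[1/\sqrt2,\hat q]$, strictly decreasing on $[\hat q,q_*]$ with $g(q_* )=0$, strictly increasing on $[q_*,1)$ with $g\to\infty$ at $1$. For $c\in(0,\hat\lambda]$ let $q_1(c)\in(1/\sqrt2,\hat q]$, $q_2(c)\in[\hat q,q_* )$ be the solutions of $g(q)=c$ in these intervals; for every $c>0$ let $q_3(c)$ be the unique solution of $g(q)=c$ in $(q_*,1)$. Setting: $A_\ell=\{\gamma\in W^{2,2}(0,1;\mathbb{R}^2): |\gamma'|\neq0$ on $[0,1]$, $\gamma(0)=(0,0),\ \gamma(1)=(\ell,0)\}$; $\mathcal{E}_\lambda[\gamma]=\int_\gamma k^2\,ds+\lambda L[\gamma]$. A penalized pinned elastica is $\gamma\in A_\ell$ with $\frac{d}{d\varepsilon}\mathcal{E}_\lambda[\gamma+\varepsilon\eta]|_{\varepsilon=0}=0$ for all $\eta\in W^{2,2}(0,1;\mathbb{R}^2)\cap W^{1,2}_0(0,1;\mathbb{R}^2)$. It is stable if it is a local minimizer of $\mathcal{E}_\lambda$ in $A_\ell$ w.r.t. the $W^{2,2}$-norm, and unstable otherwise. Curves (arclength parametrized on $[0,2\mathrm{K}(q)/\alpha]$), for $\lambda\ell^2\le\hat\lambda$: $\gamma_{\rm sarc}^{\lambda,\ell,1}(s)=\frac1\alpha\big(2\mathrm{E}(\mathrm{am}(\alpha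 s-\mathrm{K}(q),q),q)+2\mathrm{E}(q)-\alpha s,\ 2q\,\mathrm{cn}(\alpha s-\mathrm{K}(q),q)\big)$ with $q=q_1(\lambda\ell^2)$, $\alpha=\frac{2}{\ell}(2\mathrm{E}(q)-\mathrm{K}(q))$; $\gamma_{\rm larc}^{\lambda,\ell,1}$ is the same formula with $q=q_2(\lambda\ell^2)$. For all $\lambda\ell^2>0$: $\gamma_{\rm loop}^{\lambda,\ell,1}(s)=\frac1\alpha\big(-2\mathrm{E}(\mathrm{am}(\alpha s-\mathrm{K}(q),q),q)-2\mathrm{E}(q)+\alpha s,\ 2q\,\mathrm{cn}(\alpha s-\mathrm{K}(q),q)\big)$ with $q=q_3(\lambda\ell^2)$, $\alpha=\frac{2}{\ell}(\mathrm{K}(q)-2\mathrm{E}(q))$. *)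

(* Defs.v *)
From HB Require Import structures.
From mathcomp Require Import all_boot all_order all_algebra.
From mathcomp Require Import all_classical all_reals all_analysis.
Set Implicit Arguments. Unset Strict Implicit. Unset Printing Implicit Defensive.
Import Order.TTheory GRing.Theory Num.Theory.
Import numFieldNormedType.Exports.
Local Open Scope classical_set_scope.
Local Open Scope ring_scope.

Section Elastica.
Variable R : realType.
Local Notation mu := (@lebesgue_measure R).
Local Notation pt := (R * R)%type.

Definition oint (a b : R) (f : R -> R) : R :=
  if a <= b then \int[mu]_(x in `[a, b]) f x
  else - \int[mu]_(x in `[b, a]) f x.

Definition ellF (x q : R) : R :=
  oint 0 x (fun t => (Num.sqrt (1 - q ^+ 2 * (sin t) ^+ 2))^-1).
Definition ellE (x q : R) : R :=
  oint 0 x (fun t => Num.sqrt (1 - q ^+ 2 * (sin t) ^+ 2)).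
Definition ellK (q : R) : R := ellF (pi / 2) q.
Definition ellEc (q : R) : R := ellE (pi / 2) q.
Definition am (u q : R) : R := xget 0 [set x | ellF x q = u].
Definition cn (u q : R) : R := cos (am u q).

Definition fq (q : R) : R :=
  (4 * q ^+ 4 - 5 * q ^+ 2 + 1) * ellK q + (- 8 * q ^+ 4 + 8 * q ^+ 2 - 1) * ellEc q.
Definition gq (q : R) : R :=
  8 * (2 * ellEc q - ellK q) ^+ 2 * (2 * q ^+ 2 - 1).
(* q_* : unique zero of 2E - K in (0,1) *)
Definition qstar : R := xget 0 [set q | 0 < q < 1 /\ 2 * ellEc q - ellK q = 0].
(* hat q : unique zero of f in [1/sqrt 2, 1) *)
Definition qhat : R := xget 0 [set q | (Num.sqrt 2)^-1 <= q < 1 /\ fq q = 0].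
Definition lamhat : R := gq qhat.
Definition q1 (c : R) : R := xget 0 [set q | (Num.sqrt 2)^-1 < q <= qhat /\ gq q = c].
Definition q2 (c : R) : R := xget 0 [set q | qhat <= q < qstar /\ gq q = c].
Definition q3 (c : R) : R := xget 0 [set q | qstar < q < 1 /\ gq q = c].

Definition arc_alpha (q l : R) : R := 2 / l * (2 * ellEc q - ellK q).
Definition arc_curve (q l : R) (s : R) : pt :=
  let a := arc_alpha q l in
  (a^-1 * (2 * ellE (am (a * s - ellK q) q) q + 2 * ellEc q - a * s),
   a^-1 * (2 * q * cn (a * s - ellK q) q)).
Definition arc_length (q l : R) : R := 2 * ellK q / arc_alpha q l.

Definition loop_alpha (q l : R) : R := 2 / l * (ellK q - 2 * ellEc q).
Definition loop_curve (q l : R) (s : R) : pt :=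
  let a := loop_alpha q l in
  (a^-1 * (- 2 * ellE (am (a * s - ellK q) q) q - 2 * ellEc q + a * s),
   a^-1 * (2 * q * cn (a * s - ellK q) q)).
Definition loop_length (q l : R) : R := 2 * ellK q / loop_alpha q l.

Definition sarc (lam l : R) := arc_curve (q1 (lam * l ^+ 2)) l.
Definition sarc_len (lam l : R) := arc_length (q1 (lam * l ^+ 2)) l.
Definition larc (lam l : R) := arc_curve (q2 (lam * l ^+ 2)) l.
Definition larc_len (lam l : R) := arc_length (q2 (lam * l ^+ 2)) l.
Definition loop (lam l : R) := loop_curve (q3 (lam * l ^+ 2)) l.
Definition loop_len (lam l : R) := loop_length (q3 (lam * l ^+ 2)) l.

(* [W22 g g1 g2]: g is (the continuous representative of) an element of
   W^{2,2}(0,1;R^2), g1 is its (continuous) first derivative and g2 its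
   (L^2) second weak derivative: g and g1 are absolutely continuous on [0,1]
   with derivatives g1, resp. g2, and g2 is square integrable on [0,1]. *)
Definition W22 (g g1 g2 : R -> pt) : Prop :=
  [/\ [/\ mu.-integrable `[0, 1] (EFin \o (fun t => (g1 t).1)),
          mu.-integrable `[0, 1] (EFin \o (fun t => (g1 t).2)),
          mu.-integrable `[0, 1] (EFin \o (fun t => (g2 t).1)) &
          mu.-integrable `[0, 1] (EFin \o (fun t => (g2 t).2))],
      [/\ mu.-integrable `[0, 1] (EFin \o (fun t => (g2 t).1 ^+ 2)) &
          mu.-integrable `[0, 1] (EFin \o (fun t => (g2 t).2 ^+ 2))],
      (forall t, 0 <= t <= 1 ->
         g t = ((g 0).1 + \int[mu]_(s in `[0, t]) (g1 s).1,
                (g 0).2 + \int[mu]_(s in `[0, t]) (g1 s).2)) &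
      (forall t, 0 <= t <= 1 ->
         g1 t = ((g1 0).1 + \int[mu]_(s in `[0, t]) (g2 s).1,
                 (g1 0).2 + \int[mu]_(s in `[0, t]) (g2 s).2))].

Definition speed (g1 : R -> pt) (t : R) : R :=
  Num.sqrt ((g1 t).1 ^+ 2 + (g1 t).2 ^+ 2).

Definition in_A (l : R) (g g1 : R -> pt) : Prop :=
  [/\ (forall t, 0 <= t <= 1 -> g1 t != (0, 0)), g 0 = (0, 0) & g 1 = (l, 0)].

(* E_lam[gamma] = int_gamma k^2 ds + lam L[gamma]
   = int_0^1 ( (x'y''-y'x'')^2/|gamma'|^5 + lam |gamma'| ) dt *)
Definition energy (lam : R) (g1 g2 : R -> pt) : R :=
  \int[mu]_(t in `[0, 1])
     (((g1 t).1 * (g2 t).2 - (g1 t).2 * (g2 t).1) ^+ 2 / (speed g1 t) ^+ 5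
      + lam * speed g1 t).

Definition pt_comb (u : R -> pt) (e : R) (v : R -> pt) : R -> pt :=
  fun t => ((u t).1 + e * (v t).1, (u t).2 + e * (v t).2).

Definition pp_elastica (lam : R) (g1 g2 : R -> pt) : Prop :=
  forall eta eta1 eta2 : R -> pt, W22 eta eta1 eta2 ->
    eta 0 = (0, 0) -> eta 1 = (0, 0) ->
    is_derive (0 : R) (1 : R)
      (fun e : R => energy lam (pt_comb g1 e eta1) (pt_comb g2 e eta2)) 0.

Definition W22_dist (g g1 g2 h h1 h2 : R -> pt) : R :=
  Num.sqrt (\int[mu]_(t in `[0, 1])
     (((g t).1 - (h t).1) ^+ 2 + ((g t).2 - (h t).2) ^+ 2
      + ((g1 t).1 - (h1 t).1) ^+ 2 + ((g1 t).2 - (h1 t).2) ^+ 2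
      + ((g2 t).1 - (h2 t).1) ^+ 2 + ((g2 t).2 - (h2 t).2) ^+ 2)).

Definition stable (lam l : R) (g g1 g2 : R -> pt) : Prop :=
  exists2 delta : R, 0 < delta &
    forall h h1 h2 : R -> pt, W22 h h1 h2 -> in_A l h h1 ->
      W22_dist g g1 g2 h h1 h2 < delta ->
      energy lam g1 g2 <= energy lam h1 h2.

Definition arclen (g1 : R -> pt) (t : R) : R := \int[mu]_(s in `[0, t]) speed g1 s.

Definition arclength_param_is (g g1 : R -> pt) (c : R -> pt) (Lc : R) : Prop :=
  arclen g1 1 = Lc /\ forall t, 0 <= t <= 1 -> g t = c (arclen g1 t).

End Elastica.

(* Main.v *)
Require Import Defs.
From HB Require Import structures.
From mathcomp Require Import all_boot all_order all_algebra.
From mathcomp Require Import all_classical all_reals all_analysis measurable_realfun.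
From mathcomp Require Import ring lra.
Set Implicit Arguments. Unset Strict Implicit. Unset Printing Implicit Defensive.
Import Order.TTheory GRing.Theory Num.Theory.
Import numFieldNormedType.Exports.
Local Open Scope classical_set_scope.
Local Open Scope ring_scope.

(* Up to similarity the arcs form a family indexed by [q], and the member spanning a chord of length
   [l] has energy [P q / l] with [P = C D + kap / C], [kap = lam l^2], [C = 2 E / K - 1] and
   [D = 16 K (E - (1 - q^2) K)]. One finds [P' = C' (g - kap) / C^2] with [C' < 0], and [g'] has the
   sign of [f] as long as [2 E > K]. Hence [q_1], as well as the double point [q_1 = q_2], is not a
   local minimum of [P], and neighbouring arcs are better competitors; [q_2] is a local minimum.

   For the stability of the longer arc it remains to see that arcs minimize the bending energy among
   all curves of given length [L] and chord [l]: if [C q L = l] then [\int k^2 ds >= D q / L]. Let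
   [T] be the unit tangent, [T0] its value at the middle of the curve, [c = 1 - T . T0], and
   [w = 2 p' / (p (1 - p^2))], [p = q sn]. Since [w] solves a Riccati equation,
   [k^2 + 2 om^2 T . T0] exceeds the derivative of [om w c] plus [om^2 (2 - w^2 p^4)] by a sum of
   squares; integrating and using [\int T . T0 ds <= l] gives the bound. Curves close in [W^{2,2}]
   have close lengths, so the [q] attached to a competitor is close to [q_2].

   For the loop, sliding the window along the periodically continued elastica preserves length and
   bending energy but lengthens the chord; turning and rescaling the result back to the chord [l]
   lowers the energy because [2 E < K]. *)

(** * Absolutely continuous functions on an interval *)

Section abscont.
Variable R : realType.
Local Notation mu := (@lebesgue_measure R).
Implicit Types (H h f g : R -> R) (lo hi a b c : R).

(** The parameters [q1], [q2], [q3], [qhat], [qstar] are choices with default 0, and nothing about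
    the shape of [gq] is given. The required facts are recovered where they are used: [0 < lamhat]
    makes [qhat] a genuine zero of [fq], the sign of [2 E - K] is read off the positive length of
    the given curve, and the default modulus 0 is treated on its own. The formula for [P] is
    scaling: an arc of length 1 has chord [C] and bending energy [D], and bending energy scales
    inversely to length. The weight [w] has a pole at the middle of the curve, where the phase
    passes 0. The calibration therefore leaves a gap in the phase between the two halves, uses
    [c = 0] in the middle and [w = 0] at both ends, and lets the gap close. Curves come in arbitrary
    [W^{2,2}] parametrizations, with second derivatives known almost everywhere. Calculus is
    therefore done for absolutely continuous functions with a density, composed with the arclength
    function; competitors inherit the speed of the given curve up to a constant factor. *)

Lemma integrable_sub_itv h a b c d : c <= a -> b <= d ->
  mu.-integrable `[c, d] (EFin \o h) -> mu.-integrable `[a, b] (EFin \o h).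
Proof.
move=> ca bd; apply: integrableS => //.
by apply: subset_itvScc; rewrite bnd_simp.
Qed.

Lemma Rintegral_itv_split h a b c : a <= b -> b <= c ->
  mu.-integrable `[a, c] (EFin \o h) ->
  \int[mu]_(t in `[a, c]) h t = \int[mu]_(t in `[a, b]) h t + \int[mu]_(t in `[b, c]) h t.
Proof.
move=> ab bc ih.
have := @Rintegral_itvB R h (BLeft a) (BRight c) b ih.
rewrite !bnd_simp => /(_ ab bc) /eqP; rewrite subr_eq => /eqP ->.
rewrite addrC Rintegral_itv_obnd_cbnd//.
apply: integrableS ih => //.
by apply: subset_itvScc; rewrite bnd_simp.
Qed.

Lemma within_cts_mul f g (A : set R) : {within A, continuous f} ->
  {within A, continuous g} -> {within A, continuous (fun t => f t * g t)}.
Proof. by move=> cf cg x; exact: (@continuousM R (subspace A) f g x (cf x) (cg x)). Qed.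

Lemma within_cts_add f g (A : set R) : {within A, continuous f} ->
  {within A, continuous g} -> {within A, continuous (fun t => f t + g t)}.
Proof.
by move=> cf cg x; exact: (@continuousD R R^o (subspace A) f g x (cf x) (cg x)).
Qed.

Lemma within_cts_cst r (A : set R) : {within A, continuous (fun=> r : R)}.
Proof. by apply: continuous_subspaceT => x; exact: cvg_cst. Qed.

Lemma within_cts_comp f g (A : set R) : {within A, continuous f} ->
  (forall t, A t -> {for f t, continuous g}) -> {within A, continuous (fun t => g (f t))}.
Proof.
move=> /subspace_continuousP cf cg; apply/subspace_continuousP => t At.
exact: (cvg_comp _ _ (cf t At) (cg t At)).
Qed.

Lemma within_cts_inv f (A : set R) : {within A, continuous f} ->
  (forall t, A t -> f t != 0) -> {within A, continuous (fun t => (f t)^-1)}.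
Proof.
move=> cf f0; apply: (within_cts_comp (g := fun x => x^-1)) => // t At.
by apply: inv_continuous; exact: f0.
Qed.

Lemma within_cts_integrable f a b : {within `[a, b], continuous f} ->
  mu.-integrable `[a, b] (EFin \o f).
Proof. by move=> cf; apply: continuous_compact_integrable => //; exact: segment_compact. Qed.

Lemma within_cts_bounded f a b : a <= b -> {within `[a, b], continuous f} ->
  exists2 M, 0 < M & forall t, a <= t <= b -> `|f t| <= M.
Proof.
move=> ab cf.
have cn : {within `[a, b], continuous (fun t => `|f t|)}.
  by move=> t; apply: continuous_comp; [exact: cf|exact: norm_continuous].
have [c cab fc] := EVT_max ab cn.
exists (`|f c| + 1); first by rewrite ltr_wpDl.
by move=> t tab; apply: le_trans (fc t _) _; rewrite ?in_itv// lerDl.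
Qed.

Lemma within_cts_measurable f a b : {within `[a, b], continuous f} ->
  measurable_fun `[a, b] f.
Proof. by move=> cf; apply: subspace_continuous_measurable_fun => //. Qed.

Lemma integrable_mul_cts f h a b : {within `[a, b], continuous f} ->
  mu.-integrable `[a, b] (EFin \o h) ->
  mu.-integrable `[a, b] (EFin \o (fun t => f t * h t)).
Proof.
move=> cf ih.
have [ab|ba] := leP a b; last first.
  by rewrite set_itv_ge ?bnd_simp -?ltNge//; exact: integrable_set0.
have [M M0 fM] := within_cts_bounded ab cf.
apply: eq_integrable (@integrableMr _ _ _ mu `[a, b] _ f (EFin \o h) _ _ ih) => //.
- exact: within_cts_measurable.
- exists M; split; first by rewrite num_real.
  by move=> x Mx t /=; rewrite in_itv/= => tab; rewrite (le_trans (fM _ tab)) ?ltW.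
Qed.


Lemma within_ctsP f a b : {within `[a, b], continuous f} <->
  forall t, a <= t <= b -> forall e : R, 0 < e -> exists2 d : R, 0 < d &
    forall y, a <= y <= b -> `|y - t| < d -> `|f y - f t| <= e.
Proof.
split=> [cf t tab e e0|cf].
  have /subspace_continuousP/(_ t) := cf; rewrite /= in_itv/= => /(_ tab).
  move/cvgrPdist_le => /(_ _ e0); rewrite near_withinE => -[d /= d0 Hd].
  exists d => // y yab yt; rewrite distrC; apply: Hd => /=; last by rewrite in_itv.
  by rewrite distrC.
apply/subspace_continuousP => t /=; rewrite in_itv/= => tab.
apply/cvgrPdist_le => e e0.
have [d d0 Hd] := cf t tab e e0.
rewrite near_withinE; exists d => //= y /= yt; rewrite in_itv/= => yab.
by rewrite distrC Hd// distrC.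
Qed.

(** The supremum of the points whose value is at least [N a] belongs to them by the left half of the
    local hypothesis, and by the right half it cannot lie below [b]. Each half compares only with
    the centre [t], which is all that a derivative at [t] can provide. *)
Lemma locally_nondecreasing_le (lo hi : R) (N : R -> R) :
  (forall t, lo <= t <= hi -> exists2 d : R, 0 < d & forall y, lo <= y <= hi ->
     (t <= y < t + d -> N t <= N y) /\ (t - d < y <= t -> N y <= N t)) ->
  forall a b, lo <= a -> a <= b -> b <= hi -> N a <= N b.
Proof.
move=> HN a b a0 ab b1.
pose S := [set t | a <= t <= b /\ N a <= N t].
have Sa : S a by rewrite /S /= lexx ab.
have supS : has_sup S by split; [exists a|exists b => t [/andP[]]].
have aS : a <= sup S by apply: ub_le_sup => //; case: supS.
have Sb : sup S <= b by apply: ge_sup => //; [exists a|move=> t [/andP[]]].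
have s01 : lo <= sup S <= hi by apply/andP; split; lra.
have [d d0 Hd] := HN (sup S) s01.
have [t [St1 St2] tS] := sup_adherent d0 supS.
have tsup : t <= sup S by apply: ub_le_sup => //; case: supS.
have Ns : N a <= N (sup S).
  apply: le_trans St2 _; have [_] := Hd t ltac:(apply/andP; split; lra); apply.
  by rewrite tS tsup.
have [->//|sb] := eqVneq b (sup S).
have sltb : sup S < b by rewrite lt_neqAle eq_sym sb.
pose y := Num.min b (sup S + d / 2).
have ys : sup S < y by rewrite lt_min sltb/= ltrDl divr_gt0.
have yb : y <= b by rewrite ge_min lexx.
have yd : y < sup S + d by rewrite gt_min; apply/orP; right; lra.
have /(ub_le_sup supS.2) : S y.
  split; first by apply/andP; split; lra.
  apply: le_trans Ns _; have [+ _] := Hd y ltac:(apply/andP; split; lra); apply.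
  by rewrite yd ltW.
by lra.
Qed.

(** Absolute continuity with a prescribed density, the form in which [W22] provides derivatives. The
    density is determined only almost everywhere, so pointwise statements about it need a separate
    argument. *)
Definition abscont lo hi H h := mu.-integrable `[lo, hi] (EFin \o h) /\
  forall a b, lo <= a -> a <= b -> b <= hi -> H b - H a = \int[mu]_(t in `[a, b]) h t.

Lemma AC_primitive lo hi H h : mu.-integrable `[lo, hi] (EFin \o h) ->
  (forall t, lo <= t <= hi -> H t = H lo + \int[mu]_(s in `[lo, t]) h s) -> abscont lo hi H h.
Proof.
move=> ih Hh; split=> // a b a0 ab b1.
rewrite (Hh a) ?(Hh b); try by apply/andP; split; lra.
rewrite (@Rintegral_itv_split h lo a b)//; first by ring.
exact: integrable_sub_itv ih.
Qed.

Lemma AC_integrable_sub lo hi H h a b : abscont lo hi H h -> lo <= a -> b <= hi ->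
  mu.-integrable `[a, b] (EFin \o h).
Proof. by move=> [ih _] a0 b1; exact: integrable_sub_itv ih. Qed.

Lemma AC_cts lo hi H h : abscont lo hi H h -> {within `[lo, hi], continuous H}.
Proof.
move=> [ih Hh].
have [lohi|hilo] := leP lo hi; last first.
  by rewrite set_itv_ge ?bnd_simp -?ltNge//; exact: continuous_subspace0.
have := parameterized_integral_continuous lohi ih.
move/within_ctsP => c; apply/within_ctsP => t t01 e e0.
have [d d0 Hd] := c t t01 e e0; exists d => // y y01 yt.
move: (Hd y y01 yt); rewrite /parameterized_integral.
move/andP: t01 => [t0 t1]; move/andP: y01 => [y0 y1].
rewrite -(Hh lo t)// -(Hh lo y)//.
by rewrite opprB addrA subrK.
Qed.

Lemma AC_le_norm lo hi H h a b : abscont lo hi H h -> lo <= a -> a <= b -> b <= hi ->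
  `|H b - H a| <= \int[mu]_(t in `[a, b]) `|h t|.
Proof.
move=> ACH a0 ab b1; rewrite (ACH.2)//.
by apply: le_normr_Rintegral => //; exact: AC_integrable_sub ACH _ _.
Qed.

Lemma le_Rintegral_itv f g a b :
  mu.-integrable `[a, b] (EFin \o f) -> mu.-integrable `[a, b] (EFin \o g) ->
  (forall t, a <= t <= b -> f t <= g t) ->
  \int[mu]_(t in `[a, b]) f t <= \int[mu]_(t in `[a, b]) g t.
Proof.
by move=> fi gi fg; apply: le_Rintegral => // t /=; rewrite in_itv/=; exact: fg.
Qed.

Lemma integrable_scale f a b r : mu.-integrable `[a, b] (EFin \o f) ->
  mu.-integrable `[a, b] (EFin \o (fun t => r * f t)).
Proof.
move=> fi; have : mu.-integrable `[a, b] (fun t => r%:E * (EFin \o f) t)%E.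
  exact: integrableZl.
by apply: eq_integrable.
Qed.

Lemma integrable_add f g a b :
  mu.-integrable `[a, b] (EFin \o f) -> mu.-integrable `[a, b] (EFin \o g) ->
  mu.-integrable `[a, b] (EFin \o (fun t => f t + g t)).
Proof.
move=> fi gi; have : mu.-integrable `[a, b] ((EFin \o f) \+ (EFin \o g))%E.
  exact: integrableD.
by apply: eq_integrable.
Qed.

Lemma integrable_lin f g a b r s :
  mu.-integrable `[a, b] (EFin \o f) -> mu.-integrable `[a, b] (EFin \o g) ->
  mu.-integrable `[a, b] (EFin \o (fun t => r * f t + s * g t)).
Proof. by move=> fi gi; apply: integrable_add; exact: integrable_scale. Qed.

Lemma Rintegral_lin f g a b r s :
  mu.-integrable `[a, b] (EFin \o f) -> mu.-integrable `[a, b] (EFin \o g) ->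
  \int[mu]_(t in `[a, b]) (r * f t + s * g t) =
  r * \int[mu]_(t in `[a, b]) f t + s * \int[mu]_(t in `[a, b]) g t.
Proof.
by move=> fi gi; rewrite RintegralD ?RintegralZl//; exact: integrable_scale.
Qed.

Lemma eq_Rintegral_itv f g a b : (forall t, a <= t <= b -> f t = g t) ->
  \int[mu]_(t in `[a, b]) f t = \int[mu]_(t in `[a, b]) g t.
Proof. by move=> fg; apply: eq_Rintegral => t; rewrite inE/= in_itv/=; exact: fg. Qed.

Lemma eq_integrable_itv f g a b : (forall t, a <= t <= b -> f t = g t) ->
  mu.-integrable `[a, b] (EFin \o f) -> mu.-integrable `[a, b] (EFin \o g).
Proof.
by move=> fg; apply: eq_integrable => // t; rewrite inE/= in_itv/= => /fg ->.
Qed.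


Lemma integrable_normr f a b : mu.-integrable `[a, b] (EFin \o f) ->
  mu.-integrable `[a, b] (EFin \o (fun t => `|f t|)).
Proof. by move=> fi; exact: integrable_norm fi. Qed.

Lemma AC_scale lo hi H h r : abscont lo hi H h -> abscont lo hi (fun t => r * H t) (fun t => r * h t).
Proof.
move=> [ih Hh]; split; first exact: integrable_scale.
move=> a b a0 ab b1; rewrite -mulrBr (Hh a b)// RintegralZl//.
exact: integrable_sub_itv ih.
Qed.

Lemma AC_add lo hi H h G g : abscont lo hi H h -> abscont lo hi G g -> abscont lo hi (fun t => H t + G t) (fun t => h t + g t).
Proof.
move=> [ih Hh] [ig Gg]; split; first exact: integrable_add.
move=> a b a0 ab b1; rewrite RintegralD// -?(Hh a b)// -?(Gg a b)//.
- by ring.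
- exact: integrable_sub_itv ih.
- exact: integrable_sub_itv ig.
Qed.

Lemma AC_ext lo hi H h G g : (forall t, lo <= t <= hi -> H t = G t) ->
  (forall t, lo <= t <= hi -> h t = g t) -> abscont lo hi H h -> abscont lo hi G g.
Proof.
move=> HG hg [ih Hh]; split; first exact: eq_integrable_itv ih.
move=> a b a0 ab b1; rewrite -!HG; try by apply/andP; split; lra.
rewrite Hh//; apply: eq_Rintegral_itv => t /andP[ta tb].
by apply: hg; apply/andP; split; lra.
Qed.

(** No differentiation almost everywhere is involved. The defect [D] between [phi (H t)] and its
    expected primitive changes near each point by at most [e] times the increment of [M], the
    integral of [|h|]. Hence [e * M - D] and [e * M + D] are nondecreasing, and [e] tends to 0. *)
Lemma AC_comp lo hi H h (phi dphi : R -> R) : abscont lo hi H h ->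
  (forall t, lo <= t <= hi -> is_derive (H t) 1 phi (dphi (H t))) ->
  {within `[lo, hi], continuous (fun t => dphi (H t))} ->
  abscont lo hi (fun t => phi (H t)) (fun t => dphi (H t) * h t).
Proof.
move=> ACH dp cd; have [ih Hh] := ACH.
have idh : mu.-integrable `[lo, hi] (EFin \o (fun t => dphi (H t) * h t)).
  exact: integrable_mul_cts.
split=> // a b a0 ab b1.
have inh : mu.-integrable `[lo, hi] (EFin \o (fun t => `|h t|)) by exact: integrable_normr.
pose D t := phi (H t) - \int[mu]_(s in `[lo, t]) (dphi (H s) * h s).
pose M t := \int[mu]_(s in `[lo, t]) `|h s|.
have split01 f : mu.-integrable `[lo, hi] (EFin \o f) -> forall x y, lo <= x -> x <= y -> y <= hi ->
    \int[mu]_(s in `[lo, y]) f s - \int[mu]_(s in `[lo, x]) f s = \int[mu]_(s in `[x, y]) f s.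
  move=> fi x y x0 xy y1; rewrite (@Rintegral_itv_split f lo x y)//; first by ring.
  exact: integrable_sub_itv fi.
(* The intervals have [t] as an endpoint because the Caratheodory slope [G] compares [phi (H y)]
   only with [phi (H t)]. Half of [e] pays for the slope, half for the oscillation of
   [dphi (H s)]. *)
have key e : 0 < e -> forall t, lo <= t <= hi -> exists2 d : R, 0 < d &
    forall x y, lo <= x -> x <= y -> y <= hi -> x = t \/ y = t -> t - d < x -> y < t + d ->
    `|D y - D x| <= e * (M y - M x).
  move=> e0 t t01.
  have e20 : 0 < e / 2 by rewrite divr_gt0.
  have /is_derive1_caratheodory [G [HG cG Gt]] := dp t t01.
  have [d1 d10 Hd1] := (within_ctsP _ _ _).1 cd t t01 _ e20.
  have /cvgrPdist_le /(_ _ e20) := cG; rewrite near_simpl => -[d2 /= d20 Hd2].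
  have d220 : 0 < d2 / 2 by rewrite divr_gt0.
  have [d3 d30 Hd3] := (within_ctsP _ _ _).1 (AC_cts ACH) t t01 _ d220.
  exists (Num.min d1 d3); first by rewrite lt_min d10.
  move=> x y x0 xy y1 xyt tx yt.
  have near_t z : x <= z <= y -> `|z - t| < d1 /\ `|z - t| < d3.
    move=> /andP[xz zy].
    suff : `|z - t| < Num.min d1 d3 by rewrite lt_min => /andP[].
    by rewrite ltr_distl; apply/andP; split; lra.
  have in01 z : x <= z <= y -> lo <= z <= hi.
    by move=> /andP[xz zy]; rewrite (le_trans x0 xz)/=; exact: le_trans zy y1.
  have xI : x <= x <= y by rewrite lexx xy.
  have yI : x <= y <= y by rewrite lexx xy.
  have Gbd z : x <= z <= y -> `|G (H z) - dphi (H t)| <= e / 2.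
    move=> xzy; rewrite distrC -Gt; apply: Hd2; rewrite /ball_/= distrC.
    by apply: le_lt_trans (Hd3 _ (in01 _ xzy) (near_t _ xzy).2) _; lra.
  have ihxy : mu.-integrable `[x, y] (EFin \o h) by exact: AC_integrable_sub ACH _ _.
  have idxy : mu.-integrable `[x, y] (EFin \o (fun t => dphi (H t) * h t)).
    exact: integrable_sub_itv idh.
  have MI : M y - M x = \int[mu]_(s in `[x, y]) `|h s| by apply: split01.
  have HI : `|H y - H x| <= M y - M x by rewrite MI; exact: (AC_le_norm ACH).
  have inc : `|phi (H y) - phi (H x) - dphi (H t) * (H y - H x)| <= e / 2 * (M y - M x).
    have [z zI ->] : exists2 z, x <= z <= y &
        phi (H y) - phi (H x) = G (H z) * (H y - H x).
      case: xyt => E; first by exists y => //; rewrite E; exact: HG.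
      by exists x => //; rewrite E -opprB HG; ring.
    rewrite -mulrBl normrM; apply: ler_pM => //; exact: Gbd.
  have intb : `|\int[mu]_(s in `[x, y]) (dphi (H s) * h s) - dphi (H t) * (H y - H x)|
      <= e / 2 * (M y - M x).
    rewrite (Hh x y)// -RintegralZl// -RintegralB//; last exact: integrable_scale.
    have iB : mu.-integrable `[x, y] (EFin \o (fun s => dphi (H s) * h s - dphi (H t) * h s)).
      have := integrable_lin 1 (-1) idxy (integrable_scale (dphi (H t)) ihxy).
      by apply: eq_integrable_itv => s _; ring.
    apply: le_trans (le_normr_Rintegral _ _) _ => //.
    rewrite MI -RintegralZl//; last exact: integrable_normr.
    apply: le_Rintegral_itv.
    - exact: integrable_normr.
    - by apply: integrable_scale; exact: integrable_normr.
    - move=> s sI; rewrite -mulrBl normrM ler_wpM2r//.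
      by apply: Hd1; [exact: in01|exact: (near_t _ sI).1].
  have -> : D y - D x = (phi (H y) - phi (H x) - dphi (H t) * (H y - H x)) -
      (\int[mu]_(s in `[x, y]) (dphi (H s) * h s) - dphi (H t) * (H y - H x)).
    by rewrite /D -(split01 _ idh x y)//; ring.
  by apply: le_trans (ler_normB _ _) _; move: inc intb; clear; lra.
have fin e : 0 < e -> `|D b - D a| <= e * (M b - M a).
  move=> e0.
  have P1 : e * M a - D a <= e * M b - D b.
    apply: (@locally_nondecreasing_le lo hi (fun t => e * M t - D t)) => // t t01.
    have [d d0 Hd] := key e e0 t t01; exists d => // y /andP[y0 y1].
    move: (t01) => /andP[t0 t1]; split=> /andP[h1 h2].
      have := Hd t y t0 h1 y1 (or_introl erefl) ltac:(lra) h2.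
      by rewrite ler_norml => /andP[_]; clear; lra.
    have := Hd y t y0 h2 t1 (or_intror erefl) h1 ltac:(lra).
    by rewrite ler_norml => /andP[_]; clear; lra.
  have P2 : e * M a + D a <= e * M b + D b.
    apply: (@locally_nondecreasing_le lo hi (fun t => e * M t + D t)) => // t t01.
    have [d d0 Hd] := key e e0 t t01; exists d => // y /andP[y0 y1].
    move: (t01) => /andP[t0 t1]; split=> /andP[h1 h2].
      have := Hd t y t0 h1 y1 (or_introl erefl) ltac:(lra) h2.
      by rewrite ler_norml => /andP[+ _]; clear; lra.
    have := Hd y t y0 h2 t1 (or_intror erefl) h1 ltac:(lra).
    by rewrite ler_norml => /andP[+ _]; clear; lra.
  by rewrite ler_norml; move: P1 P2; clear => P1 P2; apply/andP; split; lra.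
have M0 : 0 <= M b - M a.
  by rewrite /M split01//; apply: Rintegral_ge0.
have D0 : D b - D a = 0.
  apply/eqP; rewrite -normr_eq0 eq_le normr_ge0 andbT.
  apply/ler_addgt0Pr => e e0; rewrite add0r.
  have q0 : 0 < e / (M b - M a + 1) by rewrite divr_gt0// ltr_wpDl.
  apply: le_trans (fin _ q0) _.
  by rewrite mulrAC ler_pdivrMr ?ler_pM2l//; move: M0; clear; lra.
by move: D0; rewrite /D -(split01 _ idh a b)//; clear; lra.
Qed.


Lemma AC_cst lo hi r : abscont lo hi (fun=> r) (fun=> 0).
Proof.
have i0 : mu.-integrable `[lo, hi] (EFin \o (fun=> 0 : R)).
  by apply: within_cts_integrable; apply: continuous_subspaceT => x; exact: cvg_cst.
by split=> // a b _ _ _; rewrite subrr Rintegral_cst// mul0r.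
Qed.

Lemma AC_id lo hi : abscont lo hi id (fun=> 1).
Proof.
have i1 : mu.-integrable `[lo, hi] (EFin \o (fun=> 1 : R)).
  by apply: within_cts_integrable; apply: continuous_subspaceT => x; exact: cvg_cst.
split=> // a b a0 ab b1; rewrite Rintegral_cst//= lebesgue_measure_itv/= mul1r lte_fin.
by have [//|ba] := ltP a b; rewrite /=; apply/eqP; rewrite subr_eq0 eq_le ab ba.
Qed.

Lemma AC_sqr lo hi H h : abscont lo hi H h -> abscont lo hi (fun t => H t ^+ 2) (fun t => 2 * H t * h t).
Proof.
move=> ACH.
apply: (AC_comp (phi := fun x => x ^+ 2) (dphi := fun x => 2 * x)) => //.
  by move=> t _; apply: is_derive_eq; rewrite /GRing.scale/=; ring.
by apply: within_cts_mul; [exact: within_cts_cst|exact: AC_cts ACH].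
Qed.

(** Polarization: [H G] is half of [(H + G)^2 - H^2 - G^2], so the product rule reduces to the chain
    rule for the square. *)
Lemma AC_mul lo hi H h G g : abscont lo hi H h -> abscont lo hi G g ->
  abscont lo hi (fun t => H t * G t) (fun t => H t * g t + h t * G t).
Proof.
move=> ACH ACG.
have S := AC_sqr (AC_add ACH ACG).
have D := AC_add (AC_scale (1/2) S)
  (AC_add (AC_scale (- 1/2) (AC_sqr ACH)) (AC_scale (- 1/2) (AC_sqr ACG))).
by apply: AC_ext D => t _; field.
Qed.

Lemma AC_restrict lo hi a b H h : lo <= a -> b <= hi -> abscont lo hi H h ->
  abscont a b H h.
Proof.
move=> la bh [ih Hh]; split; first exact: integrable_sub_itv ih.
by move=> c d ac cd db; apply: Hh => //; [exact: le_trans ac|exact: le_trans bh].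
Qed.

(** Lebesgue differentiation, applied to the density extended by 0 outside [[0, 1]]; inside, the
    extension [h0] has the same primitive. *)
Lemma AC_ae_derive H h : abscont 0 1 H h -> {ae mu, forall t : R, 0 < t < 1 -> is_derive t 1 H (h t)}.
Proof.
move=> [ih Hh].
pose h0 := h \_ `[0, 1].
have loc := integrable_locally (measurable_itv `[0, 1]) ih.
have := lebesgue_differentiation loc.
apply: filterS; first exact: (ae_filter_ringOfSetsType mu).
move=> t lt /andP[t0 t1].
have ih0 : mu.-integrable `[0, 1] (EFin \o h0).
  apply: eq_integrable_itv ih => s s01; rewrite /h0 patchE mem_set//= in_itv.
have /= FTC1 := FTC1_lebesgue_pt t1 ih0.
have [|dF F't] := FTC1 _ lt; first by rewrite lte_fin.
have dF' : is_derive t 1 (fun y => \int[mu]_(s in `[0, y]) h0 s) (h t).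
  apply: DeriveDef => //; rewrite -derive1E F't /h0 patchE mem_set//= in_itv/=.
  by rewrite !ltW.
have dF2 : is_derive t 1 (fun y => H 0 + \int[mu]_(s in `[0, y]) h0 s) (h t).
  have := @is_deriveD _ _ _ (cst (H 0)) _ t 1 _ _ (is_derive_cst _ _ _) dF'.
  by rewrite add0r.
apply: near_eq_is_derive dF2.
near=> y.
have y0 : 0 < y by near: y; exact: lt_nbhsr.
have y1 : y < 1 by near: y; exact: lt_nbhsl.
have -> : \int[mu]_(s in `[0, y]) h0 s = \int[mu]_(s in `[0, y]) h s.
  apply: eq_Rintegral_itv => s /andP[s0 sy]; rewrite /h0 patchE mem_set//= in_itv/= s0/=.
  by rewrite (le_trans sy)// ltW.
by rewrite -(Hh 0 y (lexx 0) (ltW y0) (ltW y1)) addrC subrK.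
Unshelve. all: by end_near. Qed.

Lemma AC_deriv_unique H h h' : abscont 0 1 H h -> abscont 0 1 H h' ->
  {ae mu, forall t : R, 0 < t < 1 -> h t = h' t}.
Proof.
move=> /AC_ae_derive a1 /AC_ae_derive a2; apply: filterS2 a1 a2.
  exact: (ae_filter_ringOfSetsType mu).
move=> t + + t01 => /(_ t01) d1 /(_ t01) d2.
by rewrite -(@derive_val _ _ _ _ _ _ _ d1) -(@derive_val _ _ _ _ _ _ _ d2).
Qed.

End abscont.

(** * Elliptic integrals and the amplitude function *)

Section Elliptic.
Variable R : realType.
Local Notation mu := (@lebesgue_measure R).
Implicit Types (q x y u t r : R) (f g : R -> R).

Lemma is_derive_ext f g x (a b : R) : is_derive x 1 f a -> f =1 g -> a = b ->
  is_derive x 1 g b.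
Proof. by move=> d /funext <- <-. Qed.

Lemma isder_cst r x : is_derive x 1 (fun=> r) 0.
Proof. exact: is_derive_cst. Qed.

Lemma isder_add f g x (a b : R) : is_derive x 1 f a -> is_derive x 1 g b ->
  is_derive x 1 (fun z => f z + g z) (a + b).
Proof. by move=> da db; exact: is_deriveD. Qed.

Lemma isder_mul f g x (a b : R) : is_derive x 1 f a -> is_derive x 1 g b ->
  is_derive x 1 (fun z => f z * g z) (a * g x + f x * b).
Proof.
move=> da db; have := is_deriveM da db; move/is_derive_ext; apply=> //.
by rewrite /GRing.scale/= addrC [g x * a]mulrC.
Qed.

Lemma isder_scale r f x (a : R) : is_derive x 1 f a -> is_derive x 1 (fun z => r * f z) (r * a).
Proof.
by move=> /(isder_mul (isder_cst r x)) /is_derive_ext; apply=> //; rewrite mul0r add0r.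
Qed.

Lemma isder_sub f g x (a b : R) : is_derive x 1 f a -> is_derive x 1 g b ->
  is_derive x 1 (fun z => f z - g z) (a - b).
Proof. by move=> da db; exact: is_deriveB. Qed.

Lemma isder_inv f x (a : R) : f x != 0 -> is_derive x 1 f a ->
  is_derive x 1 (fun z => (f z)^-1) (- a / f x ^+ 2).
Proof.
move=> f0 da; have := is_deriveV f0 da; move/is_derive_ext; apply=> //.
by rewrite /GRing.scale/= !mulNr mulrC.
Qed.

Lemma isder_comp f g x (a b : R) : is_derive (g x) 1 f a -> is_derive x 1 g b ->
  is_derive x 1 (fun z => f (g z)) (a * b).
Proof. by move=> da db; exact: is_derive1_comp. Qed.

Lemma derive_continuous f x df : is_derive x 1 f df -> {for x, continuous f}.
Proof. by move=> d; apply/differentiable_continuous/derivable1_diffP. Qed.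

Lemma is_derive_oint f x : continuous f -> is_derive x 1 (fun y => oint 0 y f) (f x).
Proof.
move=> cf.
(* A base point to the left of both 0 and [x] turns [oint 0 y], for [y] near [x], into a difference
   of two ordinary integrals whatever the sign of [y]. *)
pose a : R := Num.min x 0 - 1.
have a0 : a < 0.
  by rewrite /a ltrBlDr add0r gt_min; apply/orP; right; exact: ltr01.
have ax : a < x by rewrite /a ltrBlDr gt_min; apply/orP; left; rewrite ltrDl.
have fi c d : mu.-integrable `[c, d] (EFin \o f).
  by apply: within_cts_integrable; exact: continuous_subspaceT.
have x1 : x < x + 1 by rewrite ltrDl.
have [dF F'x] := continuous_FTC1_closed x1 (fi a (x + 1)) ax (cf x).
have d1 : is_derive x 1 (fun y => \int[mu]_(t in `[a, y]) f t) (f x).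
  by apply: DeriveDef; [exact: dF|rewrite -derive1E].
have d2 : is_derive x 1 (fun y => \int[mu]_(t in `[a, y]) f t - \int[mu]_(t in `[a, 0]) f t) (f x).
  by apply: is_derive_eq; rewrite subr0.
apply: near_eq_is_derive d2; near=> y.
have ay : a < y by near: y; exact: lt_nbhsr.
rewrite /oint; case: ifPn => [y0|]; last rewrite -ltNge => y0.
  by rewrite (@Rintegral_itv_split R f a 0 y (ltW a0) y0)// addrC addKr.
by rewrite (@Rintegral_itv_split R f a y 0 (ltW ay) (ltW y0))// opprD addrA subrr add0r.
Unshelve. all: by end_near. Qed.

Lemma oint00 f : oint 0 0 f = 0.
Proof. by rewrite /oint lexx set_itv1 Rintegral_set1. Qed.

(** Legendre's delta amplitude, the integrand of [ellE] and the reciprocal of that of [ellF]. *)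
Definition delta q t := Num.sqrt (1 - q ^+ 2 * sin t ^+ 2).

Lemma delta_sqr_gt0 q t : 0 <= q < 1 -> 0 < 1 - q ^+ 2 * sin t ^+ 2.
Proof.
move=> /andP[q0 q1]; rewrite subr_gt0.
have s1 : sin t ^+ 2 <= 1 by rewrite sin2cos2 gerBl sqr_ge0.
have q2 : q ^+ 2 < 1 by rewrite expr_lt1.
by apply: le_lt_trans q2; rewrite ler_piMr ?sqr_ge0.
Qed.

Lemma delta_gt0 q t : 0 <= q < 1 -> 0 < delta q t.
Proof. by move=> q01; rewrite sqrtr_gt0 delta_sqr_gt0. Qed.

Lemma delta_sqr q t : 0 <= q < 1 -> delta q t ^+ 2 = 1 - q ^+ 2 * sin t ^+ 2.
Proof. by move=> q01; rewrite sqr_sqrtr// ltW// delta_sqr_gt0. Qed.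

Lemma delta_le1 q t : 0 <= q < 1 -> delta q t <= 1.
Proof.
move=> q01; rewrite -(@ler_pXn2r _ 2)// ?nnegrE ?(ltW (delta_gt0 _ _))//.
by rewrite expr1n delta_sqr// gerBl mulr_ge0 ?sqr_ge0.
Qed.

Lemma is_derive_delta q t : 0 <= q < 1 ->
  is_derive t 1 (delta q) (- (q ^+ 2 * sin t * cos t) / delta q t).
Proof.
move=> q01; have p := delta_sqr_gt0 t q01.
have d1 : is_derive t 1 (fun t => 1 - q ^+ 2 * sin t ^+ 2) (- (2 * (q ^+ 2 * sin t * cos t))).
  by apply: is_derive_eq; rewrite /GRing.scale/=; ring.
have := @is_derive1_comp _ Num.sqrt (fun t => 1 - q ^+ 2 * sin t ^+ 2) t _ _ (is_derive1_sqrt p) d1.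
move/is_derive_ext; apply=> //; rewrite -/(delta q t); have := delta_gt0 t q01.
by move=> d0; field; rewrite gt_eqF.
Qed.

Lemma delta_cts q : 0 <= q < 1 -> continuous (delta q).
Proof. by move=> q01 t; exact: derive_continuous (is_derive_delta t q01). Qed.

Lemma deltaV_cts q : 0 <= q < 1 -> continuous (fun t => (delta q t)^-1).
Proof.
move=> q01 t; apply: continuous_comp; first exact: delta_cts.
by apply: inv_continuous; rewrite gt_eqF// delta_gt0.
Qed.

Lemma is_derive_ellE q x : 0 <= q < 1 -> is_derive x 1 (fun z => ellE z q) (delta q x).
Proof. by move=> q01; exact: is_derive_oint (delta_cts q01). Qed.

Lemma is_derive_ellF q x : 0 <= q < 1 -> is_derive x 1 (fun z => ellF z q) (delta q x)^-1.
Proof. by move=> q01; exact: is_derive_oint (deltaV_cts q01). Qed.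

Lemma ellE0 q : ellE 0 q = 0. Proof. exact: oint00. Qed.
Lemma ellF0 q : ellF 0 q = 0. Proof. exact: oint00. Qed.

Lemma deltaN q t : delta q (- t) = delta q t.
Proof. by rewrite /delta sinN sqrrN. Qed.

Lemma deltaDpi q t : delta q (t + pi) = delta q t.
Proof. by rewrite /delta sinDpi sqrrN. Qed.

Section primitive_symmetry.
Variables (F f : R -> R).
Hypothesis dF : forall x, is_derive x 1 F (f x).
Hypothesis F0 : F 0 = 0.

Lemma primitive_odd : (forall x, f (- x) = f x) -> forall x, F (- x) = - F x.
Proof.
move=> fN x; apply/eqP; rewrite -addr_eq0; apply/eqP.
have d (y : R) : is_derive y 1 (fun z => F (- z) + F z) 0.
  have dN := @is_derive1_comp _ F -%R y _ _ (dF (- y)) (is_deriveNid y 1).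
  have := @is_deriveD _ _ _ (F \o -%R) F y 1 _ _ dN (dF y).
  by move/is_derive_ext; apply=> //; rewrite fN; ring.
by rewrite (is_derive_0_is_cst x 0 d) oppr0 F0 addr0.
Qed.

(** [F (x + p) - F x] has derivative 0; its constant value is read off at [x = - p / 2], where
    oddness applies. *)
Lemma primitive_shift p : (forall x, f (- x) = f x) -> (forall x, f (x + p) = f x) ->
  forall x, F (x + p) = F x + 2 * F (p / 2).
Proof.
move=> fN fp x.
have d (y : R) : is_derive y 1 (fun z => F (z + p) - F z) 0.
  have ds : is_derive y 1 (fun z => z + p) 1 by apply: is_derive_eq; rewrite addr0.
  have dc := @is_derive1_comp _ F (fun z => z + p) y _ _ (dF (y + p)) ds.
  have := @is_deriveB _ _ _ (F \o (fun z => z + p)) F y 1 _ _ dc (dF y).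
  by move/is_derive_ext; apply=> //; rewrite fp; ring.
have := is_derive_0_is_cst x (- (p / 2)) d.
have -> : - (p / 2) + p = p / 2 by field.
by rewrite (primitive_odd fN) => /eqP; rewrite subr_eq => /eqP ->; ring.
Qed.

End primitive_symmetry.

Lemma ellFN q x : 0 <= q < 1 -> ellF (- x) q = - ellF x q.
Proof.
move=> q01; apply: (@primitive_odd (fun z => ellF z q) _ (fun x => is_derive_ellF x q01)).
  exact: ellF0.
by move=> y; rewrite deltaN.
Qed.

Lemma ellEN q x : 0 <= q < 1 -> ellE (- x) q = - ellE x q.
Proof.
move=> q01; apply: (@primitive_odd (fun z => ellE z q) _ (fun x => is_derive_ellE x q01)).
  exact: ellE0.
by move=> y; rewrite deltaN.
Qed.

Lemma ellFDpi q x : 0 <= q < 1 -> ellF (x + pi) q = ellF x q + 2 * ellK q.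
Proof.
move=> q01; apply: (@primitive_shift (fun z => ellF z q) _ (fun x => is_derive_ellF x q01)).
- exact: ellF0.
- by move=> y; rewrite deltaN.
- by move=> y; rewrite deltaDpi.
Qed.

Lemma ellEDpi q x : 0 <= q < 1 -> ellE (x + pi) q = ellE x q + 2 * ellEc q.
Proof.
move=> q01; apply: (@primitive_shift (fun z => ellE z q) _ (fun x => is_derive_ellE x q01)).
- exact: ellE0.
- by move=> y; rewrite deltaN.
- by move=> y; rewrite deltaDpi.
Qed.

Lemma derive_gt0_lt f df : (forall x, is_derive x 1 f (df x)) -> (forall x, 0 < df x) ->
  forall x y, x < y -> f x < f y.
Proof.
move=> d d0 x y xy.
have [c _] := @MVT_segment _ f df x y (ltW xy) (fun z _ => d z)
  (continuous_subspaceT (fun z => derive_continuous (d z))).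
by move=> /eqP; rewrite subr_eq => /eqP ->; rewrite ltrDr mulr_gt0// subr_gt0.
Qed.

Lemma derive_ge0_le f df : (forall x, is_derive x 1 f (df x)) -> (forall x, 0 <= df x) ->
  forall x y, x <= y -> f x <= f y.
Proof.
move=> d d0 x y xy.
have [c _] := @MVT_segment _ f df x y xy (fun z _ => d z)
  (continuous_subspaceT (fun z => derive_continuous (d z))).
by move=> /eqP; rewrite subr_eq => /eqP ->; rewrite lerDr mulr_ge0// subr_ge0.
Qed.

Lemma ellF_lt q x y : 0 <= q < 1 -> x < y -> ellF x q < ellF y q.
Proof.
move=> q01; apply: derive_gt0_lt (fun x => is_derive_ellF x q01) _ _ _.
by move=> z; rewrite invr_gt0 delta_gt0.
Qed.

Lemma ellF_inj q : 0 <= q < 1 -> injective (fun z => ellF z q).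
Proof.
move=> q01 x y /= xy; have [h|h|//] := ltgtP x y.
  by have := ellF_lt q01 h; rewrite xy ltxx.
by have := ellF_lt q01 h; rewrite xy ltxx.
Qed.

(** The integrand [1 / delta] is at least 1. This makes [ellF] onto and bounds differences of
    amplitudes by differences of their arguments. *)
Lemma ellF_sub q x y : 0 <= q < 1 -> x <= y -> y - x <= ellF y q - ellF x q.
Proof.
move=> q01 xy.
have d (z : R) : is_derive z 1 (fun z => ellF z q - z) ((delta q z)^-1 - 1).
  by have := is_derive_ellF z q01 => ?; apply: is_derive_eq.
have := derive_ge0_le d _ xy => H.
suff : ellF x q - x <= ellF y q - y by lra.
by apply: H => z; rewrite subr_ge0 invr_ge1 ?delta_le1// ?delta_gt0// unitfE gt_eqF// delta_gt0.
Qed.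

Lemma ellF_am q u : 0 <= q < 1 -> ellF (am u q) q = u.
Proof.
move=> q01; suff [x xu] : exists x, ellF x q = u.
  by apply: (@xgetPex _ 0 [set x | ellF x q = u]); exists x.
have ab : - `|u| <= `|u| by have := normr_ge0 u; lra.
have [] := @IVT _ (fun z => ellF z q) (- `|u|) `|u| u ab.
- by apply: continuous_subspaceT => z; exact: derive_continuous (is_derive_ellF z q01).
- have := ellF_sub q01 (normr_ge0 u); rewrite ellF0 ellFN// !subr0 => h.
  have h2 := ler_norm u; have h3 := lerNnormlW (lexx `|u|).
  by rewrite ge_min le_max; apply/andP; split; apply/orP; [left|right]; lra.
- by move=> c _ <-; exists c.
Qed.

Lemma am_ellF q x : 0 <= q < 1 -> am (ellF x q) q = x.
Proof. by move=> q01; apply: (ellF_inj q01); rewrite ellF_am. Qed.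

Lemma is_derive_am q u : 0 <= q < 1 -> is_derive u 1 (fun z => am z q) (delta q (am u q)).
Proof.
move=> q01.
have := @is_derive_inverse _ (fun z => ellF z q) (fun z => am z q) (delta q (am u q))^-1 (am u q).
rewrite invrK ellF_am//; apply.
- by near=> x; rewrite /= am_ellF.
- by near=> x; exact: derive_continuous (is_derive_ellF x q01).
- exact: is_derive_ellF.
- by rewrite invr_eq0 gt_eqF// delta_gt0.
Unshelve. all: by end_near. Qed.

Lemma am0 q : 0 <= q < 1 -> am 0 q = 0.
Proof. by move=> q01; rewrite -{1}(ellF0 q) am_ellF. Qed.

Lemma amK q : 0 <= q < 1 -> am (ellK q) q = pi / 2.
Proof. by move=> q01; rewrite am_ellF. Qed.

Lemma amN q u : 0 <= q < 1 -> am (- u) q = - am u q.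
Proof. by move=> q01; apply: (ellF_inj q01); rewrite ellFN// !ellF_am. Qed.

Lemma amD2K q u : 0 <= q < 1 -> am (u + 2 * ellK q) q = am u q + pi.
Proof. by move=> q01; apply: (ellF_inj q01); rewrite ellFDpi// !ellF_am. Qed.

Lemma ellK_gt0 q : 0 <= q < 1 -> 0 < ellK q.
Proof. by move=> q01; rewrite -(ellF0 q) ellF_lt// divr_gt0// pi_gt0. Qed.

End Elliptic.

(** * Complete elliptic integrals and their derivatives in the modulus *)

Section Complete.
Variable R : realType.
Local Notation mu := (@lebesgue_measure R).
Implicit Types (q x y u t : R) (f : R -> R).

Lemma ctsD f g : continuous f -> continuous g -> continuous (fun x => f x + g x).
Proof. by move=> cf cg x; exact: continuousD (cf x) (cg x). Qed.

Lemma ctsM f g : continuous f -> continuous g -> continuous (fun x => f x * g x).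
Proof. by move=> cf cg x; exact: continuousM (cf x) (cg x). Qed.

Lemma ctsN f : continuous f -> continuous (fun x => - f x).
Proof. by move=> cf x; exact: continuousN (cf x). Qed.

Lemma cts_cst (r : R) : continuous (fun _ : R => r).
Proof. by move=> x; exact: cvg_cst. Qed.

Lemma cts_integrable f (a b : R) : continuous f -> mu.-integrable `[a, b] (EFin \o f).
Proof. by move=> cf; apply: within_cts_integrable; exact: continuous_subspaceT. Qed.

Lemma Rintegral_derive f df (b : R) : (forall x, is_derive x 1 f (df x)) -> continuous df ->
  0 <= b -> \int[mu]_(t in `[0, b]) df t = f b - f 0.
Proof.
move=> d cd b0.
have dd x : is_derive x 1 (fun y => oint 0 y df - f y) 0.
  have := @is_deriveB _ _ _ _ f x 1 _ _ (is_derive_oint x cd) (d x).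
  by move/is_derive_ext; apply=> //; rewrite subrr.
have := is_derive_0_is_cst b 0 dd; rewrite oint00 /oint b0; lra.
Qed.

Lemma is_derive_under_integral (F dF : R -> R -> R) (u v M c a : R) :
  u < a < v ->
  (forall x t, u < x < v -> is_derive x 1 (F ^~ t) (dF x t)) ->
  (forall x, u < x < v -> continuous (F x)) ->
  (forall x t, u < x < v -> `|dF x t| <= M) ->
  is_derive a 1 (fun x => \int[mu]_(t in `[0, c]) F x t) (\int[mu]_(t in `[0, c]) dF a t).
Proof.
move=> uav dFF cF bd.
have M0 : 0 <= M by apply: le_trans (normr_ge0 _) (bd a 0 uav).
have I_a : `]u, v[%classic a by rewrite /= in_itv.
have intf x : `]u, v[%classic x -> mu.-integrable `[0, c] (EFin \o F x).
  by rewrite /= in_itv => uxv; apply: cts_integrable; exact: cF.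
have der x t : `]u, v[%classic x -> `[0, c]%classic t -> derivable (F ^~ t) x 1.
  by rewrite /= in_itv/= => uxv _; have [] := dFF x t uxv.
have intG : mu.-integrable `[0, c] (EFin \o (fun=> M)).
  by apply: cts_integrable => x; exact: cvg_cst.
have part x t : u < x < v -> partial1of2 F x t = dF x t.
  by move=> uxv; rewrite partial1of2E; exact: (@derive_val _ _ _ _ _ _ _ (dFF x t uxv)).
have Gub x t : `]u, v[%classic x -> `[0, c]%classic t -> `|partial1of2 F x t| <= M.
  by rewrite /= in_itv/= => uxv _; rewrite part// bd.
have D := @derivable_under_integral R _ _ mu F `[0, c]%classic (measurable_itv _) a u v I_a
  intf der (fun=> M) (fun=> M0) intG Gub.
have E := @differentiation_under_integral R _ _ mu F `[0, c]%classic (measurable_itv _) a u v I_a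
  intf der (fun=> M) (fun=> M0) intG Gub.
apply: DeriveDef; first exact: D.
rewrite -derive1E E; apply: eq_Rintegral_itv => t _; exact: part.
Qed.

Lemma pihalf_ge0 : 0 <= pi / 2 :> R.
Proof. by rewrite divr_ge0// pi_ge0. Qed.

Lemma ellKE q : ellK q = \int[mu]_(t in `[0, pi / 2]) (delta q t)^-1.
Proof. by rewrite /ellK /ellF /oint pihalf_ge0. Qed.

Lemma ellEcE q : ellEc q = \int[mu]_(t in `[0, pi / 2]) delta q t.
Proof. by rewrite /ellEc /ellE /oint pihalf_ge0. Qed.

Lemma is_derive_delta_modulus q t : 0 <= q < 1 ->
  is_derive q 1 (fun z => delta z t) (- (q * sin t ^+ 2) / delta q t).
Proof.
move=> q01; have p := delta_sqr_gt0 t q01.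
have d1 : is_derive q 1 (fun q => 1 - q ^+ 2 * sin t ^+ 2) (- (2 * (q * sin t ^+ 2))).
  by apply: is_derive_eq; rewrite /GRing.scale/=; ring.
have := @is_derive1_comp _ Num.sqrt (fun q => 1 - q ^+ 2 * sin t ^+ 2) q _ _ (is_derive1_sqrt p) d1.
move/is_derive_ext; apply=> //; rewrite -/(delta q t); have := delta_gt0 t q01.
by move=> d0; field; rewrite gt_eqF.
Qed.

Lemma is_derive_deltaV_modulus q t : 0 <= q < 1 ->
  is_derive q 1 (fun q => (delta q t)^-1) (q * sin t ^+ 2 / delta q t ^+ 3).
Proof.
move=> q01; have d0 := delta_gt0 t q01; have dn0 : delta q t != 0 by rewrite gt_eqF.
have := @is_deriveV _ (fun z => delta z t) q _ 1 dn0 (is_derive_delta_modulus t q01).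
by move/is_derive_ext; apply=> //; rewrite /GRing.scale/=; field.
Qed.

Lemma delta_ge q (v : R) t : 0 <= q <= v -> v < 1 -> Num.sqrt (1 - v ^+ 2) <= delta q t.
Proof.
move=> /andP[q0 qv] v1; apply: ler_wsqrtr; rewrite lerB//.
apply: le_trans (_ : q ^+ 2 <= _); last by rewrite ler_sqr ?nnegrE// (le_trans q0).
by rewrite ler_piMr ?sqr_ge0// sin2cos2 gerBl sqr_ge0.
Qed.

Lemma is_derive_ellEc_int q : 0 < q < 1 ->
  is_derive q 1 (@ellEc R) (\int[mu]_(t in `[0, pi / 2]) (- (q * sin t ^+ 2) / delta q t)).
Proof.
(* Confining the modulus below [v < 1] gives [delta] the positive lower bound [m]; up to modulus 1
   no constant would dominate the derivative. *)
move=> /andP[q0 q1]; pose v := (q + 1) / 2.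
have qv : q < v by rewrite /v; lra.
have v1 : v < 1 by rewrite /v; lra.
have v0 : 0 < v by lra.
pose m := Num.sqrt (1 - v ^+ 2).
have m0 : 0 < m by rewrite sqrtr_gt0 subr_gt0 expr_lt1// ltW.
have H := @is_derive_under_integral (fun q t => delta q t) (fun q t => - (q * sin t ^+ 2) / delta q t) 0 v m^-1 (pi / 2) q.
apply: is_derive_ext (H _ _ _ _) _ _ => //.
- by rewrite q0.
- by move=> x t /andP[x0 xv]; apply: is_derive_delta_modulus; rewrite ltW//= (lt_trans xv).
- by move=> x /andP[x0 xv]; apply: delta_cts; rewrite ltW//= (lt_trans xv).
- move=> x t /andP[x0 xv].
  have d0 : m <= delta x t by apply: delta_ge => //; rewrite !ltW.
  rewrite normrM normrN normfV (ger0_norm (ltW (lt_le_trans m0 d0))) -[leRHS]mul1r.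
  have x1 : x < 1 by exact: lt_trans xv v1.
  have s0 := sqr_ge0 (sin t).
  have s1 : sin t ^+ 2 <= 1 by rewrite sin2cos2 gerBl sqr_ge0.
  apply: ler_pM => //; first by rewrite invr_ge0; apply: le_trans d0; exact: ltW.
    rewrite ger0_norm; last by rewrite mulr_ge0// ltW.
    by apply: mulr_ile1 => //; exact: ltW.
  by rewrite lef_pV2 ?posrE//; exact: lt_le_trans d0.
- by move=> x; rewrite ellEcE.
Qed.

Lemma is_derive_ellK_int q : 0 < q < 1 ->
  is_derive q 1 (@ellK R) (\int[mu]_(t in `[0, pi / 2]) (q * sin t ^+ 2 / delta q t ^+ 3)).
Proof.
move=> /andP[q0 q1]; pose v := (q + 1) / 2.
have qv : q < v by rewrite /v; lra.
have v1 : v < 1 by rewrite /v; lra.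
have v0 : 0 < v by lra.
pose m := Num.sqrt (1 - v ^+ 2).
have m0 : 0 < m by rewrite sqrtr_gt0 subr_gt0 expr_lt1// ltW.
have H := @is_derive_under_integral (fun q t => (delta q t)^-1)
  (fun q t => q * sin t ^+ 2 / delta q t ^+ 3) 0 v (m ^+ 3)^-1 (pi / 2) q.
apply: is_derive_ext (H _ _ _ _) _ _ => //.
- by rewrite q0.
- by move=> x t /andP[x0 xv]; apply: is_derive_deltaV_modulus; rewrite ltW//= (lt_trans xv).
- by move=> x /andP[x0 xv]; apply: deltaV_cts; rewrite ltW//= (lt_trans xv).
- move=> x t /andP[x0 xv].
  have d0 : m <= delta x t by apply: delta_ge => //; rewrite !ltW.
  have dp : 0 < delta x t by exact: lt_le_trans d0.
  rewrite normrM normfV normrX (ger0_norm (ltW dp)) -[leRHS]mul1r.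
  have x1 : x < 1 by exact: lt_trans xv v1.
  have s0 := sqr_ge0 (sin t).
  have s1 : sin t ^+ 2 <= 1 by rewrite sin2cos2 gerBl sqr_ge0.
  apply: ler_pM => //; first by rewrite invr_ge0 exprn_ge0// ltW.
    rewrite ger0_norm; last by rewrite mulr_ge0// ltW.
    by apply: mulr_ile1 => //; exact: ltW.
  by rewrite lef_pV2 ?posrE ?exprn_gt0// ler_pXn2r// nnegrE ltW.
- by move=> x; rewrite ellKE.
Qed.

Lemma sin_cts_sqr : continuous (fun t : R => sin t ^+ 2).
Proof. by move=> t; apply: continuousM; exact: continuous_sin. Qed.

Lemma deltaV3_cts q : 0 <= q < 1 -> continuous (fun t => (delta q t ^+ 3)^-1).
Proof.
move=> q01 t.
apply: (@continuous_comp _ _ _ (delta q) (fun x => (x ^+ 3)^-1)); first exact: delta_cts.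
apply: (@continuous_comp _ _ _ (fun x : R => x ^+ 3) (fun x => x^-1)).
  exact: exprn_continuous.
by apply: inv_continuous; rewrite gt_eqF// exprn_gt0// delta_gt0.
Qed.

(** [delta - (1 - q^2) / delta^3] is the derivative of [q^2 sin t cos t / delta], which vanishes at
    both endpoints. This expresses the third power in [is_derive_ellK_int] through complete
    integrals. *)
Lemma Rintegral_deltaV3 q : 0 <= q < 1 ->
  (1 - q ^+ 2) * \int[mu]_(t in `[0, pi / 2]) (delta q t ^+ 3)^-1 = ellEc q.
Proof.
move=> q01.
have cD := delta_cts q01; have cV := deltaV3_cts q01.
have d x : is_derive x 1 (fun t => q ^+ 2 * sin t * cos t / delta q t)
    (1 * delta q x + - (1 - q ^+ 2) * (delta q x ^+ 3)^-1).
  have d0 := delta_gt0 x q01; have dn0 : delta q x != 0 by rewrite gt_eqF.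
  have dV := @is_deriveV _ (delta q) x _ 1 dn0 (is_derive_delta x q01).
  have dN : is_derive x 1 (fun t => q ^+ 2 * sin t * cos t) (q ^+ 2 * (cos x ^+ 2 - sin x ^+ 2)).
    by apply: is_derive_eq; rewrite /GRing.scale/=; ring.
  have := is_deriveM dN dV; move/is_derive_ext; apply=> //.
  rewrite /GRing.scale/= cos2sin2.
  have E := delta_sqr x q01.
  have E2 : q ^+ 2 * sin x ^+ 2 = 1 - delta q x ^+ 2 by rewrite E; ring.
  apply: (mulIf (expf_neq0 3 dn0)).
  transitivity ((q ^+ 2 - 2 * (q ^+ 2 * sin x ^+ 2)) * delta q x ^+ 2
      + (q ^+ 2 * sin x ^+ 2) * (q ^+ 2 * cos x ^+ 2)); first by field.
  transitivity (delta q x ^+ 4 - (1 - q ^+ 2)); last by field.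
  rewrite (_ : q ^+ 2 * cos x ^+ 2 = q ^+ 2 - q ^+ 2 * sin x ^+ 2); last by rewrite cos2sin2; ring.
  by rewrite E2; ring.
have c : continuous (fun x => 1 * delta q x + - (1 - q ^+ 2) * (delta q x ^+ 3)^-1).
  by apply: ctsD; apply: ctsM => //; exact: cts_cst.
have := Rintegral_derive d c pihalf_ge0.
rewrite sin0 cos_pihalf !mulr0 !mul0r subrr Rintegral_lin; try exact: cts_integrable.
by rewrite -ellEcE; lra.
Qed.

Lemma is_derive_ellEc q : 0 < q < 1 -> is_derive q 1 (@ellEc R) ((ellEc q - ellK q) / q).
Proof.
move=> q01; have /andP[q0 q1] := q01; have q01' : 0 <= q < 1 by rewrite ltW.
apply: is_derive_ext (is_derive_ellEc_int q01) _ _ => //.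
rewrite ellKE ellEcE mulrBl mulrC ![_ / q]mulrC -mulNr -Rintegral_lin.
- apply: eq_Rintegral_itv => t _; have d0 := delta_gt0 t q01'; have E := delta_sqr t q01'.
  apply: (mulfI (_ : q * delta q t != 0)); first by rewrite gt_eqF ?mulr_gt0.
  transitivity (- (q ^+ 2 * sin t ^+ 2)); first by field; rewrite gt_eqF.
  transitivity (delta q t ^+ 2 - 1); first by rewrite E; ring.
  by field; rewrite !gt_eqF.
- by apply: cts_integrable; exact: delta_cts.
- by apply: cts_integrable; exact: deltaV_cts.
Qed.

Lemma is_derive_ellK q : 0 < q < 1 ->
  is_derive q 1 (@ellK R) ((ellEc q - (1 - q ^+ 2) * ellK q) / (q * (1 - q ^+ 2))).
Proof.
move=> q01; have /andP[q0 q1] := q01; have q01' : 0 <= q < 1 by rewrite ltW.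
have qq : 0 < 1 - q ^+ 2 by rewrite subr_gt0 expr_lt1// ltW.
apply: is_derive_ext (is_derive_ellK_int q01) _ _ => //.
rewrite -(Rintegral_deltaV3 q01') ellKE -mulrBr.
set J := \int[mu]_(t in _) (_ ^+ 3)^-1; set I := \int[mu]_(t in _) (delta q t)^-1.
have -> : (1 - q ^+ 2) * (J - I) / (q * (1 - q ^+ 2)) = q^-1 * (1 * J + -1 * I).
  by field; rewrite !gt_eqF.
rewrite /J /I -Rintegral_lin; last 2 first.
- by apply: cts_integrable; exact: deltaV3_cts.
- by apply: cts_integrable; exact: deltaV_cts.
rewrite -RintegralZl//; last first.
  apply: integrable_lin; apply: cts_integrable; [exact: deltaV3_cts|exact: deltaV_cts].
apply: eq_Rintegral_itv => t _; have d0 := delta_gt0 t q01'; have E := delta_sqr t q01'.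
apply: (mulfI (_ : q * delta q t ^+ 3 != 0)); first by rewrite gt_eqF ?mulr_gt0 ?exprn_gt0.
transitivity (q ^+ 2 * sin t ^+ 2); first by field; rewrite gt_eqF.
transitivity (1 - delta q t ^+ 2); first by rewrite E; ring.
by field; rewrite !gt_eqF.
Qed.

Lemma Rintegral_sin2 : \int[mu]_(t in `[0, pi / 2]) (sin t ^+ 2) = pi / 4.
Proof.
have d (x : R) : is_derive x 1 (fun t => 1 / 2 * (t - sin t * cos t)) (sin x ^+ 2).
  by apply: is_derive_eq; rewrite /GRing.scale/=; have := cos2Dsin2 x; lra.
rewrite (Rintegral_derive d sin_cts_sqr pihalf_ge0) sin0 cos_pihalf; by field.
Qed.

Lemma Rintegral_cos2 : \int[mu]_(t in `[0, pi / 2]) (cos t ^+ 2) = pi / 4.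
Proof.
have d (x : R) : is_derive x 1 (fun t => 1 / 2 * (t + sin t * cos t)) (cos x ^+ 2).
  by apply: is_derive_eq; rewrite /GRing.scale/=; have := cos2Dsin2 x; lra.
have c : continuous (fun t : R => cos t ^+ 2).
  by move=> t; apply: continuousM; exact: continuous_cos.
rewrite (Rintegral_derive d c pihalf_ge0) sin0 cos_pihalf; by field.
Qed.

(** [1 / delta - delta = q^2 sin^2 / delta] dominates [q^2 sin^2], whose integral is explicit and
    positive. The next bound uses [delta - (1 - q^2) / delta = q^2 cos^2 / delta] in the same
    way. *)
Lemma ellKB_gt0 q : 0 < q < 1 -> ellEc q < ellK q.
Proof.
move=> q01; have /andP[q0 q1] := q01; have q01' : 0 <= q < 1 by rewrite ltW.
suff : q ^+ 2 * (pi / 4) <= 1 * ellK q + -1 * ellEc q.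
  have : 0 < q ^+ 2 * (pi / 4) by rewrite mulr_gt0 ?exprn_gt0 ?divr_gt0 ?pi_gt0.
  by lra.
have iD : mu.-integrable `[0, pi / 2] (EFin \o (delta q)) by apply: cts_integrable; exact: delta_cts.
have iV : mu.-integrable `[0, pi / 2] (EFin \o (fun t => (delta q t)^-1)).
  by apply: cts_integrable; exact: deltaV_cts.
have is2 : mu.-integrable `[0, pi / 2] (EFin \o (fun t : R => sin t ^+ 2)).
  by apply: cts_integrable; exact: sin_cts_sqr.
rewrite -Rintegral_sin2 -RintegralZl// ellKE ellEcE -Rintegral_lin//.
apply: le_Rintegral_itv; [exact: integrable_scale|exact: integrable_lin|].
move=> t _; have d0 := delta_gt0 t q01'; have E := delta_sqr t q01'; have d1 := delta_le1 t q01'.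
rewrite -(ler_pM2r d0).
have -> : (1 * (delta q t)^-1 + -1 * delta q t) * delta q t = 1 - delta q t ^+ 2.
  by field; rewrite gt_eqF.
rewrite E opprB addrC subrK ler_piMr//.
by rewrite mulr_ge0 ?sqr_ge0.
Qed.

Lemma ellE_gtK q : 0 < q < 1 -> (1 - q ^+ 2) * ellK q < ellEc q.
Proof.
move=> q01; have /andP[q0 q1] := q01; have q01' : 0 <= q < 1 by rewrite ltW.
suff : q ^+ 2 * (pi / 4) <= 1 * ellEc q + - (1 - q ^+ 2) * ellK q.
  have : 0 < q ^+ 2 * (pi / 4) by rewrite mulr_gt0 ?exprn_gt0 ?divr_gt0 ?pi_gt0.
  by lra.
have iD : mu.-integrable `[0, pi / 2] (EFin \o (delta q)) by apply: cts_integrable; exact: delta_cts.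
have iV : mu.-integrable `[0, pi / 2] (EFin \o (fun t => (delta q t)^-1)).
  by apply: cts_integrable; exact: deltaV_cts.
have ic2 : mu.-integrable `[0, pi / 2] (EFin \o (fun t : R => cos t ^+ 2)).
  by apply: cts_integrable => t; apply: continuousM; exact: continuous_cos.
rewrite -Rintegral_cos2 -RintegralZl// ellKE ellEcE -Rintegral_lin//.
apply: le_Rintegral_itv; [exact: integrable_scale|exact: integrable_lin|].
move=> t _; have d0 := delta_gt0 t q01'; have E := delta_sqr t q01'; have d1 := delta_le1 t q01'.
rewrite -(ler_pM2r d0).
have -> : (1 * delta q t + - (1 - q ^+ 2) * (delta q t)^-1) * delta q t = delta q t ^+ 2 - (1 - q ^+ 2).
  by field; rewrite gt_eqF.
rewrite E (_ : _ - (1 - q ^+ 2) = q ^+ 2 * cos t ^+ 2); last by rewrite cos2sin2; ring.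
by rewrite ler_piMr// mulr_ge0 ?sqr_ge0.
Qed.

Lemma ellEc_gt0 q : 0 <= q < 1 -> 0 < ellEc q.
Proof.
move=> q01; have [->|q0] := eqVneq q 0.
  have -> : ellEc 0 = ellK 0 :> R.
    rewrite ellKE ellEcE; apply: eq_Rintegral_itv => t _.
    by rewrite /delta expr0n mul0r subr0 sqrtr1 invr1.
  by apply: ellK_gt0; rewrite lexx ltr01.
have q01' : 0 < q < 1 by move: q01 => /andP[? ->]; rewrite lt_neqAle eq_sym q0 andbT.
apply: lt_trans (ellE_gtK q01'); rewrite mulr_gt0 ?ellK_gt0// subr_gt0 expr_lt1//.
  by case/andP: q01.
by case/andP: q01.
Qed.

End Complete.

(** * Energy of the one-parameter family of arcs *)

Section Landscape.
Variable R : realType.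
Implicit Types (q x y u t kap : R).

(* The elastica of parameter [q] spanning a chord of length [l] has length [l / arcC q], bending
   energy [arcC q * arcD q / l], and energy [arcP (lam * l ^+ 2) q / l]. *)
Definition arcC q : R := 2 * ellEc q / ellK q - 1.
Definition arcD q : R := 16 * ellK q * (ellEc q - (1 - q ^+ 2) * ellK q).
Definition arcP kap q : R := arcC q * arcD q + kap / arcC q.

Lemma dom01 q : 0 < q < 1 ->
  [/\ 0 < q, q < 1, 0 <= q < 1, 0 < 1 - q ^+ 2 & 0 < ellK q].
Proof.
move=> /andP[q0 q1]; have q01 : 0 <= q < 1 by rewrite ltW.
by split=> //; [rewrite subr_gt0 expr_lt1// ltW|exact: ellK_gt0].
Qed.

Definition arcdC q : R :=
  2 * ((ellEc q - ellK q) / q * ellK q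
       - ellEc q * ((ellEc q - (1 - q ^+ 2) * ellK q) / (q * (1 - q ^+ 2)))) / ellK q ^+ 2.

Lemma is_derive_arcC q : 0 < q < 1 -> is_derive q 1 arcC (arcdC q).
Proof.
move=> q01; have [q0 q1 q01' qq K0] := dom01 q01.
have Kn : ellK q != 0 by rewrite gt_eqF.
have dE := is_derive_ellEc q01; have dK := is_derive_ellK q01.
have dM := isder_mul dE (isder_inv Kn dK).
apply: is_derive_ext (isder_sub (isder_scale 2 dM) (isder_cst 1 q)) _ _.
  by move=> x; rewrite /arcC mulrA.
by rewrite /arcdC; field; rewrite Kn !gt_eqF.
Qed.

(** [E] decreases and [K] increases with the modulus, so at unit length the chord shrinks. *)
Lemma arcdC_lt0 q : 0 < q < 1 -> arcdC q < 0.
Proof.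
move=> q01; have [q0 q1 q01' qq K0] := dom01 q01.
have h1 := ellKB_gt0 q01; have h2 := ellE_gtK q01; have h3 := ellEc_gt0 q01'.
rewrite /arcdC pmulr_llt0 ?invr_gt0 ?exprn_gt0// pmulr_rlt0// subr_lt0.
apply: (@lt_trans _ _ 0).
  by rewrite pmulr_llt0// pmulr_llt0 ?invr_gt0// subr_lt0.
by rewrite mulr_gt0// divr_gt0 ?mulr_gt0// subr_gt0.
Qed.

(** Envelope relation: along the arcs of unit length, the derivative of the bending energy with
    respect to the chord is minus the Lagrange multiplier [2 om^2], where [om = 2 K]. It makes every
    term in the derivative of [arcP] a multiple of [arcdC]. *)
Lemma is_derive_arcD q : 0 < q < 1 -> is_derive q 1 arcD (- 8 * ellK q ^+ 2 * arcdC q).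
Proof.
move=> q01; have [q0 q1 q01' qq K0] := dom01 q01.
have Kn : ellK q != 0 by rewrite gt_eqF.
have dE := is_derive_ellEc q01; have dK := is_derive_ellK q01.
have dq : is_derive q 1 (fun q => 1 - q ^+ 2) (- (2 * q)).
  by apply: is_derive_eq; rewrite /GRing.scale/=; ring.
apply: is_derive_ext (isder_scale 16 (isder_mul dK (isder_sub dE (isder_mul dq dK)))) _ _.
  by move=> x; rewrite /arcD mulrA.
by rewrite /arcdC; field; rewrite Kn !gt_eqF.
Qed.

Lemma arcCK q : 0 < q < 1 -> arcC q * ellK q = 2 * ellEc q - ellK q.
Proof.
by move=> q01; have [q0 q1 q01' qq K0] := dom01 q01; rewrite /arcC; field; rewrite gt_eqF.
Qed.

Lemma gqE q : 0 < q < 1 -> gq q = arcC q ^+ 2 * (arcD q - 8 * ellK q ^+ 2 * arcC q).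
Proof.
move=> q01; have [q0 q1 q01' qq K0] := dom01 q01.
by rewrite /gq /arcD /arcC; field; rewrite gt_eqF.
Qed.

Lemma is_derive_arcP kap q : 0 < q < 1 -> arcC q != 0 ->
  is_derive q 1 (arcP kap) (arcdC q / arcC q ^+ 2 * (gq q - kap)).
Proof.
move=> q01 C0.
have dC := is_derive_arcC q01; have dD := is_derive_arcD q01.
have := isder_add (isder_mul dC dD) (isder_scale kap (isder_inv C0 dC)).
move/is_derive_ext; apply=> //.
by rewrite gqE//; field.
Qed.

Lemma is_derive_gq q : 0 < q < 1 ->
  is_derive q 1 (@gq R) (16 * (2 * ellEc q - ellK q) * fq q / (q * (1 - q ^+ 2))).
Proof.
move=> q01; have [q0 q1 q01' qq K0] := dom01 q01.
have dE := is_derive_ellEc q01; have dK := is_derive_ellK q01.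
have dq : is_derive q 1 (fun q => 2 * q ^+ 2 - 1) (4 * q).
  by apply: is_derive_eq; rewrite /GRing.scale/=; ring.
have dy := isder_sub (isder_scale 2 dE) dK.
apply: is_derive_ext (isder_mul (isder_scale 8 (isder_mul dy dy)) dq) _ _.
  by move=> x; rewrite /gq; ring.
by rewrite /fq; field; rewrite !gt_eqF.
Qed.

Lemma ellK_lt q q' : 0 < q -> q < q' -> q' < 1 -> ellK q < ellK q'.
Proof.
move=> q0 qq' q1.
have in01 z : z \in `[q, q'] -> 0 < z < 1.
  by rewrite in_itv/= => /andP[qz zq]; rewrite (lt_le_trans q0 qz) (le_lt_trans zq q1).
have in01' z : z \in `]q, q'[ -> 0 < z < 1.
  by rewrite in_itv/= => /andP[qz zq]; rewrite (lt_trans q0 qz) (lt_trans zq q1).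
apply: (@gtr0_derive1_lt_cc _ (@ellK R) q q') => //.
- by move=> z /in01' /is_derive_ellK [].
- move=> z /in01' z01; have [z0 z1 _ zz _] := dom01 z01.
  rewrite derive1E (@derive_val _ _ _ _ _ _ _ (is_derive_ellK z01)).
  by rewrite divr_gt0 ?mulr_gt0// subr_gt0 ellE_gtK.
- apply: derivable_within_continuous => z /in01 z01.
  by have [] := is_derive_ellK z01.
- by rewrite in_itv/= lexx ltW.
- by rewrite in_itv/= lexx ltW.
Qed.

Lemma ellEc_lt q q' : 0 < q -> q < q' -> q' < 1 -> ellEc q' < ellEc q.
Proof.
move=> q0 qq' q1.
have in01 z : z \in `[q, q'] -> 0 < z < 1.
  by rewrite in_itv/= => /andP[qz zq]; rewrite (lt_le_trans q0 qz) (le_lt_trans zq q1).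
have in01' z : z \in `]q, q'[ -> 0 < z < 1.
  by rewrite in_itv/= => /andP[qz zq]; rewrite (lt_trans q0 qz) (lt_trans zq q1).
apply: (@ltr0_derive1_lt_cc _ (@ellEc R) q q') => //.
- by move=> z /in01' /is_derive_ellEc [].
- move=> z /in01' z01; have [z0 z1 _ zz _] := dom01 z01.
  rewrite derive1E (@derive_val _ _ _ _ _ _ _ (is_derive_ellEc z01)).
  by rewrite pmulr_llt0 ?invr_gt0// subr_lt0 ellKB_gt0.
- apply: derivable_within_continuous => z /in01 z01.
  by have [] := is_derive_ellEc z01.
- by rewrite in_itv/= lexx ltW.
- by rewrite in_itv/= lexx ltW.
Qed.

Let a_ q : R := 8 * q ^+ 2 * (1 - q ^+ 2) - 1.
Let b_ q : R := (4 * q ^+ 2 - 1) * (1 - q ^+ 2).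

Let fqE q : fq q = a_ q * ellEc q - b_ q * ellK q.
Proof. by rewrite /fq /a_ /b_; ring. Qed.

(* [fq q = 0] reads [b_ / a_ = E / K], where the left side increases with q and the right side decreases. *)
Let cross q q' : 1 / 2 <= q ^+ 2 -> q ^+ 2 < q' ^+ 2 -> b_ q * a_ q' < b_ q' * a_ q.
Proof.
move=> h1 h2; rewrite -subr_gt0.
rewrite (_ : _ - _ = (q' ^+ 2 - q ^+ 2) * (8 * (q ^+ 2 - 1 / 2) * (q' ^+ 2 - 1 / 2) + 1)).
  apply: mulr_gt0; first by rewrite subr_gt0.
  by rewrite ltr_wpDl// mulr_ge0 ?mulr_ge0// subr_ge0// ltW// (le_lt_trans h1).
by rewrite /a_ /b_; field.
Qed.

Let b_gt0 q : 1 / 2 <= q ^+ 2 -> 0 < 1 - q ^+ 2 -> 0 < b_ q.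
Proof. by move=> h1 h2; rewrite /b_ mulr_gt0//; lra. Qed.

Lemma fq_sign a : 1 / 2 <= a ^+ 2 -> 0 < a < 1 -> fq a = 0 ->
  (forall q, 0 < q -> 1 / 2 <= q ^+ 2 -> q < a -> 0 < fq q) /\
  (forall q, a < q -> q < 1 -> fq q < 0).
Proof.
move=> a2 a01; have [a0 a1 a01' aa Ka] := dom01 a01.
have Ea := ellEc_gt0 a01'; have ba := b_gt0 a2 aa.
rewrite fqE => /eqP; rewrite subr_eq0 => /eqP fa.
have aa0 : 0 < a_ a by rewrite -(pmulr_lgt0 _ Ea) fa mulr_gt0.
split=> q.
- move=> q0 q2 qa; have q1 := lt_trans qa a1.
  have q01 : 0 < q < 1 by rewrite q0.
  have [_ _ q01' qq Kq] := dom01 q01; have Eq := ellEc_gt0 q01'.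
  have qa2 : q ^+ 2 < a ^+ 2 by rewrite ltr_pXn2r// nnegrE ltW.
  have KK := ellK_lt q0 qa a1; have EE := ellEc_lt q0 qa a1.
  have cr := cross q2 qa2.
  have aq0 : 0 < a_ q.
    by rewrite -(pmulr_rgt0 _ ba); apply: lt_trans cr; rewrite mulr_gt0// b_gt0.
  rewrite fqE subr_gt0 -(ltr_pM2r (mulr_gt0 aa0 Ea)).
  have -> : b_ q * ellK q * (a_ a * ellEc a) = (b_ q * a_ a) * (ellK q * ellEc a) by ring.
  have -> : a_ q * ellEc q * (a_ a * ellEc a) = (b_ a * a_ q) * (ellK a * ellEc q).
    by rewrite fa; ring.
  have h1 := mulr_ge0 (ltW (b_gt0 q2 qq)) (ltW aa0).
  have h2 := mulr_ge0 (ltW Kq) (ltW Ea).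
  have h3 := ltr_pM (ltW Kq) (ltW Ea) KK EE.
  exact: ltr_pM h1 h2 cr h3.
- move=> aq q1; have q0 := lt_trans a0 aq.
  have q01 : 0 < q < 1 by rewrite q0.
  have [_ _ q01' qq Kq] := dom01 q01; have Eq := ellEc_gt0 q01'.
  have qa2 : a ^+ 2 < q ^+ 2 by rewrite ltr_pXn2r// nnegrE ltW.
  have q2 : 1 / 2 <= q ^+ 2 by exact: le_trans a2 (ltW qa2).
  have bq := b_gt0 q2 qq.
  have KK := ellK_lt a0 aq q1; have EE := ellEc_lt a0 aq q1.
  have cr := cross a2 qa2.
  (* Near modulus 1 the factor [a_ q] is negative, and then the sign of [fq] is immediate since
     [b_], [E] and [K] are positive. *)
  rewrite fqE subr_lt0; have [aq0|aq0] := leP (a_ q) 0.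
    by apply: le_lt_trans (mulr_gt0 bq Kq); rewrite mulr_le0_ge0// ltW.
  rewrite -(ltr_pM2r (mulr_gt0 aa0 Ea)).
  have -> : b_ q * ellK q * (a_ a * ellEc a) = (b_ q * a_ a) * (ellK q * ellEc a) by ring.
  have -> : a_ q * ellEc q * (a_ a * ellEc a) = (b_ a * a_ q) * (ellK a * ellEc q).
    by rewrite fa; ring.
  have h1 := mulr_ge0 (ltW ba) (ltW aq0).
  have h2 := mulr_ge0 (ltW Ka) (ltW Eq).
  have h3 := ltr_pM (ltW Ka) (ltW Eq) KK EE.
  exact: ltr_pM h1 h2 cr h3.
Qed.

End Landscape.

(** * Regular [W^{2,2}] curves *)

Section Curves.
Variable R : realType.
Local Notation mu := (@lebesgue_measure R).
Local Notation pt := (R * R)%type.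
Implicit Types (f g : R -> R) (a b s t : R).

Lemma ae_itv01 (P : R -> Prop) : {ae mu, forall t : R, 0 < t < 1 -> P t} ->
  {ae mu, forall t : R, `[0, 1]%classic t -> P t}.
Proof.
move=> aeP.
have n0 : {ae mu, forall t : R, t <> 0}.
  exists [set 0]; split=> //; first exact: lebesgue_measure_set1.
  by move=> t /= /contrapT.
have n1 : {ae mu, forall t : R, t <> 1}.
  exists [set 1]; split=> //; first exact: lebesgue_measure_set1.
  by move=> t /= /contrapT.
have FF := ae_filter_ringOfSetsType mu.
apply: filterS3 aeP n0 n1 => t Pt /eqP t0 /eqP t1; rewrite /= in_itv/= => /andP[h0 h1].
by apply: Pt; rewrite !lt_neqAle h0 h1 t1 eq_sym t0.
Qed.

Lemma Rintegral_ae_eq f g : mu.-integrable `[0, 1] (EFin \o f) ->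
  mu.-integrable `[0, 1] (EFin \o g) ->
  {ae mu, forall t : R, 0 < t < 1 -> f t = g t} ->
  \int[mu]_(t in `[0, 1]) f t = \int[mu]_(t in `[0, 1]) g t.
Proof.
move=> fi gi /ae_itv01 fg; rewrite /Rintegral; congr fine.
apply: ae_eq_integral => //.
- exact: (measurable_int mu).
- exact: (measurable_int mu).
- have FF := ae_filter_ringOfSetsType mu.
  by apply: filterS fg => t /= fg t01; rewrite fg.
Qed.

Lemma integrable_mulr f g (a b : R) :
  mu.-integrable `[a, b] (EFin \o f) -> mu.-integrable `[a, b] (EFin \o g) ->
  mu.-integrable `[a, b] (EFin \o (fun t => f t ^+ 2)) ->
  mu.-integrable `[a, b] (EFin \o (fun t => g t ^+ 2)) ->
  mu.-integrable `[a, b] (EFin \o (fun t => f t * g t)).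
Proof.
move=> fi gi f2 g2.
apply: (le_integrable _ _ _ (integrable_add f2 g2)) => //.
  apply/measurable_EFinP; apply: measurable_funM;
    by apply/measurable_EFinP; exact: (measurable_int mu).
move=> t _ /=; rewrite lee_fin (ger0_norm (addr_ge0 (sqr_ge0 _) (sqr_ge0 _))) normrM.
rewrite -(real_normK (num_real (f t))) -(real_normK (num_real (g t))).
have := sqr_ge0 (`|f t| - `|g t|); have := mulr_ge0 (normr_ge0 (f t)) (normr_ge0 (g t)).
rewrite sqrrB; set A := `|f t|; set B := `|g t|; rewrite !expr2; lra.
Qed.

(** Continuity upgrades the uniqueness of densities to every point, endpoints included: with [F t]
    nonzero, the integral of [F] over a short interval ending or starting at [t] could not
    vanish. *)
Lemma AC_cts_deriv_unique (H h h' : R -> R) : abscont 0 1 H h -> abscont 0 1 H h' ->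
  {within `[0, 1], continuous h} -> {within `[0, 1], continuous h'} ->
  forall t, 0 <= t <= 1 -> h t = h' t.
Proof.
move=> [ih Hh] [ih' Hh'] ch ch' t t01; apply/eqP; rewrite -subr_eq0; apply/eqP.
pose F s := h s - h' s.
have cF : {within `[0, 1], continuous F}.
  have -> : F = (fun s => h s + -1 * h' s) by apply/funext => s; rewrite /F mulN1r.
  by apply: within_cts_add => //; apply: within_cts_mul => //; exact: within_cts_cst.
have iF : mu.-integrable `[0, 1] (EFin \o F) by exact: within_cts_integrable.
have F0 a b : 0 <= a -> a <= b -> b <= 1 -> \int[mu]_(s in `[a, b]) F s = 0.
  move=> a0 ab b1.
  have i1 := integrable_sub_itv a0 b1 ih; have i2 := integrable_sub_itv a0 b1 ih'.
  by rewrite RintegralB// -(Hh a b)// -(Hh' a b)// subrr.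
rewrite -/(F t); apply/eqP; apply: contraT => Ft0.
have m0 : 0 < `|F t| / 2 by rewrite divr_gt0// normr_gt0.
have [d d0 Hd] := (within_ctsP _ _ _).1 cF t t01 _ m0.
have [a [b [a0 ab b1 abt]]] : exists a b, [/\ 0 <= a, a < b, b <= 1 &
    forall s, a <= s <= b -> `|s - t| < d].
  have /andP[t0 t1] := t01; have [t1'|t1'] := ltP t (1 / 2).
    exists t, (t + Num.min (1/2) (d / 2)).
    have m1 : 0 < Num.min (1/2) (d / 2) by rewrite lt_min; apply/andP; split; lra.
    have m2 : Num.min (1/2) (d / 2) <= 1 / 2 by rewrite ge_min lexx.
    have m3 : Num.min (1/2) (d / 2) <= d / 2 by rewrite ge_min lexx orbT.
    split=> //; [lra|lra|move=> s /andP[ts st]].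
    by rewrite ger0_norm ?subr_ge0//; lra.
  exists (t - Num.min (1/2) (d / 2)), t.
  have m1 : 0 < Num.min (1/2) (d / 2) by rewrite lt_min; apply/andP; split; lra.
  have m2 : Num.min (1/2) (d / 2) <= 1 / 2 by rewrite ge_min lexx.
  have m3 : Num.min (1/2) (d / 2) <= d / 2 by rewrite ge_min lexx orbT.
  split=> //; [lra|lra|move=> s /andP[ts st]].
  by rewrite ler0_norm ?subr_le0//; lra.
have iFab : mu.-integrable `[a, b] (EFin \o F) by exact: integrable_sub_itv iF.
have icst r : mu.-integrable `[a, b] (EFin \o (fun=> r)).
  by apply: cts_integrable; exact: cts_cst.
have lenE r : \int[mu]_(s in `[a, b]) (fun=> r) s = r * (b - a).
  by rewrite Rintegral_cst//= lebesgue_measure_itv/= lte_fin ab.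
have : `|\int[mu]_(s in `[a, b]) (F s - F t)| <= `|F t| / 2 * (b - a).
  apply: le_trans (le_normr_Rintegral _ _) _ => //.
    by have := integrable_lin 1 (-1) iFab (icst (F t)); apply: eq_integrable_itv => s _; ring.
  rewrite -lenE; apply: le_Rintegral_itv => //.
    apply: integrable_normr.
    by have := integrable_lin 1 (-1) iFab (icst (F t)); apply: eq_integrable_itv => s _; ring.
  move=> s sab; apply: Hd; last exact: abt.
  by move: sab => /andP[? ?]; apply/andP; split; lra.
rewrite RintegralB// (F0 a b a0 (ltW ab) b1) lenE sub0r normrN normrM [`|b - a|]gtr0_norm ?subr_gt0//.
by rewrite ler_pM2r ?subr_gt0// => ?; lra.
Qed.

Section regular_curve.
Variables (h h1 h2 : R -> pt).
Hypothesis W : W22 h h1 h2.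
Hypothesis N : forall t, 0 <= t <= 1 -> h1 t != (0, 0).

Let x t := (h1 t).1.
Let y t := (h1 t).2.
Let X t := (h2 t).1.
Let Y t := (h2 t).2.
Local Notation v := (speed h1).
Local Notation S := (arclen h1).

Lemma W22_AC1 : abscont 0 1 (fun t => (h1 t).1) (fun t => (h2 t).1).
Proof.
by case: W => -[_ _ i1 i2] _ _ H; apply: AC_primitive => // t t01; rewrite {1}H.
Qed.

Lemma W22_AC2 : abscont 0 1 (fun t => (h1 t).2) (fun t => (h2 t).2).
Proof.
by case: W => -[_ _ i1 i2] _ _ H; apply: AC_primitive => // t t01; rewrite {1}H.
Qed.

Lemma W22_AC01 : abscont 0 1 (fun t => (h t).1) (fun t => (h1 t).1).
Proof.
by case: W => -[i1 i2 _ _] _ H _; apply: AC_primitive => // t t01; rewrite {1}H.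
Qed.

Lemma W22_AC02 : abscont 0 1 (fun t => (h t).2) (fun t => (h1 t).2).
Proof.
by case: W => -[i1 i2 _ _] _ H _; apply: AC_primitive => // t t01; rewrite {1}H.
Qed.

Lemma speed_sqr (k1 : R -> pt) t : speed k1 t ^+ 2 = (k1 t).1 ^+ 2 + (k1 t).2 ^+ 2.
Proof. by rewrite sqr_sqrtr// addr_ge0 ?sqr_ge0. Qed.

Lemma speed_ge0 (k1 : R -> pt) t : 0 <= speed k1 t. Proof. exact: sqrtr_ge0. Qed.

Lemma speed_gt0 t : 0 <= t <= 1 -> 0 < v t.
Proof.
move=> t01; rewrite sqrtr_gt0 lt_neqAle addr_ge0 ?sqr_ge0// andbT eq_sym.
rewrite paddr_eq0 ?sqr_ge0// !sqrf_eq0; have := N t01.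
by case: (h1 t) => a b; rewrite xpair_eqE.
Qed.

Definition dspeed t := ((h1 t).1 * (h2 t).1 + (h1 t).2 * (h2 t).2) / v t.

Lemma AC_speed : abscont 0 1 v dspeed.
Proof.
have A := AC_add (AC_sqr W22_AC1) (AC_sqr W22_AC2).
have p t : 0 <= t <= 1 -> 0 < (h1 t).1 ^+ 2 + (h1 t).2 ^+ 2.
  by move=> t01; rewrite -speed_sqr exprn_gt0// speed_gt0.
have := AC_comp A (phi := Num.sqrt) (dphi := fun z => (2 * Num.sqrt z)^-1).
move=> B; apply: AC_ext (B _ _) => //.
- move=> t t01; rewrite -/(v t) /dspeed; have := speed_gt0 t01 => v0.
  by field; rewrite gt_eqF.
- by move=> t t01; apply: is_derive1_sqrt; exact: p.
- apply: within_cts_inv => [|t]; last first.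
    by rewrite /= in_itv/= => t01; rewrite gt_eqF// mulr_gt0// sqrtr_gt0 p.
  apply: within_cts_mul; first exact: within_cts_cst.
  by apply: within_cts_comp (AC_cts A) _ => t _; exact: sqrt_continuous.
Qed.

Lemma speed_cts : {within `[0, 1], continuous v}.
Proof. exact: AC_cts AC_speed. Qed.

Lemma speed_integrable : mu.-integrable `[0, 1] (EFin \o v).
Proof. by apply: within_cts_integrable; exact: speed_cts. Qed.

Lemma arclen0 : S 0 = 0.
Proof. by rewrite /arclen set_itv1 Rintegral_set1. Qed.

Lemma AC_arclen : abscont 0 1 S v.
Proof.
by apply: AC_primitive => [|t _]; [exact: speed_integrable|rewrite arclen0 add0r].
Qed.

Lemma arclen_le a b : 0 <= a -> a <= b -> b <= 1 -> S a <= S b.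
Proof.
move=> a0 ab b1; rewrite -subr_ge0 (AC_arclen.2)//.
by apply: Rintegral_ge0 => t _; exact: speed_ge0.
Qed.

Lemma arclen_itv t : 0 <= t <= 1 -> 0 <= S t <= S 1.
Proof. by move=> /andP[t0 t1]; rewrite -{1}arclen0 !arclen_le. Qed.

Lemma arclen_gt0 : 0 < S 1.
Proof.
have [c c01 vc] := EVT_min ler01 speed_cts.
have c01' : 0 <= c <= 1 by move: c01; rewrite in_itv.
apply: lt_le_trans (speed_gt0 c01') _.
have ic : mu.-integrable `[0, 1] (EFin \o (fun=> v c)) by apply: cts_integrable; exact: cts_cst.
have := le_Rintegral_itv ic speed_integrable.
rewrite Rintegral_cst//= lebesgue_measure_itv/= lte_fin ltr01/= subr0 mulr1; apply.
by move=> t t01; apply: vc; rewrite in_itv.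
Qed.

Lemma AC_arclen_comp f df : (forall s, is_derive s 1 f (df s)) -> continuous df ->
  abscont 0 1 (fun t => f (S t)) (fun t => df (S t) * v t).
Proof.
move=> d c; apply: AC_comp => //; first exact: AC_arclen.
apply: within_cts_comp (AC_cts AC_arclen) _ => t _; exact: c.
Qed.

Lemma W22_sqr1 : mu.-integrable `[0, 1] (EFin \o (fun t => (h2 t).1 ^+ 2)).
Proof. by case: W => _ [? ?]. Qed.

Lemma W22_sqr2 : mu.-integrable `[0, 1] (EFin \o (fun t => (h2 t).2 ^+ 2)).
Proof. by case: W => _ [? ?]. Qed.

Definition det t := (h1 t).1 * (h2 t).2 - (h1 t).2 * (h2 t).1.

Definition bend := \int[mu]_(t in `[0, 1]) (det t ^+ 2 / v t ^+ 5).

Lemma bend_integrable : mu.-integrable `[0, 1] (EFin \o (fun t => det t ^+ 2 / v t ^+ 5)).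
Proof.
have cx := AC_cts W22_AC1; have cy := AC_cts W22_AC2.
have iXY := integrable_mulr W22_AC1.1 W22_AC2.1 W22_sqr1 W22_sqr2.
have cV : {within `[0, 1], continuous (fun t => (v t ^+ 5)^-1)}.
  apply: within_cts_inv => [|t]; last first.
    by rewrite /= in_itv/= => t01; rewrite gt_eqF// exprn_gt0// speed_gt0.
  by apply: (within_cts_comp (g := fun z => z ^+ 5)) speed_cts _ => t _; exact: exprn_continuous.
have i1 := integrable_mul_cts (within_cts_mul (within_cts_mul cx cx) cV) W22_sqr2.
have i2 := integrable_mul_cts (within_cts_mul (within_cts_mul cy cy) cV) W22_sqr1.
have i3 := integrable_mul_cts (within_cts_mul (within_cts_mul cx cy) cV) iXY.
have := integrable_add (integrable_add i1 i2) (integrable_scale (-2) i3).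
by apply: eq_integrable_itv => t _; rewrite /det; ring.
Qed.

Lemma energyE lam : energy lam h1 h2 = bend + lam * S 1.
Proof.
rewrite /energy /bend /arclen -RintegralZl//; last exact: speed_integrable.
rewrite -RintegralD//; first exact: bend_integrable.
by apply: integrable_scale; exact: speed_integrable.
Qed.

(** Lagrange's identity: the gap is [det^2 / v^2]. It makes [dspeed] square integrable, as the
    second derivatives of competitors require. *)
Lemma dspeed_sqr_le t : 0 <= t <= 1 -> dspeed t ^+ 2 <= (h2 t).1 ^+ 2 + (h2 t).2 ^+ 2.
Proof.
move=> t01; have v0 := speed_gt0 t01.
rewrite /dspeed expr_div_n ler_pdivrMr ?exprn_gt0// speed_sqr -subr_ge0.
rewrite (_ : _ - _ = det t ^+ 2) ?sqr_ge0// /det; ring.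
Qed.

Lemma dspeed_sqr_integrable : mu.-integrable `[0, 1] (EFin \o (fun t => dspeed t ^+ 2)).
Proof.
apply: (le_integrable _ _ _ (integrable_add W22_sqr1 W22_sqr2)) => //.
  apply/measurable_EFinP; apply: measurable_funX.
  by apply/measurable_EFinP; exact: (measurable_int mu AC_speed.1).
move=> t /=; rewrite in_itv/= => t01.
by rewrite lee_fin !ger0_norm ?addr_ge0 ?sqr_ge0// dspeed_sqr_le.
Qed.

End regular_curve.

End Curves.

(** * Moving frames along a curve, and a criterion for instability *)

Section Frames.
Variable R : realType.
Local Notation mu := (@lebesgue_measure R).
Local Notation pt := (R * R)%type.
Implicit Types (f : R -> R) (a b s t : R).

(** A unit tangent as a function of arclength with signed curvature [k]; the equations are Frenet's,
    with normal [(- T2, T1)]. *)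
Definition frame (T1 T2 k : R -> R) :=
  [/\ forall s, is_derive s 1 T1 (- k s * T2 s), forall s, is_derive s 1 T2 (k s * T1 s),
      forall s, T1 s ^+ 2 + T2 s ^+ 2 = 1 & continuous k].

Lemma frame_cts1 T1 T2 k : frame T1 T2 k -> continuous T1.
Proof. by case=> d _ _ _ s; exact: derive_continuous (d s). Qed.

Lemma frame_cts2 T1 T2 k : frame T1 T2 k -> continuous T2.
Proof. by case=> _ d _ _ s; exact: derive_continuous (d s). Qed.

Lemma frame_dcts1 T1 T2 k : frame T1 T2 k -> continuous (fun s => - k s * T2 s).
Proof.
move=> F; have [_ _ _ ck] := F; apply: ctsM; last exact: frame_cts2 F.
by move=> s; apply: continuousN; exact: ck.
Qed.

Lemma frame_dcts2 T1 T2 k : frame T1 T2 k -> continuous (fun s => k s * T1 s).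
Proof. by move=> F; have [_ _ _ ck] := F; apply: ctsM => //; exact: frame_cts1 F. Qed.

Section tangent.
Variables (g g1 g2 : R -> pt) (T1 T2 k : R -> R).
Hypothesis W : W22 g g1 g2.
Hypothesis N : forall t, 0 <= t <= 1 -> g1 t != (0, 0).
Hypothesis F : frame T1 T2 k.
Local Notation v := (speed g1).
Local Notation S := (arclen g1).

Section of_curve.
Variable c : R -> pt.
Hypothesis gc : forall t, 0 <= t <= 1 -> g t = c (S t).

(** The curve is known only through its arclength parametrization [c]. Both sides are continuous
    densities of the first coordinate of [g], hence they agree at every point. *)
Lemma tangent_of_curve1 : (forall s, is_derive s 1 (fun s => (c s).1) (T1 s)) ->
  forall t, 0 <= t <= 1 -> (g1 t).1 = T1 (S t) * v t.
Proof.
move=> dc; have A1 := AC_arclen_comp W N dc (frame_cts1 F).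
have A2 := W22_AC01 W.
apply: (@AC_cts_deriv_unique _ (fun t => (g t).1)) => //.
- by apply: AC_ext A1 => // t /gc ->.
- exact: AC_cts (W22_AC1 W).
- apply: within_cts_mul; last exact: speed_cts W N.
  apply: within_cts_comp (AC_cts (AC_arclen W N)) _ => t _; exact: (frame_cts1 F).
Qed.

Lemma tangent_of_curve2 : (forall s, is_derive s 1 (fun s => (c s).2) (T2 s)) ->
  forall t, 0 <= t <= 1 -> (g1 t).2 = T2 (S t) * v t.
Proof.
move=> dc; have A1 := AC_arclen_comp W N dc (frame_cts2 F).
have A2 := W22_AC02 W.
apply: (@AC_cts_deriv_unique _ (fun t => (g t).2)) => //.
- by apply: AC_ext A1 => // t /gc ->.
- exact: AC_cts (W22_AC2 W).
- apply: within_cts_mul; last exact: speed_cts W N.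
  apply: within_cts_comp (AC_cts (AC_arclen W N)) _ => t _; exact: (frame_cts2 F).
Qed.

End of_curve.

Lemma AC_frame1 : abscont 0 1 (fun t => T1 (S t) * v t)
  (fun t => dspeed g1 g2 t * T1 (S t) - v t ^+ 2 * (k (S t) * T2 (S t))).
Proof.
have [d1 _ _ _] := F.
have := AC_mul (AC_arclen_comp W N d1 (frame_dcts1 F)) (AC_speed W N).
by apply: AC_ext => // t _; ring.
Qed.

Lemma AC_frame2 : abscont 0 1 (fun t => T2 (S t) * v t)
  (fun t => dspeed g1 g2 t * T2 (S t) + v t ^+ 2 * (k (S t) * T1 (S t))).
Proof.
have [_ d2 _ _] := F.
have := AC_mul (AC_arclen_comp W N d2 (frame_dcts2 F)) (AC_speed W N).
by apply: AC_ext => // t _; ring.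
Qed.

Hypothesis tan1 : forall t, 0 <= t <= 1 -> (g1 t).1 = T1 (S t) * v t.
Hypothesis tan2 : forall t, 0 <= t <= 1 -> (g1 t).2 = T2 (S t) * v t.

Lemma second_ae1 : {ae mu, forall t : R, 0 < t < 1 ->
  (g2 t).1 = dspeed g1 g2 t * T1 (S t) - v t ^+ 2 * (k (S t) * T2 (S t))}.
Proof.
apply: AC_deriv_unique (W22_AC1 W) _; apply: AC_ext AC_frame1 => // t t01.
by rewrite tan1.
Qed.

Lemma second_ae2 : {ae mu, forall t : R, 0 < t < 1 ->
  (g2 t).2 = dspeed g1 g2 t * T2 (S t) + v t ^+ 2 * (k (S t) * T1 (S t))}.
Proof.
apply: AC_deriv_unique (W22_AC2 W) _; apply: AC_ext AC_frame2 => // t t01.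
by rewrite tan2.
Qed.

(** Inserting the frame gives [det = k v^3] almost everywhere, which turns the integrand into the
    density of [B] composed with the arclength. *)
Lemma bend_frame (B : R -> R) : (forall s, is_derive s 1 B (k s ^+ 2)) ->
  bend g1 g2 = B (S 1) - B 0.
Proof.
move=> dB; have [_ _ T1T2 ck] := F.
have ck2 : continuous (fun s => k s ^+ 2) by apply: ctsM.
have A := AC_arclen_comp W N dB ck2.
rewrite -[in B 0](arclen0 g1) (A.2) ?lexx ?ler01// /bend.
apply: Rintegral_ae_eq; [exact: bend_integrable W N|exact: A.1|].
have FF := ae_filter_ringOfSetsType mu.
apply: filterS2 second_ae1 second_ae2 => t + + t01.
have t01' : 0 <= t <= 1 by move: t01 => /andP[? ?]; rewrite !ltW.
move=> /(_ t01) X /(_ t01) Y.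
have -> : det g1 g2 t = k (S t) * v t ^+ 3.
  rewrite /det X Y tan1// tan2//.
  transitivity (k (S t) * v t ^+ 3 * (T1 (S t) ^+ 2 + T2 (S t) ^+ 2)); first by ring.
  by rewrite T1T2 mulr1.
by have v0 := speed_gt0 N t01'; field; rewrite gt_eqF.
Qed.

End tangent.

(** * Competitors sharing the speed profile of the given curve *)

Section competitor.
Variables (g g1 g2 : R -> pt) (U1 U2 k : R -> R) (rho : R).
Hypothesis W : W22 g g1 g2.
Hypothesis N : forall t, 0 <= t <= 1 -> g1 t != (0, 0).
Hypothesis F : frame U1 U2 k.
Hypothesis rho0 : 0 < rho.
Local Notation v := (speed g1).
Local Notation S := (arclen g1).
Local Notation dv := (dspeed g1 g2).

(** The curve with frame [U], scaled by [rho] and traversed with the speed profile of [g]. Its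
    second derivative contains the same rough factor [dspeed] as that of [g], so the two are close
    in [L^2] as soon as the frames are close uniformly. *)
Definition comp1 t : pt := (rho * (U1 (S t) * v t), rho * (U2 (S t) * v t)).
Definition comp2 t : pt :=
  (rho * (dv t * U1 (S t) - v t ^+ 2 * (k (S t) * U2 (S t))),
   rho * (dv t * U2 (S t) + v t ^+ 2 * (k (S t) * U1 (S t)))).
Definition comp0 t : pt :=
  (\int[mu]_(s in `[0, t]) (comp1 s).1, \int[mu]_(s in `[0, t]) (comp1 s).2).

Lemma comp_AC1 : abscont 0 1 (fun t => (comp1 t).1) (fun t => (comp2 t).1).
Proof. exact: AC_scale (AC_frame1 W N F). Qed.

Lemma comp_AC2 : abscont 0 1 (fun t => (comp1 t).2) (fun t => (comp2 t).2).
Proof. exact: AC_scale (AC_frame2 W N F). Qed.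

Let cv := speed_cts W N.

Let cS f : continuous f -> {within `[0, 1], continuous (fun t => f (S t))}.
Proof.
by move=> cf; apply: within_cts_comp (AC_cts (AC_arclen W N)) _ => t _; exact: cf.
Qed.

Let sqr_int (p r : R -> R) : {within `[0, 1], continuous p} -> {within `[0, 1], continuous r} ->
  mu.-integrable `[0, 1] (EFin \o (fun t => (dv t * p t + r t) ^+ 2)).
Proof.
move=> cp cr.
have i1 := integrable_mul_cts (within_cts_mul cp cp) (dspeed_sqr_integrable W N).
have i2 := integrable_mul_cts (within_cts_mul cp cr) (AC_speed W N).1.
have i3 := within_cts_integrable (within_cts_mul cr cr).
have := integrable_add (integrable_add i1 (integrable_scale 2 i2)) i3.
by apply: eq_integrable_itv => t _; ring.
Qed.

Lemma comp_W22 : W22 comp0 comp1 comp2.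
Proof.
have A1 := comp_AC1; have A2 := comp_AC2.
have [_ _ _ ck] := F.
have cU1 := frame_cts1 F; have cU2 := frame_cts2 F.
have cr1 : {within `[0, 1], continuous (fun t => - rho * (v t ^+ 2 * (k (S t) * U2 (S t))))}.
  apply: within_cts_mul; first exact: within_cts_cst.
  apply: within_cts_mul; first exact: within_cts_mul cv cv.
  by apply: within_cts_mul; exact: cS.
have cr2 : {within `[0, 1], continuous (fun t => rho * (v t ^+ 2 * (k (S t) * U1 (S t))))}.
  apply: within_cts_mul; first exact: within_cts_cst.
  apply: within_cts_mul; first exact: within_cts_mul cv cv.
  by apply: within_cts_mul; exact: cS.
have cp1 : {within `[0, 1], continuous (fun t => rho * U1 (S t))}.
  by apply: within_cts_mul; [exact: within_cts_cst|exact: cS].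
have cp2 : {within `[0, 1], continuous (fun t => rho * U2 (S t))}.
  by apply: within_cts_mul; [exact: within_cts_cst|exact: cS].
split.
- split.
  + exact: within_cts_integrable (AC_cts A1).
  + exact: within_cts_integrable (AC_cts A2).
  + exact: A1.1.
  + exact: A2.1.
- split.
    by have := sqr_int cp1 cr1; apply: eq_integrable_itv => t _; rewrite /comp2/=; ring.
  by have := sqr_int cp2 cr2; apply: eq_integrable_itv => t _; rewrite /comp2/=; ring.
- by move=> t _; rewrite /comp0 !set_itv1 !Rintegral_set1 !add0r.
- move=> t /andP[t0 t1].
  rewrite -(A1.2 0 t)// -(A2.2 0 t)// ![_ + (_ - _)]addrC !subrK.
  by rewrite -surjective_pairing.
Qed.

Lemma comp_speed t : 0 <= t <= 1 -> speed comp1 t = rho * v t.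
Proof.
move=> t01; have [_ _ U12 _] := F; have v0 := speed_ge0 g1 t.
rewrite /speed /comp1/= (_ : _ + _ = (rho * v t) ^+ 2).
  by rewrite sqrtr_sqr ger0_norm// mulr_ge0// ltW.
transitivity ((rho * v t) ^+ 2 * (U1 (S t) ^+ 2 + U2 (S t) ^+ 2)); first by ring.
by rewrite U12 mulr1.
Qed.

Lemma comp_neq0 t : 0 <= t <= 1 -> comp1 t != (0, 0).
Proof.
move=> t01; apply/eqP => E.
have : 0 < speed comp1 t by rewrite comp_speed// mulr_gt0// (speed_gt0 N).
by rewrite /speed E/= expr0n addr0 sqrtr0 ltxx.
Qed.

Lemma comp_end1 (G : R -> R) : (forall s, is_derive s 1 G (U1 s)) ->
  (comp0 1).1 = rho * (G (S 1) - G 0).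
Proof.
move=> dG; have A := AC_scale rho (AC_arclen_comp W N dG (frame_cts1 F)).
by rewrite /comp0/= -(A.2 0 1)// arclen0; ring.
Qed.

Lemma comp_end2 (G : R -> R) : (forall s, is_derive s 1 G (U2 s)) ->
  (comp0 1).2 = rho * (G (S 1) - G 0).
Proof.
move=> dG; have A := AC_scale rho (AC_arclen_comp W N dG (frame_cts2 F)).
by rewrite /comp0/= -(A.2 0 1)// arclen0; ring.
Qed.

Lemma comp_energy lam (B : R -> R) : (forall s, is_derive s 1 B (k s ^+ 2)) ->
  energy lam comp1 comp2 = (B (S 1) - B 0) / rho + lam * (rho * S 1).
Proof.
move=> dB; have [_ _ U12 ck] := F.
have ck2 : continuous (fun s => k s ^+ 2) by apply: ctsM.
have A := AC_scale rho^-1 (AC_arclen_comp W N dB ck2).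
rewrite (energyE comp_W22 comp_neq0); congr (_ + lam * _); last first.
  rewrite /arclen -RintegralZl//; last exact: speed_integrable W N.
  by apply: eq_Rintegral_itv => t t01; rewrite comp_speed.
transitivity (rho^-1 * B (S 1) - rho^-1 * B (S 0)); last by rewrite arclen0; ring.
rewrite (A.2 0 1)// /bend; apply: eq_Rintegral_itv => t t01.
have v0 := speed_gt0 N t01.
have -> : det comp1 comp2 t = rho ^+ 2 * (k (S t) * v t ^+ 3).
  rewrite /det /comp1 /comp2/=.
  transitivity (rho ^+ 2 * (k (S t) * v t ^+ 3) * (U1 (S t) ^+ 2 + U2 (S t) ^+ 2)); first by ring.
  by rewrite U12 mulr1.
by rewrite comp_speed//; field; rewrite !gt_eqF.
Qed.

End competitor.


Lemma sqr_sub_integrable (p r : R -> R) :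
  mu.-integrable `[0, 1] (EFin \o p) -> mu.-integrable `[0, 1] (EFin \o r) ->
  mu.-integrable `[0, 1] (EFin \o (fun t => p t ^+ 2)) ->
  mu.-integrable `[0, 1] (EFin \o (fun t => r t ^+ 2)) ->
  mu.-integrable `[0, 1] (EFin \o (fun t => (p t - r t) ^+ 2)).
Proof.
move=> ip ir ip2 ir2; have ipr := integrable_mulr ip ir ip2 ir2.
have := integrable_add (integrable_add ip2 ir2) (integrable_scale (-2) ipr).
by apply: eq_integrable_itv => t _; ring.
Qed.

Lemma sqr_le_of_norm (r e : R) : `|r| <= e -> r ^+ 2 <= e ^+ 2.
Proof.
by move=> h; rewrite -(real_normK (num_real r)) ler_sqr ?nnegrE// (le_trans _ h).
Qed.

Lemma sqr_add_le (p r : R) : (p + r) ^+ 2 <= 2 * p ^+ 2 + 2 * r ^+ 2.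
Proof. by have := sqr_ge0 (p - r); rewrite sqrrB sqrrD; lra. Qed.

(** * Distance between the given curve and a competitor *)

Section distance.
Variables (g g1 g2 : R -> pt) (T1 T2 k : R -> R) (U1 U2 kU : R -> R) (rho eps : R).
Hypothesis W : W22 g g1 g2.
Hypothesis N : forall t, 0 <= t <= 1 -> g1 t != (0, 0).
Hypothesis F : frame T1 T2 k.
Hypothesis FU : frame U1 U2 kU.
Hypothesis rho0 : 0 < rho.
Local Notation v := (speed g1).
Local Notation S := (arclen g1).
Local Notation dv := (dspeed g1 g2).
Hypothesis tan1 : forall t, 0 <= t <= 1 -> (g1 t).1 = T1 (S t) * v t.
Hypothesis tan2 : forall t, 0 <= t <= 1 -> (g1 t).2 = T2 (S t) * v t.
Hypothesis g0 : g 0 = (0, 0).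
Hypothesis close1 : forall s, 0 <= s <= S 1 -> `|T1 s - rho * U1 s| <= eps.
Hypothesis close2 : forall s, 0 <= s <= S 1 -> `|T2 s - rho * U2 s| <= eps.
Hypothesis close3 : forall s, 0 <= s <= S 1 -> `|k s * T2 s - rho * (kU s * U2 s)| <= eps.
Hypothesis close4 : forall s, 0 <= s <= S 1 -> `|k s * T1 s - rho * (kU s * U1 s)| <= eps.

(** The three groups bound the terms of orders 0, 1 and 2 in [W22_dist], up to the factor [eps^2]:
    each coordinate deviates by at most [eps * S 1], its derivative by [eps * v], and for the second
    derivative [(x + y)^2 <= 2 x^2 + 2 y^2] is summed over two coordinates. *)
Definition dist_weight t := 2 * S 1 ^+ 2 + 2 * v t ^+ 2 + (4 * dv t ^+ 2 + 4 * (v t ^+ 2) ^+ 2).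

Lemma dist_weight_integrable : mu.-integrable `[0, 1] (EFin \o dist_weight).
Proof.
have cv := speed_cts W N.
have i1 : mu.-integrable `[0, 1] (EFin \o (fun t => 2 * S 1 ^+ 2 + 2 * v t ^+ 2)).
  apply: within_cts_integrable; apply: within_cts_add; first exact: within_cts_cst.
  by apply: within_cts_mul; [exact: within_cts_cst|exact: within_cts_mul].
have i2 : mu.-integrable `[0, 1] (EFin \o (fun t => (v t ^+ 2) ^+ 2)).
  by apply: within_cts_integrable; apply: within_cts_mul; exact: within_cts_mul.
exact: integrable_add i1 (integrable_lin 4 4 (dspeed_sqr_integrable W N) i2).
Qed.

Let h0 := comp0 g1 U1 U2 rho.
Let h1 := comp1 g1 U1 U2 rho.
Let h2 := comp2 g1 g2 U1 U2 kU rho.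
Let Wh : W22 h0 h1 h2 := comp_W22 rho W N FU.

Let diff_bound (p q P Q : R -> R) : abscont 0 1 P p -> abscont 0 1 Q q -> P 0 = 0 -> Q 0 = 0 ->
  (forall t, 0 <= t <= 1 -> `|p t - q t| <= eps * v t) ->
  forall t, 0 <= t <= 1 -> `|P t - Q t| <= eps * S 1.
Proof.
move=> AP AQ P0 Q0 pq t /andP[t0 t1].
have AD := AC_add AP (AC_scale (-1) AQ).
have := AC_le_norm AD (lexx 0) t0 t1; rewrite P0 Q0 mulr0 addr0 subr0 mulN1r => /le_trans; apply.
have iv := integrable_sub_itv (lexx 0) t1 (speed_integrable W N).
apply: (@le_trans _ _ (\int[mu]_(s in `[0, t]) (eps * v s))).
  apply: le_Rintegral_itv.
  - by apply: integrable_normr; exact: AC_integrable_sub AD _ _.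
  - exact: integrable_scale.
  - by move=> s /andP[s0 st]; rewrite mulN1r pq// s0 (le_trans st).
rewrite RintegralZl//; apply: ler_wpM2l.
  by apply: le_trans (normr_ge0 _) (close1 (s := 0) _); rewrite lexx ltW// (arclen_gt0 W N).
by have := arclen_le W N t0 t1 (lexx 1).
Qed.

Lemma comp_dist : W22_dist g g1 g2 h0 h1 h2 <=
  eps * Num.sqrt (\int[mu]_(t in `[0, 1]) dist_weight t).
Proof.
have eps0 : 0 <= eps.
  by apply: le_trans (normr_ge0 _) (close1 (s := 0) _); rewrite lexx ltW// (arclen_gt0 W N).
have A11 := W22_AC1 W; have A12 := W22_AC2 W; have A01 := W22_AC01 W; have A02 := W22_AC02 W.
have B11 := W22_AC1 Wh; have B12 := W22_AC2 Wh; have B01 := W22_AC01 Wh; have B02 := W22_AC02 Wh.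
have Z1 := AC_frame1 W N F; have Z2 := AC_frame2 W N F.
have e1 := second_ae1 W N F tan1; have e2 := second_ae2 W N F tan2.
have sub_cts p q P Q : abscont 0 1 P p -> abscont 0 1 Q q ->
    mu.-integrable `[0, 1] (EFin \o (fun t => (P t - Q t) ^+ 2)).
  move=> AP AQ; have c := AC_cts (AC_add AP (AC_scale (-1) AQ)).
  have := within_cts_integrable (within_cts_mul c c).
  by apply: eq_integrable_itv => t _; ring.
pose Z1f t := dv t * T1 (S t) - v t ^+ 2 * (k (S t) * T2 (S t)).
pose Z2f t := dv t * T2 (S t) + v t ^+ 2 * (k (S t) * T1 (S t)).
have iZ1 : mu.-integrable `[0, 1] (EFin \o (fun t => Z1f t ^+ 2)).
  have := W22_sqr1 (comp_W22 1 W N F); apply: eq_integrable_itv => t _.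
  by rewrite /comp2/= mul1r.
have iZ2 : mu.-integrable `[0, 1] (EFin \o (fun t => Z2f t ^+ 2)).
  have := W22_sqr2 (comp_W22 1 W N F); apply: eq_integrable_itv => t _.
  by rewrite /comp2/= mul1r.
pose A0 t := ((g t).1 - (h0 t).1) ^+ 2 + ((g t).2 - (h0 t).2) ^+ 2
      + ((g1 t).1 - (h1 t).1) ^+ 2 + ((g1 t).2 - (h1 t).2) ^+ 2.
have iA0 : mu.-integrable `[0, 1] (EFin \o A0).
  do ?apply: integrable_add.
  - exact: sub_cts A01 B01.
  - exact: sub_cts A02 B02.
  - exact: sub_cts A11 B11.
  - exact: sub_cts A12 B12.
pose A t := A0 t + ((g2 t).1 - (h2 t).1) ^+ 2 + ((g2 t).2 - (h2 t).2) ^+ 2.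
pose A' t := A0 t + (Z1f t - (h2 t).1) ^+ 2 + (Z2f t - (h2 t).2) ^+ 2.
have iA : mu.-integrable `[0, 1] (EFin \o A).
  apply: integrable_add; first apply: integrable_add => //.
  - exact: sqr_sub_integrable A11.1 B11.1 (W22_sqr1 W) (W22_sqr1 Wh).
  - exact: sqr_sub_integrable A12.1 B12.1 (W22_sqr2 W) (W22_sqr2 Wh).
have iA' : mu.-integrable `[0, 1] (EFin \o A').
  apply: integrable_add; first apply: integrable_add => //.
  - exact: sqr_sub_integrable Z1.1 B11.1 iZ1 (W22_sqr1 Wh).
  - exact: sqr_sub_integrable Z2.1 B12.1 iZ2 (W22_sqr2 Wh).
(* The frame formula for [g2] holds only almost everywhere; substituting it under the integral makes
   a pointwise estimate possible. *)
have AA' : \int[mu]_(t in `[0, 1]) A t = \int[mu]_(t in `[0, 1]) A' t.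
  apply: Rintegral_ae_eq => //; have FF := ae_filter_ringOfSetsType mu.
  by apply: filterS2 e1 e2 => t E1 E2 t01; rewrite /A /A' E1// E2.
have S01 t : 0 <= t <= 1 -> 0 <= S t <= S 1 by exact: (arclen_itv W N).
have h00 : h0 0 = (0, 0) by rewrite /h0 /comp0 !set_itv1 !Rintegral_set1.
have b1 t : 0 <= t <= 1 -> `|(g1 t).1 - (h1 t).1| <= eps * v t.
  move=> t01; rewrite tan1// /h1 /comp1/= mulrA -mulrBl normrM (ger0_norm (speed_ge0 _ _)).
  by rewrite ler_wpM2r ?speed_ge0// close1// S01.
have b2 t : 0 <= t <= 1 -> `|(g1 t).2 - (h1 t).2| <= eps * v t.
  move=> t01; rewrite tan2// /h1 /comp1/= mulrA -mulrBl normrM (ger0_norm (speed_ge0 _ _)).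
  by rewrite ler_wpM2r ?speed_ge0// close2// S01.
have b01 := diff_bound A01 B01 (congr1 fst g0) (congr1 fst h00) b1.
have b02 := diff_bound A02 B02 (congr1 snd g0) (congr1 snd h00) b2.
have b3 t : 0 <= t <= 1 -> (Z1f t - (h2 t).1) ^+ 2 <= eps ^+ 2 * (2 * dv t ^+ 2 + 2 * (v t ^+ 2) ^+ 2).
  move=> t01; have c1 := sqr_le_of_norm (close1 (S01 t t01)).
  have c3 := sqr_le_of_norm (close3 (S01 t t01)).
  rewrite (_ : _ - _ = dv t * (T1 (S t) - rho * U1 (S t))
    + - (v t ^+ 2) * (k (S t) * T2 (S t) - rho * (kU (S t) * U2 (S t)))); last first.
    by rewrite /Z1f /h2 /comp2/=; ring.
  apply: le_trans (sqr_add_le _ _) _.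
  rewrite [(dv t * _) ^+ 2]exprMn [(- _ * _) ^+ 2]exprMn sqrrN.
  have := ler_wpM2l (sqr_ge0 (dv t)) c1; have := ler_wpM2l (sqr_ge0 (v t ^+ 2)) c3.
  by lra.
have b4 t : 0 <= t <= 1 -> (Z2f t - (h2 t).2) ^+ 2 <= eps ^+ 2 * (2 * dv t ^+ 2 + 2 * (v t ^+ 2) ^+ 2).
  move=> t01; have c1 := sqr_le_of_norm (close2 (S01 t t01)).
  have c3 := sqr_le_of_norm (close4 (S01 t t01)).
  rewrite (_ : _ - _ = dv t * (T2 (S t) - rho * U2 (S t))
    + (v t ^+ 2) * (k (S t) * T1 (S t) - rho * (kU (S t) * U1 (S t)))); last first.
    by rewrite /Z2f /h2 /comp2/=; ring.
  apply: le_trans (sqr_add_le _ _) _.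
  rewrite [(dv t * _) ^+ 2]exprMn [(v t ^+ 2 * _) ^+ 2]exprMn.
  have := ler_wpM2l (sqr_ge0 (dv t)) c1; have := ler_wpM2l (sqr_ge0 (v t ^+ 2)) c3.
  by lra.
have AM : \int[mu]_(t in `[0, 1]) A' t <= eps ^+ 2 * \int[mu]_(t in `[0, 1]) dist_weight t.
  rewrite -RintegralZl//; last exact: dist_weight_integrable.
  apply: le_Rintegral_itv => //; first by apply: integrable_scale; exact: dist_weight_integrable.
  move=> t t01; rewrite /A' /A0 /dist_weight.
  have := b3 t t01; have := b4 t t01.
  have := sqr_le_of_norm (b1 t t01); have := sqr_le_of_norm (b2 t t01).
  have := sqr_le_of_norm (b01 t t01); have := sqr_le_of_norm (b02 t t01).
  by rewrite !exprMn; lra.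
rewrite /W22_dist -[X in Num.sqrt X]/(\int[mu]_(t in `[0, 1]) A t) AA'.
apply: le_trans (ler_wsqrtr AM) _.
by rewrite sqrtrM ?sqr_ge0// sqrtr_sqr ger0_norm.
Qed.

End distance.

Section instability.
Variables (lam l : R) (g g1 g2 : R -> pt) (T1 T2 k B : R -> R).
Hypothesis W : W22 g g1 g2.
Hypothesis A : in_A l g g1.
Hypothesis F : frame T1 T2 k.
Local Notation L := (arclen g1 1).
Hypothesis tan1 : forall t, 0 <= t <= 1 -> (g1 t).1 = T1 (arclen g1 t) * speed g1 t.
Hypothesis tan2 : forall t, 0 <= t <= 1 -> (g1 t).2 = T2 (arclen g1 t) * speed g1 t.
Hypothesis dB : forall s, is_derive s 1 B (k s ^+ 2).

(* The competitor has the same parametrization by (rescaled) arclength as the given curve, which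
   makes closeness of the frames on [[0, L]] enough for closeness in [W^{2,2}]. *)
Definition better_competitor (eps : R) := exists rho (U1 U2 kU G1 G2 BU : R -> R),
  [/\ 0 < rho, frame U1 U2 kU,
      [/\ forall s, is_derive s 1 G1 (U1 s), forall s, is_derive s 1 G2 (U2 s) &
          forall s, is_derive s 1 BU (kU s ^+ 2)],
      [/\ rho * (G1 L - G1 0) = l, rho * (G2 L - G2 0) = 0 &
          (BU L - BU 0) / rho + lam * (rho * L) < (B L - B 0) + lam * L] &
      forall s, 0 <= s <= L -> [/\ `|T1 s - rho * U1 s| <= eps, `|T2 s - rho * U2 s| <= eps,
        `|k s * T2 s - rho * (kU s * U2 s)| <= eps & `|k s * T1 s - rho * (kU s * U1 s)| <= eps]].

Lemma unstable_of_competitors : (forall eps, 0 < eps -> better_competitor eps) ->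
  ~ stable lam l g g1 g2.
Proof.
case: A => N g0 gl H [delta delta0 Hst].
pose M := Num.sqrt (\int[mu]_(t in `[0, 1]) dist_weight g1 g2 t).
have M0 : 0 <= M by exact: sqrtr_ge0.
(* The summand 1 keeps the quotient meaningful for [M = 0] and the final inequality strict. *)
have eps0 : 0 < delta / (M + 1) by rewrite divr_gt0// ltr_wpDl.
have [rho [U1 [U2 [kU [G1 [G2 [BU [rho0 FU [dG1 dG2 dBU] [eG1 eG2 en] close]]]]]]]] := H _ eps0.
have Wh := comp_W22 rho W N FU.
have h00 : comp0 g1 U1 U2 rho 0 = (0, 0) by rewrite /comp0 !set_itv1 !Rintegral_set1.
have hA : in_A l (comp0 g1 U1 U2 rho) (comp1 g1 U1 U2 rho).
  split=> //; first by move=> t; exact: (comp_neq0 N FU rho0).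
  rewrite [LHS]surjective_pairing (comp_end1 rho W N FU dG1) (comp_end2 rho W N FU dG2).
  by rewrite eG1 eG2.
have dist : W22_dist g g1 g2 (comp0 g1 U1 U2 rho) (comp1 g1 U1 U2 rho) (comp2 g1 g2 U1 U2 kU rho) < delta.
  have c1 s : 0 <= s <= L -> `|T1 s - rho * U1 s| <= delta / (M + 1) by move=> /close [].
  have c2 s : 0 <= s <= L -> `|T2 s - rho * U2 s| <= delta / (M + 1) by move=> /close [].
  have c3 s : 0 <= s <= L -> `|k s * T2 s - rho * (kU s * U2 s)| <= delta / (M + 1).
    by move=> /close [].
  have c4 s : 0 <= s <= L -> `|k s * T1 s - rho * (kU s * U1 s)| <= delta / (M + 1).
    by move=> /close [].
  apply: le_lt_trans (comp_dist W N F FU tan1 tan2 g0 c1 c2 c3 c4) _.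
  rewrite -/M mulrAC ltr_pdivrMr ?ltr_wpDl// ltr_pM2l//.
  by rewrite ltrDl.
have := Hst _ _ _ Wh hA dist.
rewrite (comp_energy W N FU rho0 lam dBU) (energyE W N) (bend_frame W N F tan1 tan2 dB).
by rewrite leNgt en.
Qed.

End instability.

End Frames.

(** * Jacobi functions and the tangent of the elastica *)

Section Jacobi.
Variable R : realType.
Local Notation mu := (@lebesgue_measure R).
Local Notation pt := (R * R)%type.
Implicit Types (f : R -> R) (a b s t u : R).

Definition sn (u q : R) : R := sin (am u q).
Definition dn (u q : R) : R := delta q (am u q).
Definition eps_ (u q : R) : R := ellE (am u q) q.

Section modulus.
Variable q : R.
Hypothesis q01 : 0 <= q < 1.

Lemma is_derive_sn u : is_derive u 1 (fun u => sn u q) (cn u q * dn u q).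
Proof. exact: (@isder_comp _ sin (fun u => am u q) u _ _ (is_derive_sin _) (is_derive_am u q01)). Qed.

Lemma is_derive_cn u : is_derive u 1 (fun u => cn u q) (- (sn u q * dn u q)).
Proof.
have := @isder_comp _ cos (fun u => am u q) u _ _ (is_derive_cos _) (is_derive_am u q01).
by rewrite mulNr.
Qed.

Lemma dn_gt0 u : 0 < dn u q. Proof. exact: delta_gt0. Qed.

Lemma dn_neq0 u : dn u q != 0. Proof. by rewrite gt_eqF// dn_gt0. Qed.

Lemma is_derive_dn u : is_derive u 1 (fun u => dn u q) (- (q ^+ 2 * sn u q * cn u q)).
Proof.
apply: is_derive_ext (@isder_comp _ (delta q) (fun u => am u q) u _ _
  (is_derive_delta _ q01) (is_derive_am u q01)) _ _ => //.
by rewrite /sn /cn; field; exact: dn_neq0.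
Qed.

Lemma dn_sqr u : dn u q ^+ 2 = 1 - q ^+ 2 * sn u q ^+ 2.
Proof. exact: delta_sqr. Qed.

Lemma sn_cn u : sn u q ^+ 2 = 1 - cn u q ^+ 2.
Proof. exact: sin2cos2. Qed.

Lemma is_derive_eps u : is_derive u 1 (fun u => eps_ u q) (dn u q ^+ 2).
Proof.
exact: (@isder_comp _ (fun z => ellE z q) (fun u => am u q) u _ _
  (is_derive_ellE _ q01) (is_derive_am u q01)).
Qed.

Lemma sn_cts : continuous (fun u => sn u q).
Proof. by move=> u; exact: derive_continuous (is_derive_sn u). Qed.
Lemma cn_cts : continuous (fun u => cn u q).
Proof. by move=> u; exact: derive_continuous (is_derive_cn u). Qed.
Lemma dn_cts : continuous (fun u => dn u q).
Proof. by move=> u; exact: derive_continuous (is_derive_dn u). Qed.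

(** The model elastica: with [theta = 2 arcsin (q sn)] the tangent is [(cos theta, - sin theta)] and
    the curvature is [- theta']. The functions [elaG1], [elaG2] and [elaB] are primitives of the
    tangent coordinates and of the squared curvature. Phases from [- K] to [K] give the arc, with
    its middle at 0. *)
Definition elaT1 u := 2 * dn u q ^+ 2 - 1.
Definition elaT2 u := - (2 * q * sn u q * dn u q).
Definition elak u := - (2 * q * cn u q).
Definition elaG1 u := 2 * eps_ u q - u.
Definition elaG2 u := 2 * q * cn u q.
Definition elaB u := 4 * (eps_ u q - (1 - q ^+ 2) * u).

Lemma ela_frame : frame elaT1 elaT2 elak.
Proof.
split.
- move=> u; have d := is_derive_dn u.
  apply: is_derive_ext (isder_sub (isder_scale 2 (isder_mul d d)) (isder_cst 1 u)) _ _ => //.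
  by rewrite /elak /elaT2; ring.
- move=> u; have d := is_derive_dn u; have s := is_derive_sn u.
  apply: is_derive_ext (isder_scale (- 2 * q) (isder_mul s d)) _ _.
    by move=> z; rewrite /elaT2; ring.
  have E := dn_sqr u; rewrite /elak /elaT1.
  transitivity (- 2 * q * cn u q * (dn u q ^+ 2 - q ^+ 2 * sn u q ^+ 2)); first by ring.
  by rewrite E; ring.
- move=> u; have E := dn_sqr u; rewrite /elaT1 /elaT2.
  transitivity ((2 * dn u q ^+ 2 - 1) ^+ 2 + 4 * (q ^+ 2 * sn u q ^+ 2) * dn u q ^+ 2); first by ring.
  by rewrite E; ring.
- by apply: ctsN; apply: ctsM; [exact: cts_cst|exact: cn_cts].
Qed.

Lemma is_derive_elaG1 u : is_derive u 1 elaG1 (elaT1 u).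
Proof. exact: isder_sub (isder_scale 2 (is_derive_eps u)) (is_derive_id u 1). Qed.

Lemma is_derive_elaG2 u : is_derive u 1 elaG2 (elaT2 u).
Proof.
apply: is_derive_ext (isder_scale (2 * q) (is_derive_cn u)) _ _ => //.
by rewrite /elaT2; ring.
Qed.

Lemma is_derive_elaB u : is_derive u 1 elaB (elak u ^+ 2).
Proof.
apply: is_derive_ext (isder_scale 4 (isder_sub (is_derive_eps u)
  (isder_scale (1 - q ^+ 2) (is_derive_id u 1)))) _ _ => //.
by rewrite dn_sqr /elak sn_cn; ring.
Qed.

Lemma cnK : cn (ellK q) q = 0. Proof. by rewrite /cn amK// cos_pihalf. Qed.
Lemma epsK : eps_ (ellK q) q = ellEc q. Proof. by rewrite /eps_ amK. Qed.
Lemma snN u : sn (- u) q = - sn u q. Proof. by rewrite /sn amN// sinN. Qed.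
Lemma cnN u : cn (- u) q = cn u q. Proof. by rewrite /cn amN// cosN. Qed.
Lemma dnN u : dn (- u) q = dn u q. Proof. by rewrite /dn amN// deltaN. Qed.
Lemma epsN u : eps_ (- u) q = - eps_ u q. Proof. by rewrite /eps_ amN// ellEN. Qed.
Lemma sn0 : sn 0 q = 0. Proof. by rewrite /sn am0// sin0. Qed.
Lemma eps0 : eps_ 0 q = 0. Proof. by rewrite /eps_ am0// ellE0. Qed.

Lemma cnD2K u : cn (u + 2 * ellK q) q = - cn u q.
Proof. by rewrite /cn amD2K// cosDpi. Qed.
Lemma epsD2K u : eps_ (u + 2 * ellK q) q = eps_ u q + 2 * ellEc q.
Proof. by rewrite /eps_ amD2K// ellEDpi. Qed.

Lemma am_lt u u' : u < u' -> am u q < am u' q.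
Proof.
move=> uu'; rewrite ltNge; apply/negP => h.
have := ellF_sub q01 h; rewrite !ellF_am//.
by move: h uu'; clear; lra.
Qed.

Lemma sn_gt0 u : 0 < u -> u <= ellK q -> 0 < sn u q.
Proof.
move=> u0 uK; rewrite /sn; apply: sin_gt0_pi; apply/andP; split.
  by rewrite -(am0 q01) am_lt.
have [->|uK'] := eqVneq u (ellK q).
  by rewrite amK//; have := pi_gt0 R; lra.
have : am u q < am (ellK q) q by apply: am_lt; rewrite lt_neqAle uK'.
by rewrite amK//; have := pi_gt0 R; lra.
Qed.

(** With [theta = 2 arcsin (q sn)] this is [2 theta' / sin theta], which has a pole where [sn]
    vanishes. [ricQ] is a closed form of the primitive of [ricdQ]; the singularity of [ricdQ] is
    removable, and [ricdQ'] is the expression that stays regular there. *)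
Definition ricW u := 2 * cn u q / (sn u q * dn u q).
Definition ricdW u := - (ricW u ^+ 2 * (2 * dn u q ^+ 2 - 1)) / 2 - 2.
Definition ricQ u := 8 * eps_ u q - (6 - 4 * q ^+ 2) * u - 4 * q ^+ 2 * (sn u q * cn u q / dn u q).
Definition ricdQ u := 2 - ricW u ^+ 2 * (1 - dn u q ^+ 2) ^+ 2.
Definition ricdQ' u := 2 - 4 * (cn u q ^+ 2 * (1 - dn u q ^+ 2) * q ^+ 2 / dn u q ^+ 2).

(* [ricW] solves the Riccati equation of the pendulum oscillation with amplitude [q]. *)
Lemma is_derive_ricW u : sn u q != 0 -> is_derive u 1 ricW (ricdW u).
Proof.
move=> s0; have d0 := dn_neq0 u; have sd0 : sn u q * dn u q != 0 by rewrite mulf_neq0.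
have dS := is_derive_sn u; have dC := is_derive_cn u; have dD := is_derive_dn u.
apply: is_derive_ext (isder_mul (isder_scale 2 dC) (@isder_inv _ (fun u => sn u q * dn u q) u _ sd0 (isder_mul dS dD))) _ _ => //.
rewrite /ricdW /ricW.
apply: (mulIf (expf_neq0 2 sd0)).
transitivity (2 * (- (sn u q ^+ 2 + cn u q ^+ 2) * dn u q ^+ 2 + cn u q ^+ 2 * (q ^+ 2 * sn u q ^+ 2))).
  by field; rewrite ?s0 ?d0.
transitivity (- 2 * cn u q ^+ 2 * (2 * dn u q ^+ 2 - 1) - 2 * sn u q ^+ 2 * dn u q ^+ 2).
  rewrite dn_sqr sn_cn; ring.
by field; rewrite ?s0 ?d0.
Qed.

Lemma is_derive_ricQ u : is_derive u 1 ricQ (ricdQ' u).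
Proof.
have d0 := dn_neq0 u.
have dS := is_derive_sn u; have dC := is_derive_cn u; have dD := is_derive_dn u.
have dE := is_derive_eps u.
have := isder_sub (isder_sub (isder_scale 8 dE) (isder_scale (6 - 4 * q ^+ 2) (is_derive_id u 1)))
   (isder_scale (4 * q ^+ 2) (isder_mul (isder_mul dS dC) (@isder_inv _ (fun u => dn u q) u _ d0 dD))).
move/is_derive_ext; apply=> //.
rewrite /ricdQ'; apply: (mulIf (expf_neq0 2 d0)).
transitivity (8 * dn u q ^+ 4 - (6 - 4 * q ^+ 2) * dn u q ^+ 2 - 4 * q ^+ 2 * dn u q ^+ 2 * (dn u q * dn u q) * (cn u q ^+ 2 - sn u q ^+ 2) / dn u q ^+ 2 * 1
   - 4 * q ^+ 2 * cn u q ^+ 2 * (q ^+ 2 * sn u q ^+ 2)); first by field.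
have E : q ^+ 2 * sn u q ^+ 2 = 1 - dn u q ^+ 2 by rewrite dn_sqr; ring.
have E' : q ^+ 2 * cn u q ^+ 2 = q ^+ 2 - (1 - dn u q ^+ 2) by rewrite dn_sqr sn_cn; ring.
transitivity (8 * dn u q ^+ 4 - (6 - 4 * q ^+ 2) * dn u q ^+ 2 - 4 * dn u q ^+ 2 * (q ^+ 2 * cn u q ^+ 2 - q ^+ 2 * sn u q ^+ 2)
   - 4 * (q ^+ 2 * cn u q ^+ 2) * (q ^+ 2 * sn u q ^+ 2)); first by field.
transitivity (2 * dn u q ^+ 2 - 4 * (q ^+ 2 * cn u q ^+ 2) * (1 - dn u q ^+ 2)); last by field.
by rewrite E E'; ring.
Qed.

Lemma ricdQE u : sn u q != 0 -> ricdQ' u = ricdQ u.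
Proof.
move=> s0; have d0 := dn_neq0 u; rewrite /ricdQ' /ricdQ /ricW.
have E : 1 - dn u q ^+ 2 = q ^+ 2 * sn u q ^+ 2 by rewrite dn_sqr; ring.
by rewrite E; field; rewrite ?s0 ?d0.
Qed.

Lemma ricdQ'_cts : continuous ricdQ'.
Proof.
have cd2 : continuous (fun u => dn u q ^+ 2) by apply: ctsM; exact: dn_cts.
apply: ctsD; first exact: cts_cst.
apply: ctsN; apply: ctsM; first exact: cts_cst.
apply: ctsM; last first.
  move=> z; apply: (@continuous_comp _ _ _ (fun u => dn u q ^+ 2) (fun z => z^-1)); first exact: cd2.
  by apply: inv_continuous; rewrite expf_neq0// dn_neq0.
apply: ctsM; last exact: cts_cst.
apply: ctsM; first by apply: ctsM; exact: cn_cts.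
by apply: ctsD; [exact: cts_cst|exact: ctsN].
Qed.

End modulus.

Lemma frame_affine (T1 T2 k : R -> R) (al be : R) : frame T1 T2 k ->
  frame (fun s => T1 (al * s + be)) (fun s => T2 (al * s + be)) (fun s => al * k (al * s + be)).
Proof.
move=> [d1 d2 n c].
have da s : is_derive s 1 (fun s => al * s + be) al.
  by apply: is_derive_ext (isder_add (isder_scale al (is_derive_id s 1)) (isder_cst be s)) _ _ => //; ring.
split=> //.
- by move=> s; apply: is_derive_ext (isder_comp (d1 _) (da s)) _ _ => //; ring.
- by move=> s; apply: is_derive_ext (isder_comp (d2 _) (da s)) _ _ => //; ring.
- apply: ctsM; first exact: cts_cst.
  move=> s; apply: (@continuous_comp _ _ _ (fun s => al * s + be) k); last exact: c.
  exact: derive_continuous (da s).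
Qed.

(** For the loop the model elastica has the negative horizontal span [2 E - K]; reversing the first
    coordinate makes the chord point to the right. *)
Lemma frame_reflect (T1 T2 k : R -> R) : frame T1 T2 k ->
  frame (fun s => - T1 s) T2 (fun s => - k s).
Proof.
move=> [d1 d2 n c]; split.
- move=> s; apply: is_derive_ext (isder_scale (-1) (d1 s)) _ _ => [z|]; ring.
- by move=> s; apply: is_derive_ext (d2 s) _ _ => //; ring.
- by move=> s; rewrite sqrrN.
- by move=> s; apply: continuousN; exact: c.
Qed.

Lemma frame_rotate (T1 T2 k : R -> R) (a b : R) : a ^+ 2 + b ^+ 2 = 1 -> frame T1 T2 k ->
  frame (fun s => a * T1 s - b * T2 s) (fun s => b * T1 s + a * T2 s) k.
Proof.
move=> ab [d1 d2 n c]; split=> //.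
- move=> s; apply: is_derive_ext (isder_sub (isder_scale a (d1 s)) (isder_scale b (d2 s))) _ _ => //; ring.
- move=> s; apply: is_derive_ext (isder_add (isder_scale b (d1 s)) (isder_scale a (d2 s))) _ _ => //; ring.
- move=> s; transitivity ((a ^+ 2 + b ^+ 2) * (T1 s ^+ 2 + T2 s ^+ 2)); first by ring.
  by rewrite ab n mul1r.
Qed.

Lemma is_derive_affine f df (al be s : R) : (forall u, is_derive u 1 f (df u)) ->
  is_derive s 1 (fun s => f (al * s + be)) (al * df (al * s + be)).
Proof.
move=> d; have da : is_derive s 1 (fun s => al * s + be) al.
  by apply: is_derive_ext (isder_add (isder_scale al (is_derive_id s 1)) (isder_cst be s)) _ _ => //; ring.
by apply: is_derive_ext (isder_comp (d _) da) _ _ => //; ring.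
Qed.

Section curves.
Variables (q l : R).
Hypothesis q01 : 0 <= q < 1.

Lemma is_derive_arc1 s : arc_alpha q l != 0 ->
  is_derive s 1 (fun s => (arc_curve q l s).1) (elaT1 q (arc_alpha q l * s + - ellK q)).
Proof.
move=> a0; set al := arc_alpha q l.
have := isder_add (isder_scale al^-1 (is_derive_affine al (- ellK q) s (is_derive_elaG1 q01)))
  (isder_cst (al^-1 * (2 * ellEc q - ellK q)) s).
move/is_derive_ext; apply; last by rewrite mulKf ?addr0.
by move=> z; rewrite /arc_curve /elaG1 /eps_ -/al/=; ring.
Qed.

Lemma is_derive_arc2 s : arc_alpha q l != 0 ->
  is_derive s 1 (fun s => (arc_curve q l s).2) (elaT2 q (arc_alpha q l * s + - ellK q)).
Proof.
move=> a0; set al := arc_alpha q l.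
have := isder_scale al^-1 (is_derive_affine al (- ellK q) s (is_derive_elaG2 q01)).
by move/is_derive_ext; apply; last by rewrite mulKf.
Qed.

Lemma is_derive_loop1 s : loop_alpha q l != 0 ->
  is_derive s 1 (fun s => (loop_curve q l s).1) (- elaT1 q (loop_alpha q l * s + - ellK q)).
Proof.
move=> a0; set al := loop_alpha q l.
have := isder_add (isder_scale (- al^-1) (is_derive_affine al (- ellK q) s (is_derive_elaG1 q01)))
  (isder_cst (- al^-1 * (2 * ellEc q - ellK q)) s).
move/is_derive_ext; apply; last by rewrite mulNr mulKf ?addr0.
by move=> z; rewrite /loop_curve /elaG1 /eps_ -/al/=; ring.
Qed.

Lemma is_derive_loop2 s : loop_alpha q l != 0 ->
  is_derive s 1 (fun s => (loop_curve q l s).2) (elaT2 q (loop_alpha q l * s + - ellK q)).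
Proof.
move=> a0; set al := loop_alpha q l.
have := isder_scale al^-1 (is_derive_affine al (- ellK q) s (is_derive_elaG2 q01)).
by move/is_derive_ext; apply; last by rewrite mulKf.
Qed.

End curves.

End Jacobi.

(** * Lower bound of the bending energy by calibration *)

Section Calibration.
Variable R : realType.
Local Notation mu := (@lebesgue_measure R).
Local Notation pt := (R * R)%type.
Implicit Types (f : R -> R) (a b s t u : R).

Let diff_regroup (o x1 x2 y1 y2 z1 z2 : R) :
  o * (x1 * x2 - y1 * y2 + (z1 - z2)) = o * (x1 * x2 + z1) - o * (y1 * y2 + z2).
Proof. by ring. Qed.

Let combine (o A Qd QK b1 b2 x1 x2 l : R) : o * (- Qd - - QK) <= b1 + A * x1 ->
  o * (QK - Qd) <= b2 + A * x2 -> A * (x1 + x2) <= A * l ->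
  2 * o * (QK - Qd) - A * l <= b1 + b2.
Proof.
have -> : o * (- Qd - - QK) = o * (QK - Qd) by ring.
by move=> H1 H2; rewrite (mulrDr A) => H3; lra.
Qed.

(** Serves to let the cut-off [d] around the pole of [ricW] tend to 0 in the lower bound. *)
Lemma cts_le_at0 f (c B : R) : continuous f -> 0 < c ->
  (forall d, 0 < d -> d < c -> f d <= B) -> f 0 <= B.
Proof.
move=> cf c0 H; rewrite leNgt; apply/negP => fB.
have e0 : 0 < f 0 - B by rewrite subr_gt0.
have /cvgrPdist_lt /(_ _ e0) := cf 0; rewrite near_simpl => -[d /= d0 Hd].
pose m := Num.min d c / 2.
have md : 0 < Num.min d c by rewrite lt_min d0.
have m0 : 0 < m by rewrite divr_gt0.
have m1 : m < Num.min d c by rewrite /m ltr_pdivrMr// ltr_pMr// ltr1n.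
move: m1; rewrite lt_min => /andP[m1 m2].
have := Hd m; rewrite /ball_/= sub0r normrN gtr0_norm// => /(_ m1).
have := H m m0 m2; rewrite ltr_norml => h1 /andP[_ h2].
by have := lt_le_trans h2 (lexx _); rewrite ltrD2l ltrN2 ltNge h1.
Qed.

Section lower_bound.
Variables (h h1 h2 : R -> pt) (q : R).
Hypothesis W : W22 h h1 h2.
Hypothesis N : forall t, 0 <= t <= 1 -> h1 t != (0, 0).
Hypothesis q01 : 0 <= q < 1.
Local Notation v := (speed h1).
Local Notation S := (arclen h1).
Local Notation dv := (dspeed h1 h2).

Definition chord (c1 c2 : R) t := (h1 t).1 * c1 + (h1 t).2 * c2.

Lemma AC_chord_defect (c1 c2 : R) :
  abscont 0 1 (fun t => 1 - chord c1 c2 t / v t)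
    (fun t => - (det h1 h2 t * ((h1 t).1 * c2 - (h1 t).2 * c1) / v t ^+ 3)).
Proof.
have Ax := W22_AC1 W; have Ay := W22_AC2 W; have Av := AC_speed W N.
have AV : abscont 0 1 (fun t => (v t)^-1) (fun t => - (v t ^+ 2)^-1 * dv t).
  apply: (AC_comp (phi := fun z => z^-1) (dphi := fun z => - (z ^+ 2)^-1) Av).
    move=> t t01; have v0 : v t != 0 by rewrite gt_eqF// (speed_gt0 N).
    have := @isder_inv _ id (v t) _ v0 (is_derive_id (v t) 1).
    by move/is_derive_ext; apply=> //; rewrite mulNr mul1r.
  have cV : {within `[0, 1], continuous (fun t => (v t ^+ 2)^-1)}.
    apply: within_cts_inv => [|t]; last first.
      by rewrite /= in_itv/= => t01; rewrite gt_eqF// exprn_gt0// (speed_gt0 N).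
    by apply: within_cts_mul; exact: speed_cts W N.
  rewrite (_ : (fun t => _) = (fun t => -1 * (v t ^+ 2)^-1)).
    by apply: within_cts_mul => //; exact: within_cts_cst.
  by apply/funext => t; rewrite mulN1r.
have A := AC_add (AC_cst 0 1 1) (AC_scale (-1) (AC_mul (AC_add (AC_scale c1 Ax) (AC_scale c2 Ay)) AV)).
apply: AC_ext A => t t01; first by rewrite /chord; ring.
have v0 : v t != 0 by rewrite gt_eqF// (speed_gt0 N).
have vE := speed_sqr h1 t.
apply: (mulIf (expf_neq0 3 v0)).
transitivity (- ((c1 * (h2 t).1 + c2 * (h2 t).2) * v t ^+ 2
   - (c1 * (h1 t).1 + c2 * (h1 t).2) * ((h1 t).1 * (h2 t).1 + (h1 t).2 * (h2 t).2))).
  by rewrite /dspeed; field.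
transitivity (- (det h1 h2 t * ((h1 t).1 * c2 - (h1 t).2 * c1))); last by field.
by rewrite vE /det; ring.
Qed.

(* The integrand exceeds the derivative of [om w(u) (1 - T.T0) + om Q(u)] by a sum of two squares. *)
Lemma calibration_itv (om be a b c1 c2 : R) : c1 ^+ 2 + c2 ^+ 2 = 1 ->
  0 <= a -> a <= b -> b <= 1 ->
  (forall t, a <= t <= b -> sn (om * S t + be) q != 0) ->
  om * (ricW q (om * S b + be) * (1 - chord c1 c2 b / v b)
        - ricW q (om * S a + be) * (1 - chord c1 c2 a / v a)
        + (ricQ q (om * S b + be) - ricQ q (om * S a + be)))
  <= \int[mu]_(t in `[a, b]) (det h1 h2 t ^+ 2 / v t ^+ 5)
     + 2 * om ^+ 2 * \int[mu]_(t in `[a, b]) chord c1 c2 t.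
Proof.
move=> c12 a0 ab b1 sn0.
pose u t := om * S t + be.
have in01 t : a <= t <= b -> 0 <= t <= 1.
  by move=> /andP[at_ tb]; rewrite (le_trans a0 at_) (le_trans tb b1).
have Au : abscont a b u (fun t => om * v t).
  have := AC_restrict a0 b1 (AC_add (AC_scale om (AC_arclen W N)) (AC_cst 0 1 be)).
  by apply: AC_ext => // t _; rewrite addr0.
have cu := AC_cts Au.
have csn : {within `[a, b], continuous (fun t => sn (u t) q)}.
  by apply: (within_cts_comp (g := fun z => sn z q)) cu _ => t _; exact: sn_cts.
have ccn : {within `[a, b], continuous (fun t => cn (u t) q)}.
  by apply: (within_cts_comp (g := fun z => cn z q)) cu _ => t _; exact: cn_cts.
have cdn : {within `[a, b], continuous (fun t => dn (u t) q)}.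
  by apply: (within_cts_comp (g := fun z => dn z q)) cu _ => t _; exact: dn_cts.
have cW : {within `[a, b], continuous (fun t => ricW q (u t))}.
  apply: within_cts_mul; first by apply: within_cts_mul => //; exact: within_cts_cst.
  apply: within_cts_inv; first exact: within_cts_mul.
  move=> t; rewrite /= in_itv/= => tab; rewrite mulf_neq0 ?dn_neq0//; exact: sn0.
have cdW : {within `[a, b], continuous (fun t => ricdW q (u t))}.
  have cm1 : {within `[a, b], continuous (fun=> -1 : R)} by exact: within_cts_cst.
  have := within_cts_add (within_cts_mul (within_cts_mul cm1 (within_cts_mul cW cW))
    (within_cts_add (within_cts_mul cdn cdn) (within_cts_cst (r := - 1 / 2) (A := `[a, b]))))
    (within_cts_cst (r := -2) (A := `[a, b])).
  by rewrite (_ : (fun t => _) = (fun t => ricdW q (u t)))//; apply/funext => t; rewrite /ricdW; field.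
have AW : abscont a b (fun t => ricW q (u t)) (fun t => ricdW q (u t) * (om * v t)).
  apply: (AC_comp (phi := ricW q) (dphi := ricdW q) Au) => // t tab.
  by apply: is_derive_ricW => //; exact: sn0.
have AQ : abscont a b (fun t => ricQ q (u t)) (fun t => ricdQ' q (u t) * (om * v t)).
  apply: (AC_comp (phi := ricQ q) (dphi := ricdQ' q) Au) => [t _|]; first exact: is_derive_ricQ.
  by apply: (within_cts_comp (g := ricdQ' q)) cu _ => t _; exact: ricdQ'_cts.
have Az := AC_restrict a0 b1 (AC_chord_defect c1 c2).
have A := AC_scale om (AC_add (AC_mul AW Az) AQ).
rewrite -/(u a) -/(u b).
rewrite diff_regroup (A.2 a b)//.
have ib := integrable_sub_itv a0 b1 (bend_integrable W N).
have ic : mu.-integrable `[a, b] (EFin \o chord c1 c2).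
  apply: (integrable_sub_itv a0 b1); apply: within_cts_integrable.
  apply: within_cts_add; apply: within_cts_mul; try exact: within_cts_cst.
    exact: AC_cts (W22_AC1 W).
  exact: AC_cts (W22_AC2 W).
rewrite -[X in X + _]mul1r -Rintegral_lin//.
apply: le_Rintegral_itv; [exact: A.1|exact: integrable_lin|].
move=> t tab; have t01 := in01 t tab; have s0 := sn0 t tab.
have v0 := speed_gt0 N t01; have vn : v t != 0 by rewrite gt_eqF.
rewrite ricdQE//.
set w := ricW q (u t); set d := dn (u t) q.
pose C := chord c1 c2 t / v t; pose n := ((h1 t).1 * c2 - (h1 t).2 * c1) / v t.
pose kap := det h1 h2 t / v t ^+ 3.
have Cn : C ^+ 2 + n ^+ 2 = 1.
  apply: (mulIf (expf_neq0 2 vn)); rewrite mul1r speed_sqr.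
  transitivity (chord c1 c2 t ^+ 2 + ((h1 t).1 * c2 - (h1 t).2 * c1) ^+ 2).
    by rewrite /C /n -speed_sqr; field.
  transitivity (((h1 t).1 ^+ 2 + (h1 t).2 ^+ 2) * (c1 ^+ 2 + c2 ^+ 2)); first by rewrite /chord; ring.
  by rewrite c12 mulr1.
have -> : 1 * (det h1 h2 t ^+ 2 / v t ^+ 5) + 2 * om ^+ 2 * chord c1 c2 t = v t * (kap ^+ 2 + 2 * om ^+ 2 * C).
  by rewrite /kap /C; field.
have -> : om * (w * - (det h1 h2 t * ((h1 t).1 * c2 - (h1 t).2 * c1) / v t ^+ 3)
     + ricdW q (u t) * (om * v t) * (1 - chord c1 c2 t / v t) + ricdQ q (u t) * (om * v t))
   = v t * (- om * w * kap * n + om ^+ 2 * (ricdW q (u t) * (1 - C) + ricdQ q (u t))).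
  by rewrite /kap /C /n; field.
apply: ler_wpM2l; first exact: ltW.
rewrite /ricdW /ricdQ -/w -/d -subr_ge0.
(* With [phi] the angle from the fixed direction to the tangent, [C = cos phi] and [n = - sin phi].
   The first square vanishes when [phi' = om w sin phi / 2], the second when
   [sin^2 (phi / 2) = q^2 sn^2]. Both hold along the elastica itself, so nothing is lost there. *)
have -> : kap ^+ 2 + 2 * om ^+ 2 * C - (- om * w * kap * n +
    om ^+ 2 * ((- (w ^+ 2 * (2 * d ^+ 2 - 1)) / 2 - 2) * (1 - C) + (2 - w ^+ 2 * (1 - d ^+ 2) ^+ 2)))
  = (kap + om * w * n / 2) ^+ 2 + om ^+ 2 * w ^+ 2 * (((1 - C) / 2 - (1 - d ^+ 2)) ^+ 2
      + (1 - (C ^+ 2 + n ^+ 2)) / 4).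
  by field.
by rewrite Cn subrr mul0r addr0 addr_ge0 ?sqr_ge0// mulr_ge0 ?sqr_ge0// mulr_ge0 ?sqr_ge0.
Qed.

Lemma chord_integral (c1 c2 : R) : \int[mu]_(t in `[0, 1]) chord c1 c2 t =
  c1 * ((h 1).1 - (h 0).1) + c2 * ((h 1).2 - (h 0).2).
Proof.
have A := AC_add (AC_scale c1 (W22_AC01 W)) (AC_scale c2 (W22_AC02 W)).
transitivity (\int[mu]_(t in `[0, 1]) (c1 * (h1 t).1 + c2 * (h1 t).2)).
  by apply: eq_Rintegral_itv => t _; rewrite /chord mulrC [_ * c2]mulrC.
by rewrite -(A.2 0 1)//; ring.
Qed.

(** The phase runs from [- K] to [- d] on the first half and from [d] to [K] on the second, jumping
    over the pole of [ricW]. No boundary term with [ricW] survives: [cn] vanishes at both extreme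
    phases, and in the middle the tangent equals the direction [(c1, c2)], so its defect is 0. *)
Lemma bend_lower_bound_pos (l d : R) : 0 <= l -> h 0 = (0, 0) -> h 1 = (l, 0) -> 0 < q ->
  0 < d -> d < ellK q ->
  4 * (ellK q - d) / S 1 * (ricQ q (ellK q) - ricQ q d)
    - 8 * (ellK q - d) ^+ 2 * l / S 1 ^+ 2 <= bend h1 h2.
Proof.
move=> l0 h00 h1l q0 d0 dK; set K := ellK q; set L := S 1.
have L0 : 0 < L by exact: (arclen_gt0 W N).
have Ln : L != 0 by rewrite gt_eqF.
have [t0 t01 St0] : exists2 t0, 0 <= t0 <= 1 & S t0 = L / 2.
  have [] := @IVT R S 0 1 (L / 2) ler01 (AC_cts (AC_arclen W N)).
    by rewrite arclen0 -/L minElt maxElt L0; apply/andP; split; lra.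
  by move=> c; rewrite in_itv/= => c01 <-; exists c.
have v0 := speed_gt0 N t01; have vn : v t0 != 0 by rewrite gt_eqF.
have vE := speed_sqr h1 t0.
pose c1 := (h1 t0).1 / v t0; pose c2 := (h1 t0).2 / v t0.
have c12 : c1 ^+ 2 + c2 ^+ 2 = 1.
  by rewrite /c1 /c2 !expr_div_n -mulrDl -vE divff// expf_neq0.
have z0 : 1 - chord c1 c2 t0 / v t0 = 0.
  apply/eqP; rewrite subr_eq0; apply/eqP/(mulIf (expf_neq0 2 vn)); rewrite mul1r.
  by rewrite /chord /c1 /c2 [LHS]vE; field.
have c1le : c1 <= 1.
  apply: le_trans (ler_norm _) _; rewrite -(@ler_pXn2r _ 2)// ?nnegrE//.
  by rewrite expr1n real_normK ?num_real// -c12 lerDl sqr_ge0.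
(* The rate at which a phase of total extent [2 (K - d)] is swept along the length [L]. *)
pose om := 2 * (K - d) / L.
have om0 : 0 < om by rewrite /om divr_gt0// mulr_gt0// subr_gt0.
have omL : om * L = 2 * (K - d) by rewrite /om; field.
have /andP[t00 t0l] := t01.
have Smon t t' : 0 <= t -> t <= t' -> t' <= 1 -> om * S t <= om * S t'.
  by move=> ? ? ?; rewrite ler_wpM2l ?(ltW om0)// (arclen_le W N).
have WK : ricW q K = 0 by rewrite /ricW /K cnK// mulr0 mul0r.
have WKN : ricW q (- K) = 0 by rewrite /ricW cnN// /K cnK// mulr0 mul0r.
have QN u : ricQ q (- u) = - ricQ q u.
  by rewrite /ricQ snN// cnN// dnN// epsN//; ring.
have right := @calibration_itv om (d - om * L / 2) t0 1 c1 c2 c12 t00 t0l (lexx 1).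
have left := @calibration_itv om (- d - om * L / 2) 0 t0 c1 c2 c12 (lexx 0) t00 t0l.
have eR1 : om * S 1 + (d - om * L / 2) = K by rewrite -/L omL; field.
have eR0 : om * S t0 + (d - om * L / 2) = d by rewrite St0; field.
have eL0 : om * S 0 + (- d - om * L / 2) = - K by rewrite arclen0 omL; field.
have eL1 : om * S t0 + (- d - om * L / 2) = - d by rewrite St0; field.
have snR t : t0 <= t <= 1 -> sn (om * S t + (d - om * L / 2)) q != 0.
  move=> /andP[h_ h_']; rewrite gt_eqF//; apply: sn_gt0 => //.
    by apply: lt_le_trans d0 _; rewrite -{1}eR0 lerD2r Smon.
  by rewrite -/K -[leRHS]eR1 lerD2r Smon// (le_trans t00).
have snL t : 0 <= t <= t0 -> sn (om * S t + (- d - om * L / 2)) q != 0.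
  move=> /andP[h_ h_']; rewrite -[X in sn X]opprK snN// oppr_eq0 gt_eqF//; apply: sn_gt0 => //.
    by rewrite oppr_gt0; apply: le_lt_trans (_ : - d < 0); [rewrite -[leRHS]eL1 lerD2r Smon|rewrite oppr_lt0].
  by rewrite -/K lerNl -[leLHS]eL0 lerD2r Smon// (le_trans h_').
have := right snR; have := left snL.
rewrite eR1 eR0 eL0 eL1 WK WKN z0 !mulr0 !mul0r !subr0 !add0r !QN.
set b1 := \int[mu]_(t in `[0, t0]) _; set b2 := \int[mu]_(t in `[t0, 1]) _.
set x1 := \int[mu]_(t in `[0, t0]) _; set x2 := \int[mu]_(t in `[t0, 1]) _ => HL HR.
have bE : bend h1 h2 = b1 + b2.
  by apply: Rintegral_itv_split => //; exact: (bend_integrable W N).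
have xE : x1 + x2 = c1 * l.
  have := chord_integral c1 c2; rewrite h00 h1l/= !subr0 mulr0 addr0 => <-.
  apply/esym; apply: Rintegral_itv_split => //.
  apply: within_cts_integrable.
  apply: within_cts_add; apply: within_cts_mul; try exact: within_cts_cst.
    exact: AC_cts (W22_AC1 W).
  exact: AC_cts (W22_AC2 W).
have xl : 2 * om ^+ 2 * (x1 + x2) <= 2 * om ^+ 2 * l.
  rewrite xE; apply: ler_wpM2l; last by rewrite ler_piMl.
  by apply: mulr_ge0 => //; exact: sqr_ge0.
have -> : 4 * (K - d) / L * (ricQ q K - ricQ q d) - 8 * (K - d) ^+ 2 * l / L ^+ 2
   = 2 * om * (ricQ q K - ricQ q d) - 2 * om ^+ 2 * l by rewrite /om; field.
by rewrite bE; exact: combine HL HR xl.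
Qed.

(** In the limit [d = 0] the rate is [2 K / L]; inserting [ricQ K] and [l = C L] collapses the bound
    to exactly [D / L], the bending energy of the arc with the same length and chord. *)
Lemma bend_lower_bound (l : R) : 0 <= l -> h 0 = (0, 0) -> h 1 = (l, 0) -> 0 < q ->
  arcC q * S 1 = l -> arcD q / S 1 <= bend h1 h2.
Proof.
move=> l0 h00 h1l q0 Cl.
have L0 : 0 < S 1 by exact: (arclen_gt0 W N).
have K0 := ellK_gt0 q01.
pose f d := 4 * (ellK q - d) / S 1 * (ricQ q (ellK q) - ricQ q d)
    - 8 * (ellK q - d) ^+ 2 * l / S 1 ^+ 2.
have cQ : continuous (ricQ q).
  by move=> u; exact: derive_continuous (is_derive_ricQ q01 u).
have cl : continuous (fun d => ellK q - d).
  by apply: ctsD; [exact: cts_cst|apply: ctsN => x; exact: cvg_id].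
have cf : continuous f.
  apply: ctsD; first apply: ctsM.
  - by apply: ctsM; [apply: ctsM => //; exact: cts_cst|exact: cts_cst].
  - by apply: ctsD; [exact: cts_cst|exact: ctsN].
  - apply: ctsN; apply: ctsM; last exact: cts_cst.
    apply: ctsM; last exact: cts_cst.
    by apply: ctsM; [exact: cts_cst|exact: ctsM].
have := cts_le_at0 cf K0 (fun d d0 dK => bend_lower_bound_pos l0 h00 h1l q0 d0 dK).
apply: le_trans; rewrite /f /ricQ sn0// cnK// eps0// epsK// !mulr0 !mul0r !subr0 -Cl /arcD.
rewrite le_eqVlt; apply/orP; left; apply/eqP; rewrite /arcC.
by field; rewrite !gt_eqF.
Qed.

End lower_bound.

End Calibration.

(** * Instability of arcs *)

Section Continuity.
Variable R : realType.
Local Notation mu := (@lebesgue_measure R).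
Local Notation pt := (R * R)%type.
Implicit Types (f : R -> R) (a b s t u : R).

Lemma derive_lipschitz (f df : R -> R) (M : R) : (forall x : R, is_derive x 1 f (df x)) ->
  (forall x, `|df x| <= M) -> forall x y, `|f y - f x| <= M * `|y - x|.
Proof.
move=> d b x y; wlog xy : x y / x <= y.
  by move=> H; have [/H//|/ltW/H] := leP x y; rewrite distrC [`|x - y|]distrC.
have [c _ ->] := @MVT_segment _ f df x y xy (fun z _ => d z)
  (continuous_subspaceT (fun z => derive_continuous (d z))).
by rewrite normrM ler_wpM2r.
Qed.

Section modulus.
Variable q : R.
Hypothesis q01 : 0 <= q < 1.

Lemma norm_sn_le1 u : `|sn u q| <= 1. Proof. exact: sin_max. Qed.
Lemma norm_cn_le1 u : `|cn u q| <= 1. Proof. exact: cos_max. Qed.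
Lemma norm_dn_le1 u : `|dn u q| <= 1.
Proof. by rewrite gtr0_norm ?dn_gt0// delta_le1. Qed.

Lemma norm_mul_le1 (x y : R) : `|x| <= 1 -> `|y| <= 1 -> `|x * y| <= 1.
Proof. by move=> h1 h2; rewrite normrM mulr_ile1. Qed.

Let nq : `|q| <= 1.
Proof. by move: q01 => /andP[q0 q1]; rewrite ger0_norm// ltW. Qed.

Lemma norm_elaT1 u : `|elaT1 q u| <= 1.
Proof.
have [_ _ n _] := ela_frame q01; have := n u => E.
rewrite -(@ler_pXn2r _ 2)// ?nnegrE// expr1n real_normK ?num_real// -E lerDl.
exact: sqr_ge0.
Qed.

Lemma norm_elaT2 u : `|elaT2 q u| <= 1.
Proof.
have [_ _ n _] := ela_frame q01; have := n u => E.
rewrite -(@ler_pXn2r _ 2)// ?nnegrE// expr1n real_normK ?num_real// -E lerDr.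
exact: sqr_ge0.
Qed.

Lemma norm_elak u : `|elak q u| <= 2.
Proof.
rewrite /elak normrN -mulrA normrM ger0_norm// -[leRHS]mulr1 ler_wpM2l//.
by apply: norm_mul_le1 => //; exact: norm_cn_le1.
Qed.

Lemma is_derive_elak u : is_derive u 1 (elak q) (2 * q * (sn u q * dn u q)).
Proof.
apply: is_derive_ext (isder_scale (- (2 * q)) (is_derive_cn q01 u)) _ _.
  by move=> z; rewrite /elak; ring.
by ring.
Qed.

Lemma norm_delak u : `|2 * q * (sn u q * dn u q)| <= 2.
Proof.
rewrite -mulrA normrM ger0_norm// -[leRHS]mulr1 ler_wpM2l//.
apply: norm_mul_le1 => //; apply: norm_mul_le1; [exact: norm_sn_le1|exact: norm_dn_le1].
Qed.

Lemma norm_mul_le (x y X Y : R) : `|x| <= X -> `|y| <= Y -> `|x * y| <= X * Y.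
Proof. by move=> h1 h2; rewrite normrM ler_pM. Qed.

(** The constant 6 is dictated by the products [k T], whose derivative is at most [2 + 2 * 2]; one
    constant serves all four functions. *)
Lemma elaT1_lip u u' : `|elaT1 q u' - elaT1 q u| <= 6 * `|u' - u|.
Proof.
have [d1 d2 n c] := ela_frame q01.
apply: (derive_lipschitz d1) => x.
apply: le_trans (norm_mul_le (_ : _ <= 2) (norm_elaT2 x)) _; first by rewrite normrN norm_elak.
by lra.
Qed.

Lemma elaT2_lip u u' : `|elaT2 q u' - elaT2 q u| <= 6 * `|u' - u|.
Proof.
have [d1 d2 n c] := ela_frame q01.
apply: (derive_lipschitz d2) => x.
by apply: le_trans (norm_mul_le (norm_elak x) (norm_elaT1 x)) _; lra.
Qed.

Lemma elakT1_lip u u' : `|elak q u' * elaT1 q u' - elak q u * elaT1 q u| <= 6 * `|u' - u|.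
Proof.
have [d1 d2 n c] := ela_frame q01.
apply: (derive_lipschitz (f := fun u => elak q u * elaT1 q u)
  (fun x => isder_mul (is_derive_elak x) (d1 x))) => x.
apply: le_trans (ler_normD _ _) _.
have h1 := norm_mul_le (norm_delak x) (norm_elaT1 x).
have h2 := norm_mul_le (norm_elak x) (norm_mul_le (norm_elak x) (norm_elaT2 x)).
rewrite (_ : elak q x * (- elak q x * elaT2 q x) = - (elak q x * (elak q x * elaT2 q x))); last by ring.
by rewrite normrN; move: h1 h2; clear; lra.
Qed.

Lemma elakT2_lip u u' : `|elak q u' * elaT2 q u' - elak q u * elaT2 q u| <= 6 * `|u' - u|.
Proof.
have [d1 d2 n c] := ela_frame q01.
apply: (derive_lipschitz (f := fun u => elak q u * elaT2 q u)
  (fun x => isder_mul (is_derive_elak x) (d2 x))) => x.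
apply: le_trans (ler_normD _ _) _.
have h1 := norm_mul_le (norm_delak x) (norm_elaT2 x).
have h2 := norm_mul_le (norm_elak x) (norm_mul_le (norm_elak x) (norm_elaT1 x)).
by move: h1 h2; lra.
Qed.

Lemma norm_am_le u : `|am u q| <= `|u|.
Proof.
have [h|h] := leP 0 (am u q).
  have := ellF_sub q01 h; rewrite ellF0 ellF_am// !subr0 => hu.
  by rewrite !ger0_norm// (le_trans h).
have := ellF_sub q01 (ltW h); rewrite ellF0 ellF_am// !sub0r => hu.
rewrite ltr0_norm// ler0_norm//; by move: h hu; lra.
Qed.

End modulus.

Lemma deltaV_lip (r q q' t : R) : 0 <= q <= r -> 0 <= q' <= r -> r < 1 ->
  `|(delta q' t)^-1 - (delta q t)^-1| <= (Num.sqrt (1 - r ^+ 2) ^+ 3)^-1 * `|q' - q|.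
Proof.
wlog qq : q q' / q <= q'.
  move=> H h h' r1; have [qq|/ltW qq] := leP q q'; first exact: H.
  by rewrite distrC [`|q' - q|]distrC; exact: H.
move=> /andP[q0 qr] /andP[q'0 q'r] r1.
have m0 : 0 < Num.sqrt (1 - r ^+ 2).
  by rewrite sqrtr_gt0 subr_gt0 expr_lt1// (le_trans q0).
have in01 z : q <= z <= q' -> 0 <= z < 1.
  by move=> /andP[qz zq]; rewrite (le_trans q0 qz) (le_lt_trans zq) // (le_lt_trans q'r).
have [c cq ->] : exists2 c, c \in `[q, q'] & (delta q' t)^-1 - (delta q t)^-1 =
    c * sin t ^+ 2 / delta c t ^+ 3 * (q' - q).
  apply: (@MVT_segment _ (fun z => (delta z t)^-1) (fun z => z * sin t ^+ 2 / delta z t ^+ 3)) => //.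
    move=> z; rewrite in_itv/= => /andP[z1 z2]; apply: is_derive_deltaV_modulus.
    by apply: in01; rewrite !ltW.
  apply: derivable_within_continuous => z; rewrite in_itv/= => zq.
  by have [] := is_derive_deltaV_modulus t (in01 z zq).
rewrite normrM ler_wpM2r//.
have cq' : q <= c <= q' by move: cq; rewrite in_itv.
have c01 := in01 c cq'; move: cq' => /andP[qc cq''].
have /andP[c0 c1] := c01.
have d0 : Num.sqrt (1 - r ^+ 2) <= delta c t.
  by apply: delta_ge => //; rewrite c0 (le_trans cq'').
have dp : 0 < delta c t by exact: lt_le_trans d0.
rewrite normrM normfV normrX (ger0_norm (ltW dp)) -[leRHS]mul1r.
have s0 := sqr_ge0 (sin t).
have s1 : sin t ^+ 2 <= 1 by rewrite sin2cos2 gerBl sqr_ge0.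
apply: ler_pM => //; first by rewrite invr_ge0 exprn_ge0// ltW.
  rewrite ger0_norm; last by rewrite mulr_ge0.
  by apply: mulr_ile1 => //; exact: ltW.
by rewrite lef_pV2 ?posrE ?exprn_gt0// ler_pXn2r// nnegrE ltW.
Qed.

(** [ellF] of modulus [q'] expands distances. At the two amplitudes it takes the values [u] and
    [ellF (am u q) q'], and [u] is also [ellF (am u q) q]; what remains is the dependence of the
    integrand on the modulus. *)
Lemma am_lip (r q q' u : R) : 0 <= q <= r -> 0 <= q' <= r -> r < 1 ->
  `|am u q' - am u q| <= (Num.sqrt (1 - r ^+ 2) ^+ 3)^-1 * `|q' - q| * `|u|.
Proof.
move=> qr qr' r1; set c := (_ ^+ 3)^-1.
have q01 : 0 <= q < 1 by move: qr => /andP[-> h] /=; exact: le_lt_trans h r1.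
have q01' : 0 <= q' < 1 by move: qr' => /andP[-> h] /=; exact: le_lt_trans h r1.
have step1 : `|am u q' - am u q| <= `|ellF (am u q') q' - ellF (am u q) q'|.
  have [h|/ltW h] := leP (am u q) (am u q').
    have := ellF_sub q01' h => hh; rewrite ger0_norm ?subr_ge0//.
    exact: le_trans hh (ler_norm _).
  have := ellF_sub q01' h => hh; rewrite distrC ger0_norm ?subr_ge0// distrC.
  exact: le_trans hh (ler_norm _).
apply: le_trans step1 _; rewrite ellF_am// -{1}(ellF_am u q01).
have d (x : R) : is_derive x 1 (fun x => ellF x q - ellF x q') ((delta q x)^-1 - (delta q' x)^-1).
  exact: isder_sub (is_derive_ellF x q01) (is_derive_ellF x q01').
have := derive_lipschitz d (fun x => deltaV_lip x qr' qr r1) 0 (am u q).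
rewrite !ellF0 subrr !subr0 => /le_trans; apply.
rewrite -/c [`|q - q'|]distrC ler_wpM2l// ?norm_am_le//.
by rewrite mulr_ge0// invr_ge0 exprn_ge0// sqrtr_ge0.
Qed.

Lemma norm_sqrt_sub (x y : R) : 0 <= x -> 0 <= y -> `|Num.sqrt x - Num.sqrt y| <= Num.sqrt `|x - y|.
Proof.
wlog xy : x y / x <= y.
  move=> H x0 y0; have [xy|/ltW xy] := leP x y; first exact: H.
  by rewrite distrC [`|x - y|]distrC; exact: H.
move=> x0 y0; rewrite distrC [`|x - y|]distrC.
have sxy := ler_wsqrtr xy.
rewrite ger0_norm ?subr_ge0// [`|y - x|]ger0_norm ?subr_ge0// lerBlDr.
rewrite -(@ler_pXn2r _ 2)// ?nnegrE ?sqrtr_ge0 ?addr_ge0 ?sqrtr_ge0//.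
rewrite sqrrD !sqr_sqrtr// ?subr_ge0//.
have := mulr_ge0 (sqrtr_ge0 (y - x)) (sqrtr_ge0 x).
by set z := _ * _ => z0; lra.
Qed.

(* A modulus of continuity of the frame of the elastica as a function of the parameter [q]. *)
Definition moc (eta : R) : R := 10 * eta + 8 * Num.sqrt (2 * eta).

(** [P], [c] and [d] stand for [q sn], [q cn] and [dn]. The product [k T1] needs [10 eta] and [k T2]
    needs [6 eta + 4 s]; a single expression covers all four differences. *)
Lemma frame_components_close (P P' c c' d d' eta s : R) :
  `|P| <= 1 -> `|P'| <= 1 -> `|c| <= 1 -> `|c'| <= 1 -> `|d| <= 1 -> `|d'| <= 1 ->
  `|P - P'| <= eta -> `|c - c'| <= eta -> `|d - d'| <= s -> `|d ^+ 2 - d' ^+ 2| <= 2 * eta ->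
  let T1 := 2 * d ^+ 2 - 1 in let T1' := 2 * d' ^+ 2 - 1 in
  let T2 := - (2 * P * d) in let T2' := - (2 * P' * d') in
  let k := - (2 * c) in let k' := - (2 * c') in
  `|T1| <= 1 -> `|T2| <= 1 ->
  [/\ `|T1 - T1'| <= 10 * eta + 8 * s, `|T2 - T2'| <= 10 * eta + 8 * s,
      `|k * T2 - k' * T2'| <= 10 * eta + 8 * s & `|k * T1 - k' * T1'| <= 10 * eta + 8 * s].
Proof.
move=> bP bP' bc bc' bd bd' hP hc hd hd2 /=.
have eta0 : 0 <= eta by exact: le_trans (normr_ge0 _) hP.
have s0 : 0 <= s by exact: le_trans (normr_ge0 _) hd.
set T1 := 2 * d ^+ 2 - 1; set T1' := 2 * d' ^+ 2 - 1.
set T2 := - (2 * P * d); set T2' := - (2 * P' * d') => bT1 bT2.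
have hT1 : `|T1 - T1'| <= 4 * eta.
  rewrite (_ : T1 - T1' = 2 * (d ^+ 2 - d' ^+ 2)); last by rewrite /T1 /T1'; ring.
  by rewrite normrM ger0_norm//; move: hd2; clear; lra.
have hT2 : `|T2 - T2'| <= 2 * eta + 2 * s.
  rewrite (_ : T2 - T2' = 2 * ((P' - P) * d' + P * (d' - d))); last by rewrite /T2 /T2'; ring.
  rewrite normrM ger0_norm//.
  suff : `|(P' - P) * d' + P * (d' - d)| <= eta + s by clear; lra.
  apply: le_trans (ler_normD _ _) _; apply: lerD.
    by rewrite -[leRHS]mulr1; apply: norm_mul_le => //; rewrite distrC.
  by rewrite -[leRHS]mul1r; apply: norm_mul_le => //; rewrite distrC.
have prod (A A' X : R) : `|A| <= 1 -> `|A - A'| <= X ->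
    `|- (2 * c) * A - - (2 * c') * A'| <= 2 * eta + 2 * X.
  move=> hA hX.
  rewrite (_ : _ - _ = 2 * ((c' - c) * A + c' * (A' - A))); last by ring.
  rewrite normrM ger0_norm//.
  suff : `|(c' - c) * A + c' * (A' - A)| <= eta + X by clear; lra.
  apply: le_trans (ler_normD _ _) _; apply: lerD.
    by rewrite -[leRHS]mulr1; apply: norm_mul_le => //; rewrite distrC.
  by rewrite -[leRHS]mul1r; apply: norm_mul_le => //; rewrite distrC.
have p1 := prod _ _ _ bT2 hT2; have p2 := prod _ _ _ bT1 hT1.
split.
- by apply: le_trans hT1 _; move: eta0 s0; clear; lra.
- by apply: le_trans hT2 _; move: eta0 s0; clear; lra.
- by apply: le_trans p1 _; move: eta0 s0; clear; lra.
- by apply: le_trans p2 _; move: eta0 s0; clear; lra.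
Qed.

Lemma lip_prod_close (q q' x y eta : R) (f : R -> R) :
  (forall x y, `|f y - f x| <= 1 * `|y - x|) -> (forall x, `|f x| <= 1) ->
  `|q'| <= 1 -> `|q' - q| + `|y - x| <= eta -> `|q * f x - q' * f y| <= eta.
Proof.
move=> lf bf q1' H; apply: le_trans H.
rewrite (_ : _ - _ = (q - q') * f x + q' * (f x - f y)); last by ring.
apply: le_trans (ler_normD _ _) _; apply: lerD.
  by rewrite normrM distrC ler_piMr.
rewrite normrM -[leRHS]mul1r; apply: ler_pM => //.
by rewrite -[leRHS]mul1r distrC; exact: lf.
Qed.

Lemma sin_lip (x y : R) : `|sin y - sin x| <= 1 * `|y - x|.
Proof. by apply: (derive_lipschitz (@is_derive_sin R)) => z; exact: cos_max. Qed.

Lemma cos_lip (x y : R) : `|cos y - cos x| <= 1 * `|y - x|.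
Proof. by apply: (derive_lipschitz (@is_derive_cos R)) => z; rewrite normrN sin_max. Qed.

(** Estimating [dn] through its square avoids a lower bound for [dn]; the price is the square root
    in [moc]. *)
Lemma sub_sqr_sqrt (d d' : R) : 0 < d -> 0 < d' -> `|d - d'| <= Num.sqrt `|d ^+ 2 - d' ^+ 2|.
Proof.
move=> d0 d0'; have := norm_sqrt_sub (sqr_ge0 d) (sqr_ge0 d').
by rewrite !sqrtr_sqr (gtr0_norm d0) (gtr0_norm d0').
Qed.

Lemma sub_sqr_le (q q' s s' D D' eta : R) :
  D = 1 - q ^+ 2 * s ^+ 2 -> D' = 1 - q' ^+ 2 * s' ^+ 2 ->
  `|q * s| <= 1 -> `|q' * s'| <= 1 -> `|q * s - q' * s'| <= eta -> `|D - D'| <= 2 * eta.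
Proof.
move=> -> -> b b' h; rewrite (_ : _ - _ = (q' * s' + q * s) * (q' * s' - q * s)); last by ring.
apply: norm_mul_le; last by rewrite distrC.
by apply: le_trans (ler_normD _ _) _; move: b b'; clear; lra.
Qed.

Lemma ela_modulus (q q' u eta : R) : 0 <= q < 1 -> 0 <= q' < 1 ->
  `|q' - q| + `|am u q' - am u q| <= eta ->
  [/\ `|elaT1 q u - elaT1 q' u| <= moc eta, `|elaT2 q u - elaT2 q' u| <= moc eta,
      `|elak q u * elaT2 q u - elak q' u * elaT2 q' u| <= moc eta &
      `|elak q u * elaT1 q u - elak q' u * elaT1 q' u| <= moc eta].
Proof.
move=> q01 q01' H.
have nq : `|q| <= 1 by move: q01 => /andP[? ?]; rewrite ger0_norm// ltW.
have nq' : `|q'| <= 1 by move: q01' => /andP[? ?]; rewrite ger0_norm// ltW.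
have hP : `|q * sn u q - q' * sn u q'| <= eta.
  exact: lip_prod_close sin_lip (@sin_max R) nq' H.
have hc : `|q * cn u q - q' * cn u q'| <= eta.
  exact: lip_prod_close cos_lip (@cos_max R) nq' H.
have bP := norm_mul_le1 nq (norm_sn_le1 q u).
have bP' := norm_mul_le1 nq' (norm_sn_le1 q' u).
have bc := norm_mul_le1 nq (norm_cn_le1 q u).
have bc' := norm_mul_le1 nq' (norm_cn_le1 q' u).
have hd2 : `|dn u q ^+ 2 - dn u q' ^+ 2| <= 2 * eta.
  exact: sub_sqr_le (dn_sqr q01 u) (dn_sqr q01' u) bP bP' hP.
have hd : `|dn u q - dn u q'| <= Num.sqrt (2 * eta).
  apply: le_trans (sub_sqr_sqrt (dn_gt0 q01 u) (dn_gt0 q01' u)) _.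
  exact: ler_wsqrtr.
have T2E r : elaT2 r u = - (2 * (r * sn u r) * dn u r) by rewrite /elaT2; ring.
have kE r : elak r u = - (2 * (r * cn u r)) by rewrite /elak; ring.
have n1 := norm_elaT1 q01 u; have n2 := norm_elaT2 q01 u.
rewrite T2E in n2; rewrite !T2E !kE.
exact: (frame_components_close bP bP' bc bc' (norm_dn_le1 q01 u) (norm_dn_le1 q01' u) hP hc hd hd2 n1 n2).
Qed.

Lemma moc_small (e : R) : 0 < e -> exists2 eta, 0 < eta & moc eta <= e.
Proof.
move=> e0; pose eta := Num.min (e / 32) ((e / 32) ^+ 2 / 2).
have eta0 : 0 < eta by rewrite lt_min !divr_gt0// exprn_gt0// divr_gt0.
exists eta => //; rewrite /moc.
have h1 : eta <= e / 32 by rewrite ge_min lexx.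
have h2 : Num.sqrt (2 * eta) <= e / 32.
  have e16 : 0 <= e / 32 by rewrite divr_ge0// ltW.
  rewrite -[leRHS](ger0_norm e16) -sqrtr_sqr; apply: ler_wsqrtr.
  have : eta <= (e / 32) ^+ 2 / 2 by rewrite ge_min lexx orbT.
  by set z := (e / 32) ^+ 2; lra.
by lra.
Qed.

End Continuity.

(** * Neighbouring arcs as competitors *)

Section ArcUnstable.
Variable R : realType.
Local Notation mu := (@lebesgue_measure R).
Local Notation pt := (R * R)%type.
Implicit Types (q s : R).

Lemma cts_near_small (f : R -> R) (x e : R) : {for x, continuous f} -> f x = 0 -> 0 < e ->
  \forall y \near x, `|f y| <= e.
Proof.
move=> cf f0 e0; have /cvgrPdist_le/(_ e e0) : f y @[y --> x] --> f x by [].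
by apply: filterS => y; rewrite f0 sub0r normrN.
Qed.

Lemma near_interval (x a b : R) : a < x -> x < b -> \forall y \near x, a < y < b.
Proof.
move=> ax xb; near=> y; apply/andP; split; near: y; [exact: lt_nbhsr|exact: lt_nbhsl].
Unshelve. all: by end_near. Qed.

Lemma scale_close (T U rho tol e : R) : `|T - U| <= tol -> `|1 - rho| <= e -> `|U| <= 1 ->
  `|T - rho * U| <= tol + e.
Proof.
move=> h1 h2 h3; rewrite (_ : _ - _ = (T - U) + (1 - rho) * U); last by ring.
apply: le_trans (ler_normD _ _) _; apply: lerD => //.
by rewrite -[leRHS]mulr1; apply: norm_mul_le.
Qed.

Lemma scale_close2 (T U al be tol e : R) : 0 <= al -> `|T - U| <= tol -> `|al - be| <= e ->
  `|U| <= 2 -> `|al * T - be * U| <= al * tol + e * 2.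
Proof.
move=> al0 h1 h2 h3; rewrite (_ : _ - _ = al * (T - U) + (al - be) * U); last by ring.
apply: le_trans (ler_normD _ _) _; apply: lerD; first by rewrite normrM ger0_norm// ler_wpM2l.
by apply: norm_mul_le.
Qed.

Lemma close_trans (x y z a b : R) : `|y - x| <= a -> `|y - z| <= b -> `|x - z| <= a + b.
Proof.
move=> h1 h2; rewrite (_ : x - z = (x - y) + (y - z)); last by ring.
by apply: le_trans (ler_normD _ _) _; apply: lerD => //; rewrite distrC.
Qed.

Lemma norm_centered (z : R) : 0 <= z -> z <= 1 -> `|2 * z - 1| <= 1.
Proof. by move=> z0 z1; rewrite ler_norml; apply/andP; split; lra. Qed.

Lemma tolerance_le (x e eps : R) : 0 <= x -> 0 <= e -> 7 * x + 9 * e = eps ->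
  6 * e + e + e <= eps.
Proof. by move=> x0 e0 <-; lra. Qed.

Lemma tolerance_le2 (a e eps : R) : 0 <= e -> 7 * (a * e) + 9 * e = eps ->
  a * (6 * e + e) + e * 2 <= eps.
Proof.
move=> e0 <-; rewrite (_ : a * (6 * e + e) = 7 * (a * e)); last by ring.
by move: (a * e) => z; lra.
Qed.

Lemma elaG_span q : 0 <= q < 1 -> [/\ elaG1 q (ellK q) - elaG1 q (- ellK q) = 2 * (2 * ellEc q - ellK q),
  elaG2 q (ellK q) - elaG2 q (- ellK q) = 0 &
  elaB q (ellK q) - elaB q (- ellK q) = 8 * (ellEc q - (1 - q ^+ 2) * ellK q)].
Proof.
move=> q01; split.
- by rewrite /elaG1 epsN// epsK//; ring.
- by rewrite /elaG2 cnN// cnK//; ring.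
- by rewrite /elaB epsN// epsK//; ring.
Qed.

Section fixed.
Variables (q0 l lam : R) (g g1 g2 : R -> pt).
Hypothesis q01 : 0 < q0 < 1.
Hypothesis l0 : 0 < l.
Hypothesis W : W22 g g1 g2.
Hypothesis A : in_A l g g1.
Hypothesis P : arclength_param_is g g1 (arc_curve q0 l) (arc_length q0 l).
Hypothesis C0 : 0 < arcC q0.

Let al := arc_alpha q0 l.
Let L := arclen g1 1.
Let K0 := ellK q0.
Let hq := dom01 q01.

Lemma arc_alpha_gt0 : 0 < al.
Proof.
have [_ _ _ _ K0'] := hq.
by rewrite /al /arc_alpha -arcCK// !mulr_gt0 ?invr_gt0.
Qed.

Lemma arc_alphaL : al * L = 2 * K0.
Proof.
rewrite /L (proj1 P) /arc_length -/al -/K0 mulrC divfK//.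
by rewrite gt_eqF// arc_alpha_gt0.
Qed.

Lemma arc_CL : arcC q0 * L = l.
Proof.
have [_ _ _ _ K0'] := hq.
have a0 : al != 0 by rewrite gt_eqF// arc_alpha_gt0.
apply: (mulfI a0); rewrite mulrCA arc_alphaL /al /arc_alpha -arcCK//.
by rewrite -/K0; field; rewrite gt_eqF.
Qed.

Lemma arc_L_gt0 : 0 < L.
Proof. by have := l0; rewrite -arc_CL pmulr_rgt0. Qed.

Let T1 s := elaT1 q0 (al * s + - K0).
Let T2 s := elaT2 q0 (al * s + - K0).
Let k s := al * elak q0 (al * s + - K0).
Let B s := al * elaB q0 (al * s + - K0).

Lemma arc_frame : frame T1 T2 k.
Proof. by have [_ _ q01' _ _] := hq; exact: frame_affine (ela_frame q01'). Qed.

Lemma is_derive_arcB s : is_derive s 1 B (k s ^+ 2).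
Proof.
have [_ _ q01' _ _] := hq.
apply: is_derive_ext (isder_scale al (is_derive_affine al (- K0) s (is_derive_elaB q01'))) _ _ => //.
by rewrite /k; ring.
Qed.

Lemma arc_tan1 t : 0 <= t <= 1 -> (g1 t).1 = T1 (arclen g1 t) * speed g1 t.
Proof.
have [_ _ q01' _ _] := hq; case: (A) => N _ _.
apply: (@tangent_of_curve1 _ _ _ _ _ _ _ W N arc_frame _ (proj2 P)) => s.
by apply: is_derive_arc1 => //; rewrite gt_eqF// arc_alpha_gt0.
Qed.

Lemma arc_tan2 t : 0 <= t <= 1 -> (g1 t).2 = T2 (arclen g1 t) * speed g1 t.
Proof.
have [_ _ q01' _ _] := hq; case: (A) => N _ _.
apply: (@tangent_of_curve2 _ _ _ _ _ _ _ W N arc_frame _ (proj2 P)) => s.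
by apply: is_derive_arc2 => //; rewrite gt_eqF// arc_alpha_gt0.
Qed.

Lemma arc_B_span : B L - B 0 = arcD q0 / L.
Proof.
have [_ _ q01' _ _] := hq; have L0 := arc_L_gt0.
rewrite /B mulr0 add0r arc_alphaL (_ : 2 * K0 + - K0 = K0); last by ring.
rewrite -mulrBr /K0; have [_ _ ->] := elaG_span q01'.
have -> : al = 2 * K0 / L by rewrite -arc_alphaL mulfK// gt_eqF.
by rewrite /arcD -/K0; ring.
Qed.

Lemma arc_energy : energy lam g1 g2 = arcP (lam * l ^+ 2) q0 / l.
Proof.
have [_ _ q01' _ _] := hq; have L0 := arc_L_gt0; case: (A) => N _ _.
rewrite (energyE W N) (bend_frame W N arc_frame arc_tan1 arc_tan2 is_derive_arcB) -/L.
rewrite arc_B_span /arcP -arc_CL; field.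
by rewrite !gt_eqF.
Qed.

Lemma near_modulus_close (e : R) : 0 < e -> \forall q \near q0,
  [/\ 0 < q < 1, `|ellK q - K0| <= e, `|1 - arcC q0 / arcC q| <= e,
      `|al - arcC q0 / arcC q * (2 * ellK q / L)| <= e & 
      forall u, `|u| <= ellK q -> [/\ `|elaT1 q0 u - elaT1 q u| <= e, `|elaT2 q0 u - elaT2 q u| <= e,
      `|elak q0 u * elaT2 q0 u - elak q u * elaT2 q u| <= e &
      `|elak q0 u * elaT1 q0 u - elak q u * elaT1 q u| <= e]].
Proof.
move=> e0; have [q00 q01' q01'' _ K00] := hq.
have L0 := arc_L_gt0; have Cn : arcC q0 != 0 by rewrite gt_eqF.
have dK := is_derive_ellK q01; have dC := is_derive_arcC q01.
have dr := isder_scale (arcC q0) (@isder_inv _ _ _ _ Cn dC).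
have cK : {for q0, continuous (fun q => ellK q - K0)}.
  exact: derive_continuous (isder_sub dK (isder_cst K0 q0)).
have cr : {for q0, continuous (fun q => 1 - arcC q0 / arcC q)}.
  exact: derive_continuous (isder_sub (isder_cst 1 q0) dr).
have ca : {for q0, continuous (fun q => al - arcC q0 / arcC q * (2 * ellK q / L))}.
  have dKL : is_derive q0 1 (fun q => 2 * ellK q / L) (2 / L * ((ellEc q0 - (1 - q0 ^+ 2) * ellK q0) / (q0 * (1 - q0 ^+ 2)))).
    by apply: is_derive_ext (isder_scale (2 / L) dK) _ _ => // z; ring.
  exact: derive_continuous (isder_sub (isder_cst al q0) (isder_mul dr dKL)).
have [eta eta0 heta] := moc_small e0.
pose r := (1 + q0) / 2; have r1 : r < 1 by rewrite /r; lra.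
have q0r : q0 < r by rewrite /r; lra.
pose c := (Num.sqrt (1 - r ^+ 2) ^+ 3)^-1.
have c0 : 0 <= c by rewrite invr_ge0 exprn_ge0// sqrtr_ge0.
(* By [am_lip] the sum of the changes in modulus and amplitude is at most [|q - q0| (1 + c |u|)],
   and [|u| <= ellK q <= K0 + e]. *)
pose m := 1 + c * (K0 + e).
have m0 : 0 < m by rewrite /m ltr_wpDr// mulr_ge0// ltW// addr_gt0.
have cq : {for q0, continuous (fun q => q - q0)}.
  exact: derive_continuous (isder_sub (is_derive_id q0 1) (isder_cst q0 q0)).
have n1 := cts_near_small cK (subrr _) e0.
have n2 : \forall q \near q0, `|1 - arcC q0 / arcC q| <= e.
  by apply: cts_near_small => //; rewrite divff// subrr.
have n3 : \forall q \near q0, `|al - arcC q0 / arcC q * (2 * ellK q / L)| <= e.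
  apply: cts_near_small => //.
  by rewrite divff// mul1r -/K0 -arc_alphaL mulfK ?subrr// gt_eqF.
have n4 := cts_near_small cq (subrr _) (divr_gt0 eta0 m0).
have n5 := near_interval q00 q0r.
near=> q.
have /andP[q_0 q_r] : 0 < q < r by near: q; exact: n5.
have kq : `|ellK q - K0| <= e by near: q; exact: n1.
have Kq : ellK q <= K0 + e by rewrite addrC -lerBlDr; apply: le_trans kq; exact: ler_norm.
have qq : `|q - q0| <= eta / m by near: q; exact: n4.
have q_01 : 0 <= q < 1 by rewrite ltW//= (lt_trans q_r).
split => //.
- by rewrite q_0 (lt_trans q_r).
- by near: q; exact: n2.
- by near: q; exact: n3.
move=> u uK.
have H : `|q - q0| + `|am u q - am u q0| <= eta.
  have q0r' : 0 <= q0 <= r by rewrite !ltW.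
  have qr' : 0 <= q <= r by rewrite !ltW.
  apply: le_trans (lerD (lexx _) (am_lip u q0r' qr' r1)) _.
  rewrite -/c.
  have h : c * `|u| <= c * (K0 + e) by rewrite ler_wpM2l// (le_trans uK).
  rewrite -[leRHS](@divfK _ m) ?gt_eqF//.
  rewrite (_ : _ + _ = `|q - q0| * (1 + c * `|u|)); last by ring.
  by apply: ler_pM => //; [rewrite addr_ge0// mulr_ge0|rewrite lerD2l].
by have [h1 h2 h3 h4] := ela_modulus q01'' q_01 H; split; apply: le_trans heta.
Unshelve. all: by end_near. Qed.

Lemma arc_competitor (eps : R) : 0 < eps -> exists2 d, 0 < d & forall q, `|q - q0| < d ->
  0 < q < 1 -> 0 < arcC q -> arcP (lam * l ^+ 2) q < arcP (lam * l ^+ 2) q0 ->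
  better_competitor lam l g1 T1 T2 k B eps.
Proof.
move=> eps0; have a0 := arc_alpha_gt0; have L0 := arc_L_gt0.
have [q00 q01' q01'' _ K00] := hq.
(* The error budget is [6 e] for shifting the phase, [e] for changing the modulus and [e] for the
   scale. In the curvature terms the first two carry the factor [al] and the last the factor 2; both
   totals stay below [7 al e + 9 e]. *)
pose e := eps / (7 * al + 9).
have den : 0 < 7 * al + 9 by rewrite addr_gt0// mulr_gt0.
have e0 : 0 < e by rewrite divr_gt0.
have eE : 7 * (al * e) + 9 * e = eps by rewrite /e; field; rewrite gt_eqF.
have /nbhs_ballP[d /= d0 hd] := near_modulus_close e0.
exists d => // q qd q_01 Cq lt.
have [_ _ q_01' _ Kq] := dom01 q_01.
have [_ kq rq aq mq] := hd q ltac:(by rewrite /ball/= distrC).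
(* The arc of modulus [q] is built with the same length [L], which fixes the rate [be]; [rho] then
   scales its chord [arcC q * L] to [l]. *)
pose be := 2 * ellK q / L; pose rho := arcC q0 / arcC q.
have be0 : be != 0 by rewrite gt_eqF// divr_gt0// mulr_gt0.
have beL : be * L = 2 * ellK q by rewrite /be divfK// gt_eqF.
have span : be * L + - ellK q = ellK q by rewrite beL; ring.
have span0 : be * 0 + - ellK q = - ellK q by rewrite mulr0 add0r.
have [sp1 sp2 spB] := elaG_span q_01'.
exists rho, (fun s => elaT1 q (be * s + - ellK q)), (fun s => elaT2 q (be * s + - ellK q)),
  (fun s => be * elak q (be * s + - ellK q)),
  (fun s => be^-1 * elaG1 q (be * s + - ellK q)), (fun s => be^-1 * elaG2 q (be * s + - ellK q)),
  (fun s => be * elaB q (be * s + - ellK q)).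
split.
- by rewrite divr_gt0.
- exact: frame_affine (ela_frame q_01').
- split=> s.
  + apply: is_derive_ext (isder_scale be^-1 (is_derive_affine be (- ellK q) s (is_derive_elaG1 q_01'))) _ _ => //.
    by rewrite mulKf.
  + apply: is_derive_ext (isder_scale be^-1 (is_derive_affine be (- ellK q) s (is_derive_elaG2 q_01'))) _ _ => //.
    by rewrite mulKf.
  + apply: is_derive_ext (isder_scale be (is_derive_affine be (- ellK q) s (is_derive_elaB q_01'))) _ _ => //.
    by ring.
- rewrite -/L span span0; split.
  + rewrite -(mulrBr be^-1) sp1 -arcCK// -arc_CL /rho /be; field.
    by rewrite !gt_eqF.
  + by rewrite -(mulrBr be^-1) sp2 !mulr0.
  rewrite -(mulrBr be) spB arc_B_span.
  have e1 : be * (8 * (ellEc q - (1 - q ^+ 2) * ellK q)) / rho + lam * (rho * L) =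
      arcP (lam * l ^+ 2) q / l.
    rewrite /arcP /arcD -arc_CL /rho /be; field.
    by rewrite !gt_eqF.
  have e2 : arcD q0 / L + lam * L = arcP (lam * l ^+ 2) q0 / l.
    by rewrite /arcP -arc_CL; field; rewrite !gt_eqF.
  by rewrite e1 e2 ltr_pM2r ?invr_gt0.
- move=> s /andP[s0 sL].
  (* At equal arclength both phases are the same fraction [2 s / L - 1] of their quarter periods, so
     they differ by at most [|ellK q - K0|]. *)
  pose u0 := al * s + - K0; pose u := be * s + - ellK q.
  have h1 : `|2 * (s / L) - 1| <= 1.
    by apply: norm_centered; [rewrite divr_ge0// ltW|rewrite ler_pdivrMr ?mul1r].
  have uE : u = ellK q * (2 * (s / L) - 1) by rewrite /u /be; ring.
  have u0E : u0 = K0 * (2 * (s / L) - 1).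
    by rewrite /u0 (_ : al = 2 * K0 / L); [ring|rewrite -arc_alphaL mulfK// gt_eqF].
  have uK : `|u| <= ellK q by rewrite uE normrM gtr0_norm// ler_piMr// ltW.
  have du : 6 * `|u - u0| <= 6 * e.
    rewrite ler_wpM2l// uE u0E -mulrBl normrM -[leRHS]mulr1; exact: ler_pM.
  have [m1 m2 m3 m4] := mq u uK.
  have c1 := close_trans (le_trans (elaT1_lip q01'' u0 u) du) m1.
  have c2 := close_trans (le_trans (elaT2_lip q01'' u0 u) du) m2.
  have c3 := close_trans (le_trans (elakT2_lip q01'' u0 u) du) m3.
  have c4 := close_trans (le_trans (elakT1_lip q01'' u0 u) du) m4.
  have b1 := norm_elaT1 q_01' u; have b2 := norm_elaT2 q_01' u.
  have bk := norm_elak q_01' u.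
  have b3 : `|elak q u * elaT2 q u| <= 2 by rewrite -[leRHS]mulr1; exact: norm_mul_le.
  have b4 : `|elak q u * elaT1 q u| <= 2 by rewrite -[leRHS]mulr1; exact: norm_mul_le.
  have tol1 : 6 * e + e + e <= eps.
    by apply: tolerance_le eE; rewrite ltW// mulr_gt0.
  have tol2 : al * (6 * e + e) + e * 2 <= eps.
    by apply: tolerance_le2 eE; exact: ltW.
  split.
  + exact: le_trans (scale_close c1 rq b1) tol1.
  + exact: le_trans (scale_close c2 rq b2) tol1.
  + have := scale_close2 (ltW a0) c3 aq b3 => /le_trans/(_ tol2).
    by rewrite -/u0 -/u /T2 /k -/u0 -!mulrA.
  + have := scale_close2 (ltW a0) c4 aq b4 => /le_trans/(_ tol2).
    by rewrite -/u0 -/u /T1 /k -/u0 -!mulrA.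
Qed.

Lemma arc_unstable : (forall d, 0 < d -> exists q, [/\ `|q - q0| < d, 0 < q < 1, 0 < arcC q &
    arcP (lam * l ^+ 2) q < arcP (lam * l ^+ 2) q0]) -> ~ stable lam l g g1 g2.
Proof.
move=> H; apply: (unstable_of_competitors W A arc_frame arc_tan1 arc_tan2 is_derive_arcB) => eps eps0.
have [d d0 hd] := arc_competitor eps0.
by have [q [h1 h2 h3 h4]] := H d d0; exact: hd h1 h2 h3 h4.
Qed.

End fixed.
End ArcUnstable.

(** * Instability of loops *)

Section LoopUnstable.
Variable R : realType.
Local Notation mu := (@lebesgue_measure R).
Local Notation pt := (R * R)%type.
Implicit Types (q s : R).

Lemma rotate_close (x X y p w tol d M : R) : `|x - X| <= tol -> `|X| <= M -> `|y| <= M ->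
  `|1 - p| <= d -> `|w| <= d -> `|x - (p * X - w * y)| <= tol + (d * M + d * M).
Proof.
move=> h1 h2 h3 h4 h5.
rewrite (_ : _ - _ = (x - X) + ((1 - p) * X + w * y)); last by ring.
apply: le_trans (ler_normD _ _) _; apply: lerD => //.
by apply: le_trans (ler_normD _ _) _; apply: lerD; exact: norm_mul_le.
Qed.

Lemma tolerance_rotate (al e eps : R) : 0 <= al -> 0 <= e -> (12 + 12 * al) * e <= eps ->
  [/\ 6 * e + (e * 1 + e * 1) <= eps & al * (6 * e + (e * 2 + e * 2)) <= eps].
Proof.
move=> a0 e0 h; have ae : 0 <= al * e by exact: mulr_ge0.
rewrite (_ : (12 + 12 * al) * e = 12 * e + 12 * (al * e)) in h; last by ring.
split; first by move: h ae e0; move: (al * e) => z; lra.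
rewrite (_ : al * _ = 10 * (al * e)); last by ring.
by move: h ae e0; move: (al * e) => z; lra.
Qed.

Lemma cn_gt0 q u : 0 <= q < 1 -> - ellK q < u -> u < ellK q -> 0 < cn u q.
Proof.
move=> q01 h1 h2; rewrite /cn; apply: cos_gt0_pihalf.
by rewrite -(amK q01) -(amN _ q01) !am_lt.
Qed.

(* Tilting a chord [(l, Y)] of length [r] back to the horizontal and rescaling it to length [l]
   is the linear map with matrix [[p, -w], [w, p]]. *)
Lemma chord_rotation (l Y e : R) : 0 < l -> Y != 0 -> `|Y| / l <= e -> e <= 1 ->
  let r := Num.sqrt (l ^+ 2 + Y ^+ 2) in
  [/\ l < r, r ^+ 2 = l ^+ 2 + Y ^+ 2, r <= l * (1 + e), `|1 - l / r * (l / r)| <= e &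
      `|l / r * (- Y / r)| <= e].
Proof.
move=> l0 Y0 Ye e1 /=; set r := Num.sqrt _.
have e0 : 0 <= e by apply: le_trans Ye; rewrite divr_ge0// ltW.
have YY : 0 < Y ^+ 2 by rewrite exprn_even_gt0.
have r2 : r ^+ 2 = l ^+ 2 + Y ^+ 2 by rewrite sqr_sqrtr// addr_ge0// sqr_ge0.
have r0 : 0 <= r by exact: sqrtr_ge0.
have lr : l < r.
  by rewrite -(@ltr_pXn2r _ 2)// ?nnegrE// ?ltW// r2 ltrDl.
have rp : 0 < r by exact: lt_trans lr.
have rn : r != 0 by rewrite gt_eqF.
have Yle : `|Y| <= l * e by rewrite mulrC -ler_pdivrMr.
have Yr : `|Y| / r <= e.
  by apply: le_trans Ye; rewrite ler_wpM2l// lef_pV2 ?posrE// ltW.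
have lr1 : l / r <= 1 by rewrite ler_pdivrMr// mul1r ltW.
have lr0 : 0 <= l / r by rewrite divr_ge0// ltW.
split=> //.
- rewrite -(@ler_pXn2r _ 2)// ?nnegrE ?mulr_ge0 ?addr_ge0// ?(ltW l0)// r2.
  have : Y ^+ 2 <= (l * e) ^+ 2 by rewrite -(real_normK (num_real Y)) ler_sqr// nnegrE mulr_ge0// ltW.
  have : 0 <= l ^+ 2 * e by rewrite mulr_ge0// sqr_ge0.
  rewrite (_ : (l * (1 + e)) ^+ 2 = l ^+ 2 + 2 * (l ^+ 2 * e) + (l * e) ^+ 2); last by ring.
  by move: (l ^+ 2 * e) ((l * e) ^+ 2) (l ^+ 2) (Y ^+ 2) => x y z t; lra.
- rewrite (_ : 1 - _ = (`|Y| / r) ^+ 2).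
    by rewrite ger0_norm ?sqr_ge0// expr2 (le_trans _ Yr)// ler_piMr// ?(le_trans Yr)// divr_ge0.
  rewrite exprMn real_normK ?num_real// (_ : Y ^+ 2 = r ^+ 2 - l ^+ 2); last by rewrite r2; ring.
  by field.
- rewrite normrM (ger0_norm lr0) -[leRHS]mul1r; apply: ler_pM => //.
  by rewrite normrM normrN normfV (ger0_norm r0).
Qed.

Section fixed.
Variables (q l lam : R) (g g1 g2 : R -> pt).
Hypothesis q01 : 0 < q < 1.
Hypothesis l0 : 0 < l.
Hypothesis W : W22 g g1 g2.
Hypothesis A : in_A l g g1.
Hypothesis P : arclength_param_is g g1 (loop_curve q l) (loop_length q l).
Hypothesis KE : 0 < ellK q - 2 * ellEc q.
Hypothesis gl : gq q = lam * l ^+ 2.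

Let al := loop_alpha q l.
Let L := arclen g1 1.
Let K := ellK q.
Let hq := dom01 q01.

Lemma loop_alpha_gt0 : 0 < al.
Proof. by rewrite /al /loop_alpha !mulr_gt0 ?invr_gt0. Qed.

Lemma loop_alphaL : al * L = 2 * K.
Proof.
by rewrite /L (proj1 P) /loop_length -/al -/K mulrC divfK// gt_eqF// loop_alpha_gt0.
Qed.

Let T1 s := - elaT1 q (al * s + - K).
Let T2 s := elaT2 q (al * s + - K).
Let k s := - (al * elak q (al * s + - K)).
Let B s := al * elaB q (al * s + - K).

Let fr (be : R) : frame (fun s => - elaT1 q (al * s + be)) (fun s => elaT2 q (al * s + be))
  (fun s => - (al * elak q (al * s + be))).
Proof. by have [_ _ q01' _ _] := hq; exact: frame_reflect (frame_affine al be (ela_frame q01')). Qed.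

Let dB be s : is_derive s 1 (fun s => al * elaB q (al * s + be)) ((- (al * elak q (al * s + be))) ^+ 2).
Proof.
have [_ _ q01' _ _] := hq.
apply: is_derive_ext (isder_scale al (is_derive_affine al be s (is_derive_elaB q01'))) _ _ => //.
by ring.
Qed.

Let dH1 be s : is_derive s 1 (fun s => - al^-1 * elaG1 q (al * s + be)) (- elaT1 q (al * s + be)).
Proof.
have [_ _ q01' _ _] := hq.
apply: is_derive_ext (isder_scale (- al^-1) (is_derive_affine al be s (is_derive_elaG1 q01'))) _ _ => //.
by rewrite mulNr mulKf// gt_eqF// loop_alpha_gt0.
Qed.

Let dH2 be s : is_derive s 1 (fun s => al^-1 * elaG2 q (al * s + be)) (elaT2 q (al * s + be)).
Proof.
have [_ _ q01' _ _] := hq.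
apply: is_derive_ext (isder_scale al^-1 (is_derive_affine al be s (is_derive_elaG2 q01'))) _ _ => //.
by rewrite mulKf// gt_eqF// loop_alpha_gt0.
Qed.

Lemma loop_tan1 t : 0 <= t <= 1 -> (g1 t).1 = T1 (arclen g1 t) * speed g1 t.
Proof.
have [_ _ q01' _ _] := hq; case: (A) => N _ _.
apply: (@tangent_of_curve1 _ _ _ _ _ _ _ W N (fr (- K)) _ (proj2 P)) => s.
by apply: is_derive_loop1 => //; rewrite gt_eqF// loop_alpha_gt0.
Qed.

Lemma loop_tan2 t : 0 <= t <= 1 -> (g1 t).2 = T2 (arclen g1 t) * speed g1 t.
Proof.
have [_ _ q01' _ _] := hq; case: (A) => N _ _.
apply: (@tangent_of_curve2 _ _ _ _ _ _ _ W N (fr (- K)) _ (proj2 P)) => s.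
by apply: is_derive_loop2 => //; rewrite gt_eqF// loop_alpha_gt0.
Qed.

Let beta := al * (8 * (ellEc q - (1 - q ^+ 2) * K)).

Lemma loop_beta_gt0 : 0 < beta.
Proof.
have [_ _ q01' _ _] := hq; rewrite /beta mulr_gt0 ?loop_alpha_gt0// mulr_gt0// subr_gt0.
exact: ellE_gtK.
Qed.

Lemma loop_L_gt0 : 0 < L.
Proof.
have [_ _ _ _ K0] := hq; have a0 := loop_alpha_gt0.
by rewrite -(pmulr_rgt0 _ a0) loop_alphaL mulr_gt0.
Qed.

(** [lam L - beta = 4 al (K - 2 E)]. Since [beta] is the bending energy, the left side is the
    derivative of [beta / rho + lam rho L] at [rho = 1]: shrinking the loop lowers its energy to
    first order. *)
Lemma loop_beta_lt : beta < lam * L.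
Proof.
have [_ _ _ _ K0] := hq; have a0 := loop_alpha_gt0; have L0 := loop_L_gt0.
have alE : al * l = 2 * (K - 2 * ellEc q) by rewrite /al /loop_alpha -/K; field; rewrite gt_eqF.
have ln : l != 0 by rewrite gt_eqF.
have LE : L = 2 * K / al by rewrite -loop_alphaL mulrAC divff ?mul1r// gt_eqF.
have lamE : lam = 2 * al ^+ 2 * (2 * q ^+ 2 - 1).
  apply: (mulIf (expf_neq0 2 ln)); rewrite -gl /gq -/K.
  rewrite (_ : 2 * al ^+ 2 * (2 * q ^+ 2 - 1) * l ^+ 2 = 2 * (al * l) ^+ 2 * (2 * q ^+ 2 - 1)); last by ring.
  by rewrite alE; ring.
rewrite lamE LE (_ : _ * (2 * K / al) = al * (4 * K * (2 * q ^+ 2 - 1))); last by field; rewrite gt_eqF.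
rewrite /beta ltr_pM2l//.
have : 0 < K - 2 * ellEc q by [].
by move: (q ^+ 2) K (ellEc q) => x y z; nra.
Qed.

(** Translation by [2 K] changes the sign of [cn] and adds [2 E] to [eps_], so only the vertical
    span depends on the position of the window. *)
Lemma ela_shift_span e : [/\ elaG1 q (K + e) - elaG1 q (- K + e) = 4 * ellEc q - 2 * K,
  elaG2 q (K + e) - elaG2 q (- K + e) = - (4 * q * cn (- K + e) q) &
  elaB q (K + e) - elaB q (- K + e) = 8 * (ellEc q - (1 - q ^+ 2) * K)].
Proof.
have [_ _ q01' _ _] := hq.
have E : K + e = (- K + e) + 2 * ellK q by rewrite -/K; ring.
rewrite /elaG1 /elaG2 /elaB E epsD2K// cnD2K// -/K.
by split; ring.
Qed.

Lemma loop_competitor (eps : R) : 0 < eps -> better_competitor lam l g1 T1 T2 k B eps.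
Proof.
move=> eps0; have a0 := loop_alpha_gt0; have L0 := loop_L_gt0.
have [q00 q01' q01'' _ K0] := hq.
have b0 := loop_beta_gt0; have bL := loop_beta_lt.
have an : al != 0 by rewrite gt_eqF.
(* The bound 1 is what [chord_rotation] asks for; the second term secures closeness, the third keeps
   [beta r < lam L l] for chords [r <= l (1 + d)]. *)
pose d := Num.min 1 (Num.min (eps / (12 + 12 * al)) ((lam * L - beta) / (2 * beta))).
have den : 0 < 12 + 12 * al by rewrite addr_gt0// mulr_gt0.
have d0 : 0 < d by rewrite !lt_min ltr01/= !divr_gt0// ?subr_gt0// mulr_gt0.
have d1 : d <= 1 by rewrite ge_min lexx.
have dtol : (12 + 12 * al) * d <= eps.
  by rewrite mulrC -ler_pdivlMr// !ge_min lexx orbT.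
have dbeta : beta * (1 + d) < lam * L.
  have : d <= (lam * L - beta) / (2 * beta) by rewrite !ge_min lexx !orbT.
  have b2 : 0 < 2 * beta by exact: mulr_gt0.
  rewrite (ler_pdivlMr _ _ b2).
  by rewrite (_ : d * (2 * beta) = 2 * (beta * d)); [|ring]; rewrite mulrDr mulr1; move: bL; move: (beta * d) => z; lra.
(* The vertical span created by sliding the window by [e]. It is 0 at [e = 0] and nonzero for
   [0 < e < 2 K]. *)
pose Y (e : R) := - (4 * q / al * cn (- K + e) q).
have cY : {for 0, continuous (fun e => Y e / l)}.
  have dY : is_derive (0 : R) 1 (fun e => Y e / l) (- (4 * q / al) / l * (1 * - (sn (1 * 0 + - K) q * dn (1 * 0 + - K) q))).
    apply: is_derive_ext (isder_scale (- (4 * q / al) / l) (is_derive_affine 1 (- K) 0 (is_derive_cn q01''))) _ _ => //.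
    by move=> z; rewrite /Y mul1r [- K + z]addrC; ring.
  exact: derive_continuous dY.
have Y0 : Y 0 / l = 0 by rewrite /Y addr0 cnN// cnK// !(mulr0, oppr0, mul0r).
have n1 := cts_near_small cY Y0 d0.
have ci : {for (0 : R), continuous (fun e : R => e)} by exact: derive_continuous (is_derive_id (0 : R) 1).
have n2 := cts_near_small ci erefl d0.
near (0 : R)^'+ => e.
have Yd : `|Y e / l| <= d by near: e; apply: cvg_within; exact: n1.
have ed : `|e| <= d by near: e; apply: cvg_within; exact: n2.
have e_0 : 0 < e by [].
have eK : e < 2 * K by near: e; apply: nbhs_right_lt; rewrite mulr_gt0.
have Yn : Y e != 0.
  rewrite /Y oppr_eq0 !mulf_neq0// ?invr_eq0// ?gt_eqF//.
  by apply: cn_gt0 => //; rewrite -/K; move: e_0 eK; move: K => z; lra.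
have Yd' : `|Y e| / l <= d by move: Yd; rewrite normrM normfV (gtr0_norm l0).
have /= [lr r2 rle pd wd] := chord_rotation l0 Yn Yd' d1.
set r := Num.sqrt _ in lr r2 rle pd wd.
have r0 : 0 < r by exact: lt_trans lr.
have rn : r != 0 by rewrite gt_eqF.
have ln : l != 0 by rewrite gt_eqF.
(* [a] is at once the scale factor and the cosine of the rotation, so the composed linear map has
   entries [a a] and [a b]. *)
pose a := l / r; pose b := - Y e / r.
have ab : a ^+ 2 + b ^+ 2 = 1.
  rewrite /a /b !exprMn sqrrN exprVn -mulrDl -r2 divff// expf_neq0//.
have [sp1 sp2 spB] := ela_shift_span e.
have span : al * L + (- K + e) = K + e by rewrite loop_alphaL; ring.
have span0 : al * 0 + (- K + e) = - K + e by rewrite mulr0 add0r.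
pose H1 (s : R) := - al^-1 * elaG1 q (al * s + (- K + e)).
pose H2 (s : R) := al^-1 * elaG2 q (al * s + (- K + e)).
have H1s : H1 L - H1 0 = l.
  rewrite /H1 span span0 -mulrBr sp1 /al /loop_alpha -/K; field.
  by rewrite ln gt_eqF.
have H2s : H2 L - H2 0 = Y e.
  by rewrite /H2 span span0 -mulrBr sp2 /Y; ring.
exists a, (fun s => a * - elaT1 q (al * s + (- K + e)) - b * elaT2 q (al * s + (- K + e))),
  (fun s => b * - elaT1 q (al * s + (- K + e)) + a * elaT2 q (al * s + (- K + e))),
  (fun s => - (al * elak q (al * s + (- K + e)))), (fun s => a * H1 s - b * H2 s),
  (fun s => b * H1 s + a * H2 s), (fun s => al * elaB q (al * s + (- K + e))).
split.
- by rewrite divr_gt0.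
- exact: frame_rotate ab (fr _).
- split=> [s|s|]; last exact: dB.
  + exact: isder_sub (isder_scale a (dH1 _ _)) (isder_scale b (dH2 _ _)).
  + exact: isder_add (isder_scale b (dH1 _ _)) (isder_scale a (dH2 _ _)).
- split.
  + rewrite -/L (_ : _ - _ = a * (H1 L - H1 0) - b * (H2 L - H2 0)); last by ring.
    rewrite H1s H2s /a /b (_ : _ - _ = (l ^+ 2 + Y e ^+ 2) / r); last by ring.
    by rewrite -r2; field.
  + rewrite -/L (_ : _ - _ = b * (H1 L - H1 0) + a * (H2 L - H2 0)); last by ring.
    by rewrite H1s H2s /a /b; ring.
  have [z1 z2 zB] := ela_shift_span 0; rewrite !addr0 in zB.
  rewrite -/L span span0 -(mulrBr al) spB -/beta /B mulr0 add0r.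
  rewrite loop_alphaL (_ : 2 * K + - K = K); last by ring.
  rewrite -(mulrBr al) zB -/beta /a.
  have h1 : beta * r < lam * L * l.
    apply: le_lt_trans (_ : beta * (l * (1 + d)) < _); first by rewrite ler_pM2l.
    by rewrite mulrCA mulrC ltr_pM2r.
  (* The energy difference between the scales [l / r] and 1 contains the positive factor [r - l],
     which leaves the sign of [beta r - lam L l]. *)
  have h2 : (beta / (l / r) + lam * (l / r * L)) - (beta + lam * L) =
      (beta * r - lam * L * l) * (r - l) / (l * r).
    by field; rewrite ln rn.
  rewrite -subr_lt0 h2 pmulr_llt0 ?invr_gt0 ?mulr_gt0// nmulr_rlt0 ?subr_lt0//.
  by rewrite subr_gt0.
move=> s _; pose u0 := al * s + - K; pose u := al * s + (- K + e).
have du : u - u0 = e by rewrite /u /u0; ring.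
have lip (f : R -> R) : (forall x y, `|f y - f x| <= 6 * `|y - x|) -> `|f u0 - f u| <= 6 * d.
  by move=> hf; rewrite distrC; apply: le_trans (hf _ _) _; rewrite du ler_pM2l.
have c1 := lip _ (elaT1_lip q01''); have c2 := lip _ (elaT2_lip q01'').
have c3 := lip _ (elakT2_lip q01''); have c4 := lip _ (elakT1_lip q01'').
rewrite /= in c1 c2 c3 c4.
have b1 := norm_elaT1 q01'' u; have b2 := norm_elaT2 q01'' u.
have bk := norm_elak q01'' u.
have b3 : `|elak q u * elaT2 q u| <= 2 by rewrite -[leRHS]mulr1; exact: norm_mul_le.
have b4 : `|elak q u * elaT1 q u| <= 2 by rewrite -[leRHS]mulr1; exact: norm_mul_le.
have wd' : `|- (a * b)| <= d by rewrite normrN.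
have [t1 t2] := tolerance_rotate (ltW a0) (ltW d0) dtol.
rewrite /T1 /T2 /k -/u0 -/u; move: (elaT1 q u0) (elaT2 q u0) (elak q u0) (elaT1 q u) (elaT2 q u) (elak q u) c1 c2 c3 c4 b1 b2 bk b3 b4 => x1 x2 x3 y1 y2 y3 c1 c2 c3 c4 b1 b2 bk b3 b4.
split.
- apply: le_trans t1; rewrite (_ : _ - _ = - (x1 - (a * a * y1 - - (a * b) * y2))); last by ring.
  by rewrite normrN; exact: rotate_close.
- apply: le_trans t1; rewrite (_ : _ - _ = x2 - (a * a * y2 - a * b * y1)); last by ring.
  exact: rotate_close.
- apply: le_trans t2.
  rewrite (_ : _ - _ = - al * (x3 * x2 - (a * a * (y3 * y2) - a * b * (y3 * y1)))); last by ring.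
  by rewrite normrM normrN (gtr0_norm a0) ler_pM2l//; exact: rotate_close.
- apply: le_trans t2.
  rewrite (_ : _ - _ = al * (x3 * x1 - (a * a * (y3 * y1) - - (a * b) * (y3 * y2)))); last by ring.
  by rewrite normrM (gtr0_norm a0) ler_pM2l//; exact: rotate_close.
Unshelve. all: by end_near. Qed.

Lemma loop_unstable : ~ stable lam l g g1 g2.
Proof.
exact: (unstable_of_competitors W A (fr (- K)) loop_tan1 loop_tan2 (dB (- K)) loop_competitor).
Qed.

End fixed.
End LoopUnstable.

(** * Stability of the longer arc *)

Section Landscape.
Variable R : realType.
Implicit Types (q x y t h r : R).

(** Stated along [x + t h] so that the step [h] may have either sign. *)
Lemma MVT_ray (f df : R -> R) x h :
  (forall t, 0 <= t <= 1 -> is_derive (x + t * h) 1 f (df (x + t * h))) ->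
  exists2 t, 0 < t < 1 & f (x + h) - f x = df (x + t * h) * h.
Proof.
move=> d.
have dphi t : 0 <= t <= 1 -> is_derive t 1 (fun t => f (x + t * h)) (df (x + t * h) * h).
  move=> t01; have da : is_derive t 1 (fun t => x + t * h) h.
    by apply: is_derive_ext (isder_add (isder_cst x t) (isder_scale h (is_derive_id t 1))) _ _ => [z|]; ring.
  exact: (@isder_comp _ f (fun t => x + t * h) t _ _ (d t t01) da).
have [t t01 E] : exists2 t, t \in `]0, 1[%R & f (x + 1 * h) - f (x + 0 * h) = df (x + t * h) * h * (1 - 0).
  apply: (@MVT _ (fun t => f (x + t * h)) (fun t => df (x + t * h) * h)) => //.
    by move=> t; rewrite in_itv/= => /andP[t0 t1]; apply: dphi; rewrite !ltW.
  apply: derivable_within_continuous => t; rewrite in_itv/= => t01.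
  by have [] := dphi t t01.
exists t; first by move: t01; rewrite in_itv.
by move: E; rewrite mul1r mul0r addr0 subr0 mulr1.
Qed.

(* At a critical point of [arcP] the second order behaviour is governed by the sign of [fq]. *)
Lemma arcP_second_order kap q h : gq q = kap ->
  (forall t, 0 <= t <= 1 -> 0 < q + t * h < 1 /\ 0 < arcC (q + t * h)) ->
  exists2 t, 0 < t < 1 & exists2 m, 0 < m & arcP kap (q + h) - arcP kap q = - (m * fq (q + t * h) * h ^+ 2).
Proof.
move=> gk H.
have [t /andP[t0 t1] ->] := MVT_ray (df := fun y => arcdC y / arcC y ^+ 2 * (gq y - kap))
  (fun t t01 => is_derive_arcP kap (proj1 (H t t01)) (lt0r_neq0 (proj2 (H t t01)))).
have st s : 0 <= s <= 1 -> 0 <= s * t <= 1.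
  by move=> /andP[s0 s1]; rewrite mulr_ge0 ?(ltW t0)//= mulr_ile1// ltW.
pose dg (y : R) := 16 * (2 * ellEc y - ellK y) * fq y / (y * (1 - y ^+ 2)).
(* Because [gq q = kap], the factor [gq y - kap] is itself an increment of [gq] over the step [t h];
   a second mean value theorem yields the square of [h]. *)
have [|s /andP[s0 s1]] := @MVT_ray (@gq R) dg q (t * h).
  by move=> s s01; rewrite mulrA; exact: is_derive_gq (proj1 (H _ (st s s01))).
rewrite gk => ->; rewrite mulrA /dg.
have t01 : 0 <= t <= 1 by rewrite !ltW.
have s01 : 0 <= s <= 1 by rewrite !ltW.
have [q01 Cq] := H _ t01; have [q01' Cq'] := H _ (st s s01).
set y := q + t * h in q01 Cq *; set z := q + s * t * h in q01' Cq' *.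
have [z0 z1 _ zz Kz] := dom01 q01'.
have EK : 0 < 2 * ellEc z - ellK z by rewrite -arcCK// mulr_gt0.
exists (s * t); first by rewrite mulr_gt0//= mulr_ilt1// ltW.
exists (- arcdC y / arcC y ^+ 2 * (16 * (2 * ellEc z - ellK z) / (z * (1 - z ^+ 2))) * t).
  by rewrite !mulr_gt0 ?invr_gt0 ?exprn_gt0 ?oppr_gt0 ?arcdC_lt0 ?mulr_gt0.
by rewrite (mulrA s t h) -/z; ring.
Qed.

Lemma near_arcC_gt0 q : 0 < q < 1 -> 0 < arcC q ->
  exists2 r, 0 < r & forall y, `|y - q| < r -> 0 < y < 1 /\ 0 < arcC y.
Proof.
move=> q01 Cq; have [q0 q1 _ _ _] := dom01 q01.
have cC : {for q, continuous (fun y => arcC y - arcC q)}.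
  exact: derive_continuous (isder_sub (is_derive_arcC q01) (isder_cst (arcC q) q)).
have C2 : 0 < arcC q / 2 by rewrite divr_gt0.
have n1 := cts_near_small cC (subrr _) C2; have n2 := near_interval q0 q1.
have /nbhs_ballP[r /= r0 hr] : \forall y \near q, 0 < y < 1 /\ 0 < arcC y.
  apply: filterS2 n1 n2 => y; rewrite ler_norml => /andP[h _] h2; split=> //.
  by move: h C2; lra.
by exists r => // y yq; apply: hr; rewrite /ball/= distrC.
Qed.

(** To the right of its zero [a], [fq] is negative, which makes every increment of [arcP]
    nonnegative; capping the radius by [q - a] keeps the intermediate point on that side. *)
Lemma arc_local_min kap a q : 1 / 2 <= a ^+ 2 -> 0 < a < 1 -> fq a = 0 -> a < q ->
  0 < q < 1 -> 0 < arcC q -> gq q = kap ->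
  exists2 r, 0 < r & forall y, `|y - q| < r ->
    [/\ 0 < y < 1, 0 < arcC y & arcP kap q <= arcP kap y].
Proof.
move=> a2 a01 fa aq q01 Cq gk; have [_ fneg] := fq_sign a2 a01 fa.
have [r r0 hr] := near_arcC_gt0 q01 Cq.
have r'0 : 0 < Num.min r (q - a) by rewrite lt_min r0 subr_gt0.
exists (Num.min r (q - a)) => // y; rewrite lt_min => /andP[yr ya].
have [y01 Cy] := hr y yr; split=> //.
have nt t : 0 <= t <= 1 -> `|t * (y - q)| <= `|y - q|.
  by move=> /andP[t0 t1]; rewrite normrM ger0_norm// ler_piMl.
have sub t : q + t * (y - q) - q = t * (y - q) by rewrite addrAC subrr add0r.
have H t : 0 <= t <= 1 -> 0 < q + t * (y - q) < 1 /\ 0 < arcC (q + t * (y - q)).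
  by move=> t01; apply: hr; rewrite sub (le_lt_trans (nt t t01)).
have [t /andP[t0 t1] [m m0]] := arcP_second_order gk H.
rewrite (_ : q + (y - q) = y); last by ring.
move=> E; rewrite -subr_ge0 E oppr_ge0 mulr_le0_ge0 ?sqr_ge0// mulr_ge0_le0 ?(ltW m0)//.
have t01 : 0 <= t <= 1 by rewrite !ltW.
have n : `|t * (y - q)| < Num.min r (q - a) by rewrite (le_lt_trans (nt t t01))// lt_min yr.
rewrite ltW// fneg//.
  move: n; rewrite lt_min => /andP[_]; rewrite ltr_norml => /andP[+ _].
  by move: (t * (y - q)) => z; lra.
by have [/andP[]] := hr (q + t * (y - q)) ltac:(by rewrite sub; move: n; rewrite lt_min => /andP[]).
Qed.

Lemma arcP_descent kap q h : gq q = kap ->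
  (forall t, 0 <= t <= 1 -> 0 < q + t * h < 1 /\ 0 < arcC (q + t * h)) -> h != 0 ->
  (forall t, 0 < t < 1 -> 0 < fq (q + t * h)) -> arcP kap (q + h) < arcP kap q.
Proof.
move=> gk H h0 fp; have [t t01 [m m0 E]] := arcP_second_order gk H.
have h2 : 0 < h ^+ 2 by rewrite exprn_even_gt0.
by rewrite -subr_lt0 E oppr_lt0; apply: mulr_gt0 => //; apply: mulr_gt0 => //; exact: fp.
Qed.

(** The step must enter a region where [fq] is positive. For [q < a] it goes to the right, towards
    [a]. At the double point [q = a] it goes to the left, and the strict bound [1 / 2 < a ^+ 2]
    leaves room for it above [1 / sqrt 2]. *)
Lemma arc_not_local_min kap a q : 1 / 2 <= q ^+ 2 -> 0 < q -> q <= a -> a < 1 -> fq a = 0 ->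
  1 / 2 < a ^+ 2 -> 0 < arcC q -> gq q = kap -> forall d, 0 < d ->
  exists y, [/\ `|y - q| < d, 0 < y < 1, 0 < arcC y & arcP kap y < arcP kap q].
Proof.
move=> q2 q0 qa a1 fa a2 Cq gk d d0.
have q01 : 0 < q < 1 by rewrite q0 (le_lt_trans qa).
have a0 : 0 < a by exact: lt_le_trans qa.
have a01 : 0 < a < 1 by rewrite a0.
have [fpos _] := fq_sign (ltW a2) a01 fa.
have [r r0 hr] := near_arcC_gt0 q01 Cq.
suff [h [h0 hd hf]] : exists h, [/\ h != 0, `|h| < Num.min d r & forall t, 0 < t < 1 -> 0 < fq (q + t * h)].
  move: hd; rewrite lt_min => /andP[hd hhr].
  have sub z : q + z - q = z by rewrite addrAC subrr add0r.
  have H t : 0 <= t <= 1 -> 0 < q + t * h < 1 /\ 0 < arcC (q + t * h).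
    move=> /andP[t0 t1]; apply: hr; rewrite sub; apply: le_lt_trans hhr.
    by rewrite normrM ger0_norm// ler_piMl.
  have [|h1 h2] := H 1; first by rewrite ler01 lexx.
  exists (q + h); rewrite sub; split=> //; [by move: h1; rewrite mul1r|by move: h2; rewrite mul1r|].
  exact: arcP_descent.
have m0 : 0 < Num.min d r by rewrite lt_min d0.
move: qa; rewrite le_eqVlt => /orP[/eqP qa|qa].
  have sq : Num.sqrt (1 / 2) < q.
    rewrite -(@ltr_pXn2r _ 2)// ?nnegrE ?sqrtr_ge0 ?(ltW q0)// sqr_sqrtr; last by rewrite divr_ge0.
    by rewrite qa.
  have s0 : 0 < Num.sqrt (1 / 2 : R) by rewrite sqrtr_gt0 divr_gt0.
  pose e := Num.min (Num.min d r) (q - Num.sqrt (1 / 2)) / 2.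
  have e0 : 0 < e by rewrite divr_gt0// lt_min m0 subr_gt0.
  have em : e < Num.min (Num.min d r) (q - Num.sqrt (1 / 2)).
    by rewrite /e ltr_pdivrMr// ltr_pMr ?ltr1n// lt_min m0 subr_gt0.
  move: em; rewrite lt_min => /andP[em es].
  exists (- e); split; first by rewrite oppr_eq0 gt_eqF.
    by rewrite normrN gtr0_norm.
  move=> t /andP[t0 t1]; have te : t * e < e by rewrite gtr_pMl.
  have te0 : 0 < t * e by rewrite mulr_gt0.
  have h1 : Num.sqrt (1 / 2) < q + t * - e.
    by rewrite mulrN; move: te es; move: (t * e) (Num.sqrt _) => x y; lra.
  have h2 : 0 < q + t * - e by exact: lt_trans h1.
  apply: fpos => //; last by rewrite -qa mulrN gtrDl oppr_lt0.
  rewrite -[1 / 2]sqr_sqrtr; last by rewrite divr_ge0.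
  by rewrite ler_sqr ?nnegrE ?sqrtr_ge0// ltW.
pose e := Num.min (Num.min d r) (a - q) / 2.
have e0 : 0 < e by rewrite divr_gt0// lt_min m0 subr_gt0.
have em : e < Num.min (Num.min d r) (a - q).
  by rewrite /e ltr_pdivrMr// ltr_pMr ?ltr1n// lt_min m0 subr_gt0.
move: em; rewrite lt_min => /andP[em es].
exists e; split; first by rewrite gt_eqF.
  by rewrite gtr0_norm.
move=> t /andP[t0 t1]; have te : t * e < e by rewrite gtr_pMl.
have te0 : 0 < t * e by rewrite mulr_gt0.
apply: fpos; first by rewrite addr_gt0.
  by apply: le_trans q2 _; rewrite ler_sqr ?nnegrE ?addr_ge0 ?lerDl// ltW.
by move: te es; move: (t * e) => x; lra.
Qed.

End Landscape.

(** * Comparison with all nearby curves *)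

Section Stable.
Variable R : realType.
Local Notation mu := (@lebesgue_measure R).
Local Notation pt := (R * R)%type.
Implicit Types (q s t : R).

Lemma planar_norm_sub (x y x' y' : R) :
  (Num.sqrt (x ^+ 2 + y ^+ 2) - Num.sqrt (x' ^+ 2 + y' ^+ 2)) ^+ 2 <= (x - x') ^+ 2 + (y - y') ^+ 2.
Proof.
set a := Num.sqrt _; set b := Num.sqrt _.
have a0 : 0 <= a by exact: sqrtr_ge0.
have b0 : 0 <= b by exact: sqrtr_ge0.
have a2 : a ^+ 2 = x ^+ 2 + y ^+ 2 by rewrite sqr_sqrtr// addr_ge0// sqr_ge0.
have b2 : b ^+ 2 = x' ^+ 2 + y' ^+ 2 by rewrite sqr_sqrtr// addr_ge0// sqr_ge0.
have cs : x * x' + y * y' <= a * b.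
  apply: le_trans (ler_norm _) _.
  rewrite -(@ler_pXn2r _ 2)// ?nnegrE ?mulr_ge0// real_normK ?num_real// exprMn a2 b2 -subr_ge0.
  rewrite (_ : _ - _ = (x * y' - y * x') ^+ 2); last by ring.
  exact: sqr_ge0.
rewrite (_ : (a - b) ^+ 2 = a ^+ 2 + b ^+ 2 - 2 * (a * b)); last by ring.
rewrite a2 b2 -subr_ge0 (_ : _ - _ = 2 * (a * b - (x * x' + y * y'))); last by ring.
by rewrite mulr_ge0// subr_ge0.
Qed.

(** A substitute for Cauchy-Schwarz: if [z^2] has integral at most [e^2] over [[0, 1]], then [|z|]
    has integral at most [e / 2 + e / 2]. *)
Lemma young (e z : R) : 0 < e -> `|z| <= e / 2 + (2 * e)^-1 * z ^+ 2.
Proof.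
move=> e0; rewrite -(real_normK (num_real z)) -subr_ge0.
rewrite (_ : _ - _ = (2 * e)^-1 * (`|z| - e) ^+ 2); last by field; rewrite gt_eqF.
by rewrite mulr_ge0 ?sqr_ge0// invr_ge0 mulr_ge0// ltW.
Qed.

Section two_curves.
Variables (g g1 g2 h h1 h2 : R -> pt).
Hypothesis Wg : W22 g g1 g2.
Hypothesis Wh : W22 h h1 h2.
Hypothesis Ng : forall t, 0 <= t <= 1 -> g1 t != (0, 0).
Hypothesis Nh : forall t, 0 <= t <= 1 -> h1 t != (0, 0).

Let D t := ((g t).1 - (h t).1) ^+ 2 + ((g t).2 - (h t).2) ^+ 2
      + ((g1 t).1 - (h1 t).1) ^+ 2 + ((g1 t).2 - (h1 t).2) ^+ 2
      + ((g2 t).1 - (h2 t).1) ^+ 2 + ((g2 t).2 - (h2 t).2) ^+ 2.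

Lemma W22_dist_integrable : mu.-integrable `[0, 1] (EFin \o D).
Proof.
have sub_cts (p r P Q : R -> R) : abscont 0 1 P p -> abscont 0 1 Q r ->
    mu.-integrable `[0, 1] (EFin \o (fun t => (P t - Q t) ^+ 2)).
  move=> AP AQ; have c := AC_cts (AC_add AP (AC_scale (-1) AQ)).
  have := within_cts_integrable (within_cts_mul c c).
  by apply: eq_integrable_itv => t _; ring.
have i1 := sub_cts _ _ _ _ (W22_AC01 Wg) (W22_AC01 Wh).
have i2 := sub_cts _ _ _ _ (W22_AC02 Wg) (W22_AC02 Wh).
have i3 := sub_cts _ _ _ _ (W22_AC1 Wg) (W22_AC1 Wh).
have i4 := sub_cts _ _ _ _ (W22_AC2 Wg) (W22_AC2 Wh).
have i5 := sqr_sub_integrable (W22_AC1 Wg).1 (W22_AC1 Wh).1 (W22_sqr1 Wg) (W22_sqr1 Wh).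
have i6 := sqr_sub_integrable (W22_AC2 Wg).1 (W22_AC2 Wh).1 (W22_sqr2 Wg) (W22_sqr2 Wh).
exact: integrable_add (integrable_add (integrable_add (integrable_add (integrable_add i1 i2) i3) i4) i5) i6.
Qed.

Lemma W22_dist_arclen (e : R) : 0 < e -> W22_dist g g1 g2 h h1 h2 < e ->
  `|arclen h1 1 - arclen g1 1| <= e.
Proof.
move=> e0; rewrite /W22_dist -[X in Num.sqrt X]/(\int[mu]_(t in `[0, 1]) D t) => dist.
have iD := W22_dist_integrable.
have D0 t : 0 <= D t by rewrite !addr_ge0// sqr_ge0.
have I0 : 0 <= \int[mu]_(t in `[0, 1]) D t by apply: Rintegral_ge0 => t _.
have I2 : \int[mu]_(t in `[0, 1]) D t <= e ^+ 2.
  by rewrite -(sqr_sqrtr I0) ler_sqr ?nnegrE ?sqrtr_ge0// ltW.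
have AC1 := AC_add (AC_arclen Wh Nh) (AC_scale (-1) (AC_arclen Wg Ng)).
have := AC_le_norm AC1 (lexx 0) ler01 (lexx 1).
rewrite !arclen0 mulr0 addr0 subr0 mulN1r => /le_trans; apply.
have i1 : mu.-integrable `[0, 1] (EFin \o (fun=> 1 : R)).
  by apply: within_cts_integrable; exact: within_cts_cst.
apply: le_trans (_ : \int[mu]_(t in `[0, 1]) (e / 2 * 1 + (2 * e)^-1 * D t) <= _).
  apply: le_Rintegral_itv; first by apply: integrable_normr; exact: AC1.1.
    exact: integrable_lin.
  move=> t _; rewrite mulN1r mulr1; apply: le_trans (young _ e0) _.
  rewrite lerD2l ler_wpM2l//; first by rewrite invr_ge0 mulr_ge0// ltW.
  rewrite -sqrrN opprB; apply: le_trans (planar_norm_sub _ _ _ _) _.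
  rewrite /D -!addrA.
  have := (sqr_ge0 ((g t).1 - (h t).1), sqr_ge0 ((g t).2 - (h t).2),
    sqr_ge0 ((g2 t).1 - (h2 t).1), sqr_ge0 ((g2 t).2 - (h2 t).2)) => -[[[s1 s2] s3] s4].
  by rewrite addrA ler_wpDl ?addr_ge0// addrA ler_wpDr ?addr_ge0.
rewrite Rintegral_lin// [X in _ * X](_ : _ = 1); last first.
  have E : 1 - 0 = \int[mu]_(t in `[0, 1]) (1 : R) := (@AC_id R 0 1).2 0 1 (lexx 0) ler01 (lexx 1).
  by rewrite -E subr0.
have : (2 * e)^-1 * \int[mu]_(t in `[0, 1]) D t <= (2 * e)^-1 * e ^+ 2.
  by rewrite ler_wpM2l// invr_ge0 mulr_ge0// ltW.
rewrite (_ : (2 * e)^-1 * e ^+ 2 = e / 2); last by field; rewrite gt_eqF.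
by move: (_ * \int[mu]_(t in _) _) => z; lra.
Qed.

End two_curves.

Lemma window_le (C L L' e l : R) : 0 < C -> e <= (l - C * L) / C -> L' - L <= e -> C * L' <= l.
Proof.
move=> C0 h1 h2; have := le_trans h2 h1.
by rewrite ler_pdivlMr// mulrC mulrBr; move: (C * L') (C * L) => x y; lra.
Qed.

Lemma window_ge (C L L' e l : R) : 0 < C -> e <= (C * L - l) / C -> - e <= L' - L -> l <= C * L'.
Proof.
move=> C0 h1 h2; have : L - L' <= (C * L - l) / C by apply: le_trans h1; move: h2; lra.
by rewrite ler_pdivlMr// mulrC mulrBr; move: (C * L') (C * L) => x y; lra.
Qed.

Lemma arcC_lt q q' : 0 < q -> q < q' -> q' < 1 -> arcC q' < arcC q.
Proof.
move=> q0 qq q1.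
have in01 t : 0 <= t <= 1 -> 0 < q + t * (q' - q) < 1.
  move=> /andP[t0 t1]; have d0 : 0 < q' - q by rewrite subr_gt0.
  rewrite ltr_wpDr ?mulr_ge0 ?(ltW d0)//=; apply: le_lt_trans q1.
  by rewrite -lerBrDl ler_piMl// ltW.
have [t /andP[t0 t1]] := MVT_ray (f := @arcC R) (df := @arcdC R) (fun t t01 => is_derive_arcC (in01 t t01)).
rewrite (_ : q + (q' - q) = q'); last by ring.
move=> E; rewrite -subr_lt0 E nmulr_rlt0 ?subr_gt0// arcdC_lt0// in01//.
by rewrite !ltW.
Qed.

Lemma arc_stable (a q0 l lam : R) (g g1 g2 : R -> pt) : 0 < l ->
  1 / 2 <= a ^+ 2 -> 0 < a < 1 -> fq a = 0 -> a < q0 -> 0 < q0 < 1 -> 0 < arcC q0 ->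
  gq q0 = lam * l ^+ 2 -> W22 g g1 g2 -> in_A l g g1 ->
  arclength_param_is g g1 (arc_curve q0 l) (arc_length q0 l) -> stable lam l g g1 g2.
Proof.
move=> l0 a2 a01 fa aq q01 C0 gk W A P.
have [r r0 hr] := arc_local_min a2 a01 fa aq q01 C0 gk.
have CL := arc_CL q01 l0 P C0; have L0 := arc_L_gt0 q01 l0 P C0.
have r2 : 0 < r / 2 by rewrite divr_gt0.
have r2r : r / 2 < r by rewrite ltr_pdivrMr// ltr_pMr ?ltr1n.
have [pp Cp _] := hr (q0 + r / 2) ltac:(by rewrite addrAC subrr add0r gtr0_norm).
have [pm Cm _] := hr (q0 - r / 2) ltac:(by rewrite addrAC subrr add0r normrN gtr0_norm).
have /andP[q00 q01'] := q01; have /andP[_ pp1] := pp; have /andP[pm0 _] := pm.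
have ltp : arcC (q0 + r / 2) < arcC q0 by apply: arcC_lt => //; rewrite ltrDl.
have ltm : arcC q0 < arcC (q0 - r / 2) by apply: arcC_lt => //; rewrite gtrDl oppr_lt0.
set Cpl := arcC (q0 + r / 2) in Cp ltp; set Cmi := arcC (q0 - r / 2) in Cm ltm.
set L := arclen g1 1 in CL L0.
pose e := Num.min ((l - Cpl * L) / Cpl) ((Cmi * L - l) / Cmi).
have e0 : 0 < e.
  by rewrite lt_min !divr_gt0// subr_gt0 -CL ltr_pM2r.
exists e => // h h1 h2 Wh Ah dist; case: (A) (Ah) => Ng _ _ [Nh h00 h1l].
have := W22_dist_arclen W Wh Ng Nh e0 dist; rewrite ler_norml -/L => /andP[e1 e2].
set Lh := arclen h1 1 in e1 e2.
have Lh0 : 0 < Lh by exact: arclen_gt0 Wh Nh.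
have hp : Cpl * Lh <= l by apply: window_le Cp _ e2; rewrite ge_min lexx.
have hm : l <= Cmi * Lh by apply: window_ge Cm _ e1; rewrite ge_min lexx orbT.
have [y ry CyL] : exists2 y, y \in `[q0 - r / 2, q0 + r / 2]%R & arcC y = l / Lh.
  apply: IVT.
  - by apply: (@le_trans _ _ q0); rewrite ?gerDl ?lerDl ?oppr_le0 ltW.
  - apply: derivable_within_continuous => z; rewrite in_itv/= => /andP[z1 z2].
    have z01 : 0 < z < 1 by rewrite (lt_le_trans pm0 z1) (le_lt_trans z2 pp1).
    by have [] := is_derive_arcC z01.
  - have h1' : Cpl <= l / Lh by rewrite ler_pdivlMr.
    have h2' : l / Lh <= Cmi by rewrite ler_pdivrMr.
    by apply/andP; split; [rewrite ge_min h1' orbT|rewrite le_max h2'].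
have [|y01 Cy Pmin] := hr y.
  apply: le_lt_trans r2r; rewrite ler_norml; move: ry; rewrite in_itv/= => /andP[y1 y2].
  by apply/andP; split; move: y1 y2; lra.
have [y0 y1 y01' _ Ky] := dom01 y01.
have CyL' : arcC y * Lh = l by rewrite CyL divfK// gt_eqF.
have lb := bend_lower_bound Wh Nh y01' (ltW l0) h00 h1l y0 CyL'.
rewrite (arc_energy lam q01 l0 W A P C0) (energyE Wh Nh).
apply: (@le_trans _ _ (arcP (lam * l ^+ 2) y / l)); first by rewrite ler_pM2r// invr_gt0.
apply: le_trans (lerD lb (lexx _)).
rewrite le_eqVlt; apply/orP; left; apply/eqP.
rewrite -/Lh /arcP -CyL'; field.
by rewrite !gt_eqF.
Qed.

Lemma bend_ge0 (h1 h2 : R -> pt) : 0 <= bend h1 h2.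
Proof.
by apply: Rintegral_ge0 => t _; rewrite mulr_ge0 ?sqr_ge0// invr_ge0 exprn_ge0// speed_ge0.
Qed.

Lemma arclen_ge_chord (l : R) (h h1 h2 : R -> pt) : W22 h h1 h2 -> in_A l h h1 -> l <= arclen h1 1.
Proof.
move=> W [N h00 h1l]; have A := W22_AC01 W.
have : (h 1).1 - (h 0).1 = l by rewrite h00 h1l subr0.
rewrite (A.2 0 1)// => <-; apply: le_Rintegral_itv; [exact: A.1|exact: speed_integrable W N|].
move=> t _; apply: le_trans (ler_norm _) _; rewrite -sqrtr_sqr; apply: ler_wsqrtr.
by rewrite lerDl sqr_ge0.
Qed.

Lemma ellE_modulus0 : @ellEc R 0 = ellK 0.
Proof.
rewrite /ellEc /ellK /ellE /ellF; congr oint; apply/funext => t.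
by rewrite expr0n mul0r subr0 sqrtr1 invr1.
Qed.

(* The modulus [0], which is also the value of [q2] when it is undefined, is the straight segment. *)
Lemma segment_stable (l lam : R) (g g1 g2 : R -> pt) : 0 < l -> 0 < lam ->
  W22 g g1 g2 -> in_A l g g1 ->
  arclength_param_is g g1 (arc_curve 0 l) (arc_length 0 l) -> stable lam l g g1 g2.
Proof.
move=> l0 lam0 W A [PL Pc].
have q01 : (0 <= (0 : R)) && ((0 : R) < 1) by rewrite lexx ltr01.
have K0 := ellK_gt0 q01.
have alE : arc_alpha 0 l = 2 * ellK 0 / l by rewrite /arc_alpha ellE_modulus0; ring.
have al0 : arc_alpha 0 l != 0 by rewrite gt_eqF// alE divr_gt0// mulr_gt0.
have Ll : arclen g1 1 = l.
  by rewrite PL /arc_length alE; field; rewrite !gt_eqF.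
have [N _ _] := A.
have F := frame_affine (arc_alpha 0 l) (- ellK 0) (ela_frame q01).
have tan1 := tangent_of_curve1 W N F Pc (fun s => is_derive_arc1 q01 s al0).
have tan2 := tangent_of_curve2 W N F Pc (fun s => is_derive_arc2 q01 s al0).
have dB s : is_derive s 1 (fun=> 0 : R) ((arc_alpha 0 l * elak 0 (arc_alpha 0 l * s + - ellK 0)) ^+ 2).
  rewrite /elak mulr0 mul0r oppr0 mulr0 expr0n; exact: isder_cst.
exists 1 => // h h1 h2 Wh Ah _; have [Nh _ _] := Ah.
rewrite (energyE W N) (energyE Wh Nh) (bend_frame W N F tan1 tan2 dB) subrr Ll.
by apply: lerD; [exact: bend_ge0|rewrite ler_pM2l//; exact: arclen_ge_chord Wh Ah].
Qed.

End Stable.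

(** * The chosen parameters and their default values *)

Section Branches.
Variable R : realType.
Implicit Types (q c l : R).

Local Notation s2 := (Num.sqrt (2 : R))^-1.

Lemma sqrtV2_gt0 : 0 < s2. Proof. by rewrite invr_gt0 sqrtr_gt0. Qed.

Lemma sqrtV2_sqr : s2 ^+ 2 = 1 / 2.
Proof. by rewrite exprVn sqr_sqrtr// div1r. Qed.

Lemma sqr_ge_half q : s2 <= q -> 1 / 2 <= q ^+ 2.
Proof.
by move=> h; have s0 := ltW sqrtV2_gt0; rewrite -sqrtV2_sqr ler_sqr ?nnegrE// (le_trans s0).
Qed.

Lemma sqr_gt_half q : s2 < q -> 1 / 2 < q ^+ 2.
Proof.
move=> h; rewrite -sqrtV2_sqr ltr_pXn2r// ?nnegrE; first exact: ltW sqrtV2_gt0.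
by apply: le_trans (ltW h); exact: ltW sqrtV2_gt0.
Qed.

Lemma gq_sqrtV2 : gq s2 = 0.
Proof. by rewrite /gq sqrtV2_sqr; rewrite (_ : 2 * (1 / 2) - 1 = 0) ?mulr0//; field. Qed.

(** Positivity of [lamhat] excludes both degenerate values of [qhat]: [gq] vanishes at [1 / sqrt 2]
    and equals [- 8 (2 E - K)^2] at the default 0. *)
Lemma qhat_spec : 0 < lamhat R -> [/\ s2 < qhat R, qhat R < 1 & fq (qhat R) = 0].
Proof.
rewrite /lamhat /qhat; case: xgetP => [a _ [/andP[a1 a2] fa]|none].
  move=> ga; split=> //; rewrite lt_neqAle a1 andbT; apply/eqP => E.
  by move: ga; rewrite -E gq_sqrtV2 ltxx.
rewrite /gq expr0n mulr0 sub0r mulrN1 oppr_gt0 => h.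
by have := sqr_ge0 (2 * ellEc 0 - ellK (0 : R)); lra.
Qed.

Lemma qstar_ge0 : 0 <= qstar R.
Proof. by rewrite /qstar; case: xgetP => [a _ [/andP[/ltW]]|]. Qed.

Lemma qstar_lt1 : qstar R < 1.
Proof. by rewrite /qstar; case: xgetP => [a _ [/andP[]]|]. Qed.

(** [gq] takes the values 0 at [1 / sqrt 2] and [lamhat] at [qhat], so the set from which [q1] is
    chosen is inhabited by the intermediate value theorem. *)
Lemma q1_spec c : 0 < c -> c <= lamhat R -> [/\ s2 < q1 c, q1 c <= qhat R & gq (q1 c) = c].
Proof.
move=> c0 cl; have [a1 a2 fa] := qhat_spec (lt_le_trans c0 cl).
have [q] : exists2 q, q \in `[s2, qhat R]%R & gq q = c.
  apply: IVT; first exact: ltW.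
  - apply: derivable_within_continuous => z; rewrite in_itv/= => /andP[z1 z2].
    have z01 : 0 < z < 1 by rewrite (lt_le_trans sqrtV2_gt0 z1) (le_lt_trans z2).
    by have [] := is_derive_gq z01.
  - by rewrite gq_sqrtV2 -/(lamhat R) ge_min (ltW c0) le_max cl orbT.
rewrite in_itv/= => /andP[h1 h2] gc.
have ex : exists q, s2 < q <= qhat R /\ gq q = c.
  exists q; split=> //; rewrite h2 andbT lt_neqAle h1 andbT; apply/eqP => E.
  by move: c0; rewrite -gc -E gq_sqrtV2 ltxx.
by have [/andP[]] := xgetPex 0 ex.
Qed.

(** The strict bound [c < lamhat] separates [q2 c] from [qhat]. The alternative 0 is the default of
    the choice and leads to [segment_stable]. *)
Lemma q2_spec c : 0 < c -> c < lamhat R ->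
  [/\ qhat R < q2 c, q2 c < 1 & gq (q2 c) = c] \/ q2 c = 0.
Proof.
move=> c0 cl; rewrite /q2; case: xgetP => [q _ [/andP[h1 h2] gc]|none]; last by right.
left; split=> //; last exact: lt_trans qstar_lt1.
rewrite lt_neqAle h1 andbT; apply/eqP => E.
by move: cl; rewrite -gc -E ltxx.
Qed.

Lemma q3_spec c : [/\ 0 < q3 c, q3 c < 1 & gq (q3 c) = c] \/ q3 c = 0.
Proof.
rewrite /q3; case: xgetP => [q _ [/andP[h1 h2] gc]|none]; last by right.
by left; split=> //; exact: le_lt_trans qstar_ge0 h1.
Qed.

(** [arc_length] has the sign of [2 E - K]. A curve that realizes the arc has positive length, so
    this sign is obtained without locating [q] relative to [qstar]. *)
Lemma arc_length_gt0 q l : 0 <= q < 1 -> 0 < l -> 0 < arc_length q l -> 0 < 2 * ellEc q - ellK q.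
Proof.
move=> q01 l0; have K0 := ellK_gt0 q01.
rewrite /arc_length pmulr_rgt0 ?mulr_gt0// invr_gt0 /arc_alpha pmulr_rgt0//.
by rewrite divr_gt0.
Qed.

Lemma loop_length_gt0 q l : 0 <= q < 1 -> 0 < l -> 0 < loop_length q l -> 0 < ellK q - 2 * ellEc q.
Proof.
move=> q01 l0; have K0 := ellK_gt0 q01.
rewrite /loop_length pmulr_rgt0 ?mulr_gt0// invr_gt0 /loop_alpha pmulr_rgt0//.
by rewrite divr_gt0.
Qed.

Lemma arcC_gt0 q : 0 < q < 1 -> 0 < 2 * ellEc q - ellK q -> 0 < arcC q.
Proof.
by move=> q01; have [_ _ _ _ K0] := dom01 q01; rewrite -arcCK// pmulr_lgt0.
Qed.

Lemma sarc_unstable (lam l : R) (g g1 g2 : R -> R * R) : 0 < lam -> 0 < l ->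
  W22 g g1 g2 -> in_A l g g1 -> lam * l ^+ 2 <= lamhat R ->
  arclength_param_is g g1 (sarc lam l) (sarc_len lam l) -> ~ stable lam l g g1 g2.
Proof.
move=> lam0 l0 W A cl P.
have c0 : 0 < lam * l ^+ 2 by rewrite mulr_gt0// exprn_gt0.
have [h1 h2 gc] := q1_spec c0 cl.
have [a1 a2 fa] := qhat_spec (lt_le_trans c0 cl).
move: P; rewrite /sarc /sarc_len; set q := q1 _ in h1 h2 gc * => P.
have q0 : 0 < q by exact: lt_trans sqrtV2_gt0 h1.
have q01 : 0 < q < 1 by rewrite q0 (le_lt_trans h2).
have [_ _ q01' _ _] := dom01 q01.
have Cq : 0 < arcC q.
  apply: arcC_gt0 => //; apply: (arc_length_gt0 q01' l0); rewrite -(proj1 P).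
  by case: A => N _ _; exact: arclen_gt0 W N.
apply: (arc_unstable q01 l0 W A P Cq) => d d0.
exact: arc_not_local_min (sqr_ge_half (ltW h1)) q0 h2 a2 fa (sqr_gt_half a1) Cq gc d d0.
Qed.

Lemma larc_stable (lam l : R) (g g1 g2 : R -> R * R) : 0 < lam -> 0 < l ->
  W22 g g1 g2 -> in_A l g g1 -> lam * l ^+ 2 < lamhat R ->
  arclength_param_is g g1 (larc lam l) (larc_len lam l) -> stable lam l g g1 g2.
Proof.
move=> lam0 l0 W A cl P.
have c0 : 0 < lam * l ^+ 2 by rewrite mulr_gt0// exprn_gt0.
have [a1 a2 fa] := qhat_spec (lt_trans c0 cl).
move: P; rewrite /larc /larc_len; have [[h1 h2 gc]|->] := q2_spec c0 cl; last exact: segment_stable.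
set q := q2 _ in h1 h2 gc * => P.
have a0 : 0 < qhat R by exact: lt_trans sqrtV2_gt0 a1.
have q01 : 0 < q < 1 by rewrite (lt_trans a0).
have [_ _ q01' _ _] := dom01 q01.
have Cq : 0 < arcC q.
  apply: arcC_gt0 => //; apply: (arc_length_gt0 q01' l0); rewrite -(proj1 P).
  by case: A => N _ _; exact: arclen_gt0 W N.
by apply: (arc_stable l0 (sqr_ge_half (ltW a1)) _ fa h1 q01 Cq gc W A P); rewrite a0.
Qed.

Lemma loop_not_stable (lam l : R) (g g1 g2 : R -> R * R) : 0 < lam -> 0 < l ->
  W22 g g1 g2 -> in_A l g g1 ->
  arclength_param_is g g1 (loop lam l) (loop_len lam l) -> ~ stable lam l g g1 g2.
Proof.
move=> lam0 l0 W A.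
have L0 : 0 < arclen g1 1 by case: A => N _ _; exact: arclen_gt0 W N.
(* The default modulus 0 is contradictory: there [E = K], so [loop_length] would be negative. *)
rewrite /loop /loop_len; have [[h1 h2 gc]|->] := q3_spec (lam * l ^+ 2); last first.
  have q01 : (0 <= (0 : R)) && ((0 : R) < 1) by rewrite lexx ltr01.
  move=> [PL _]; rewrite PL in L0.
  have := loop_length_gt0 q01 l0 L0; rewrite ellE_modulus0.
  by have := ellK_gt0 q01; lra.
set q := q3 _ in h1 h2 gc * => P.
have q01 : 0 < q < 1 by rewrite h1.
have [_ _ q01' _ _] := dom01 q01.
have KE : 0 < ellK q - 2 * ellEc q by apply: (loop_length_gt0 q01' l0); rewrite -(proj1 P).
exact: loop_unstable q01 l0 W A P KE gc.
Qed.

End Branches.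

Theorem theorem3p6 (R : realType) (lam l : R) (g g1 g2 : R -> R * R) :
  0 < lam -> 0 < l ->
  W22 g g1 g2 -> in_A l g g1 -> pp_elastica lam g1 g2 ->
  [/\ (0 < lam * l ^+ 2 < lamhat R ->
         arclength_param_is g g1 (larc lam l) (larc_len lam l) ->
         stable lam l g g1 g2),
      (0 < lam * l ^+ 2 < lamhat R ->
         arclength_param_is g g1 (sarc lam l) (sarc_len lam l) ->
         ~ stable lam l g g1 g2),
      (lam * l ^+ 2 = lamhat R ->
         arclength_param_is g g1 (sarc lam l) (sarc_len lam l) ->
         arclength_param_is g g1 (larc lam l) (larc_len lam l) ->
         ~ stable lam l g g1 g2) &
      (arclength_param_is g g1 (loop lam l) (loop_len lam l) ->
         ~ stable lam l g g1 g2)].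
Proof.
move=> lam0 l0 W A _; split.
- by move=> /andP[_ cl]; exact: larc_stable.
- by move=> /andP[_ /ltW cl]; exact: sarc_unstable.
(* The double point is the case of equality in the bound [lam l^2 <= lamhat] of [sarc_unstable]. *)
- by move=> E P _; apply: sarc_unstable P => //; rewrite E.
- exact: loop_not_stable.
Qed.
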